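(* For every real $u\ge 1$, $$ |\omega(u)-e^{-\gamma}|<\rho(u)<\tilde{\rho}(u),\qquad |\omega'(u)|\le\rho(u)<\tilde{\rho}(u). $$
   Context: Dickman's function $\rho:[0,\infty)\to\mathbb{R}$ is the continuous solution of the delay differential equation $u\rho'(u)+\rho(u-1)=0$ for $u>1$, with initial condition $\rho(u)=1$ for $0\le u\le 1$. Buchstab's function $\omega:[1,\infty)\to\mathbb{R}$ is the unique continuous solution of the delay differential equation $(u\omega(u))'=\omega(u-1)$ for $u>2$, with initial condition $\omega(u)=1/u$ for $1\le u\le 2$. At $u=1$ and $u=2$, where $\omega$ need not be two-sidedly differentiable, $\omega'(u)$ is understood as a one-sided derivative (the right derivative at $u=1$; either one at $u=2$). For $u>1$, $\xi=\xi(u)$ denotes the unique positive solution of $e^{\xi}=1+u\xi$, and $\xi(1)=0$. Define $I(s):=\int_0^s\frac{e^z-1}{z}\,dz$ (an entire function, the integrand having a removable singularity at $0$). Let $\gamma$ be Euler's constant and, for $u\ge 1$, $$\tilde{\rho}(u):=\frac{\exp\{\gamma-u\xi+I(\xi)\}}{\sqrt{2\pi I''(\xi)}},\qquad \xi=\xi(u).$$ *)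

(* Defs.v *)
From Stdlib Require Import Reals.
From Coquelicot Require Import Coquelicot.
Open Scope R_scope.

(* [rho] and [omega] live on [0,oo) and [1,oo); they are encoded as total
   functions on R whose values outside those half-lines are unconstrained, so
   continuity is taken relative to the half-line. *)

Definition is_dickman (rho : R -> R) : Prop :=
  continuous_on (fun u => 0 <= u) rho
  /\ (forall u, 0 <= u <= 1 -> rho u = 1)
  /\ (forall u, 1 < u -> exists d, is_derive rho u d /\ u * d + rho (u - 1) = 0).

Definition is_buchstab (omega : R -> R) : Prop :=
  continuous_on (fun u => 1 <= u) omega
  /\ (forall u, 1 <= u <= 2 -> omega u = 1 / u)
  /\ (forall u, 2 < u -> is_derive (fun v => v * omega v) u (omega (u - 1))).

Definition is_right_derive (f : R -> R) (x d : R) : Prop :=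
  filterlim (fun y => (f y - f x) / (y - x)) (at_right x) (locally d).

Definition is_left_derive (f : R -> R) (x d : R) : Prop :=
  filterlim (fun y => (f y - f x) / (y - x)) (at_left x) (locally d).

(* [d] is an admissible value of omega'(u) for u >= 1.  At u = 2 the two
   one-sided derivatives of Buchstab's function differ, and both are admissible. *)
Definition is_buchstab_derive (omega : R -> R) (u d : R) : Prop :=
  (u = 1 /\ is_right_derive omega u d)
  \/ (u = 2 /\ (is_left_derive omega u d \/ is_right_derive omega u d))
  \/ (u <> 1 /\ u <> 2 /\ is_derive omega u d).

Definition is_xi (xi : R -> R) : Prop :=
  xi 1 = 0
  /\ (forall u, 1 < u -> 0 < xi u /\ exp (xi u) = 1 + u * xi u).

Definition I_integrand (z : R) : R :=
  if Req_EM_T z 0 then 1 else (exp z - 1) / z.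

Definition I (s : R) : R := RInt I_integrand 0 s.

Definition euler_gamma : R :=
  real (Lim_seq (fun n => sum_n_m (fun k => / INR k) 1 n - ln (INR n))).

Definition rho_tilde (xi : R -> R) (u : R) : R :=
  exp (euler_gamma - u * xi u + I (xi u)) / sqrt (2 * PI * Derive_n I 2 (xi u)).

(* Main.v *)
(** Let [lam := - rho' / rho].  It is increasing, so [rho] is log-concave.  With
    [u = I'(xi)], log-concavity and [u rho(u) = \int_{u-1}^u rho] force
    [v |-> rho(u - v) - rho(u) e^{xi v}] to change sign once on [0, 1], from + to -.
    Put [Theta(z) := e^{-I(z)} \int_0^u rho(t) e^{zt} dt].  The delay equation and the
    sign change give [Theta'(z) <= - rho(u) M(z) (I'(z) - u) / (z - xi)] with
    [M(z) := e^{uz - I(z)}], while [Theta(-oo) = e^gamma] and [Theta >= 0].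
    Integrating, with [D(y) := I(xi + y) - I(xi) - u y],
      [e^gamma >= rho(u) M(xi) \int D'(y) e^{-D(y)} / y dy].
    The last integral exceeds [sqrt (2 pi I''(xi))]: since [I''] is log-convex,
    [D(y) >= A (e^{my} - 1 - m y)] with [A m^2 = I''(xi)], and the two solutions
    [y > 0 > - z] of [e^y - 1 - y = t^2 / 2] satisfy [1/y + 1/z >= 2/t], which
    reduces the integral to a Gaussian one.  Hence [rho < rho_tilde].

    For Buchstab's function, [u omega'(u) = omega(u - 1) - omega(u)] and the integral
    equation for [rho] give [|omega'| <= rho] inductively.  The Laplace transform
    of [omega] gives [omega(oo) = lim x e^{I(-x)} = e^{-gamma}], and
    [\int_u^oo rho < rho(u)] because [rho(u) + \int_0^u rho] decreases. *)

(* No improper integral occurs. Almost every integral inequality is phrased as the monotonicity of a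
   function whose derivative has a known sign, and limits at infinity are taken along the integers
   or replaced by one explicit large argument. The equation [exp xi = 1 + u * xi] says [I'(xi) = u],
   so [xi] is the saddle point of [I(z) - u z], and [D], [D'] vanish at 0. A Laplace expansion there
   would only be asymptotic; a bound for every [u >= 1] needs the errors on the two sides of the
   saddle to compensate. Two devices achieve this. A lower bound for [D] says nothing about
   [D' e^{-D} / y], but after an integration by parts the integrand is [(1 - e^{-D}) / y^2], which
   increases with [D]. Its weight is [dy / y^2 = - d(1/y)], which is why the sum [1/y + 1/z] of the
   reciprocals is what matters. The two roots have no closed form, so an algebraic curve replaces
   them: it satisfies only an inequality in the transcendental equation, but its reciprocals add up
   to exactly [2/t]. *)
Require Import Defs.
From Stdlib Require Import Reals Lra Lia.
From Coquelicot Require Import Coquelicot.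
Open Scope R_scope.

(* Coquelicot often types an equation in a canonical structure over [R], which
   [ring] and [field] do not recognize. *)
Ltac eqR := match goal with |- @eq _ ?a ?b => change (@eq R a b) end.

Ltac rewD D :=
  lazymatch type of D with
  | is_derive ?f ?x ?l =>
      let H := fresh in
      assert (H : Derive (fun y => f y) x = l) by (apply is_derive_unique; exact D);
      rewrite H; clear H
  end.

(** * Calculus on an interval *)

Lemma MVT_open (f : R -> R) (a b : R) :
  a < b ->
  (forall x, a <= x <= b -> continuous f x) ->
  (forall x, a < x < b -> ex_derive f x) ->
  exists c, a < c < b /\ f b - f a = Derive f c * (b - a).
Proof.
  intros Hab Hc Hd.
  assert (pr1 : forall c, a < c < b -> derivable_pt f c).
  { intros c Hx. apply ex_derive_Reals_0. auto. }
  assert (pr2 : forall c, a < c < b -> derivable_pt id c).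
  { intros c _. apply derivable_pt_id. }
  destruct (MVT f id a b pr1 pr2 Hab) as (c & Hcab & E).
  - intros c Hx. apply continuity_pt_filterlim, Hc, Hx.
  - intros c _. apply derivable_continuous_pt, derivable_pt_id.
  - exists c. split; [exact Hcab|].
    rewrite Derive_Reals in E.
    assert (D : derive_pt id c (pr2 c Hcab) = 1).
    { rewrite (pr_nu id c (pr2 c Hcab) (derivable_pt_id c)). apply derive_pt_id. }
    rewrite D in E. unfold id in E. lra.
Qed.

(** Differentiability is asked only strictly inside the interval: [rho] has a kink at 1 and [omega]
    at 2, and these points serve as endpoints. *)
Lemma derive_ge0_le (f : R -> R) (a b : R) :
  a <= b ->
  (forall x, a <= x <= b -> continuous f x) ->
  (forall x, a < x < b -> exists d, is_derive f x d /\ 0 <= d) ->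
  f a <= f b.
Proof.
  intros Hab Hc Hd. destruct (Rle_lt_or_eq_dec _ _ Hab) as [Hlt|E]; [|subst; lra].
  destruct (MVT_open f a b Hlt Hc) as (c & Hcab & E).
  { intros x Hx. destruct (Hd x Hx) as (d & D & _). now exists d. }
  destruct (Hd c Hcab) as (d & D & Hp). rewrite (is_derive_unique _ _ _ D) in E. nra.
Qed.

Lemma derive_gt0_lt (f : R -> R) (a b : R) :
  a < b ->
  (forall x, a <= x <= b -> continuous f x) ->
  (forall x, a < x < b -> exists d, is_derive f x d /\ 0 < d) ->
  f a < f b.
Proof.
  intros Hab Hc Hd.
  destruct (MVT_open f a b Hab Hc) as (c & Hcab & E).
  { intros x Hx. destruct (Hd x Hx) as (d & D & _). now exists d. }
  destruct (Hd c Hcab) as (d & D & Hp). rewrite (is_derive_unique _ _ _ D) in E. nra.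
Qed.

Lemma derive_le0_ge (f : R -> R) (a b : R) :
  a <= b ->
  (forall x, a <= x <= b -> continuous f x) ->
  (forall x, a < x < b -> exists d, is_derive f x d /\ d <= 0) ->
  f b <= f a.
Proof.
  intros Hab Hc Hd. destruct (Rle_lt_or_eq_dec _ _ Hab) as [Hlt|E]; [|subst; lra].
  destruct (MVT_open f a b Hlt Hc) as (c & Hcab & E).
  { intros x Hx. destruct (Hd x Hx) as (d & D & _). now exists d. }
  destruct (Hd c Hcab) as (d & D & Hp). rewrite (is_derive_unique _ _ _ D) in E. nra.
Qed.

Lemma derive_lt0_gt (f : R -> R) (a b : R) :
  a < b ->
  (forall x, a <= x <= b -> continuous f x) ->
  (forall x, a < x < b -> exists d, is_derive f x d /\ d < 0) ->
  f b < f a.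
Proof.
  intros Hab Hc Hd.
  destruct (MVT_open f a b Hab Hc) as (c & Hcab & E).
  { intros x Hx. destruct (Hd x Hx) as (d & D & _). now exists d. }
  destruct (Hd c Hcab) as (d & D & Hp). rewrite (is_derive_unique _ _ _ D) in E. nra.
Qed.

Lemma derive_eq0_eq (f : R -> R) (a b : R) :
  a <= b ->
  (forall x, a <= x <= b -> continuous f x) ->
  (forall x, a < x < b -> is_derive f x 0) ->
  f b = f a.
Proof.
  intros Hab Hc Hd. apply Rle_antisym.
  - apply derive_le0_ge; auto. intros x Hx. exists 0. split; [auto|lra].
  - apply derive_ge0_le; auto. intros x Hx. exists 0. split; [auto|lra].
Qed.

Lemma continuous_gt0_nbhd (g : R -> R) (x : R) :
  continuous g x -> 0 < g x -> exists d, 0 < d /\ forall y, Rabs (y - x) < d -> 0 < g y.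
Proof.
  intros C P.
  assert (L : locally (g x) (fun z => 0 < z)) by (apply open_gt; exact P).
  apply C in L. destruct L as [d Hd]. exists d. split; [apply cond_pos|].
  intros y Hy. apply Hd. exact Hy.
Qed.

(** Induction along the half-line, suited to delay equations, where the past controls the present:
    at the supremum [s] of the good initial segments the step gives [0 < g s], and continuity pushes
    positivity beyond [s]. *)
Lemma real_induction_gt0 (g : R -> R) (a : R) :
  (forall x, a <= x -> continuous g x) ->
  0 < g a ->
  (forall u, a < u -> (forall x, a <= x < u -> 0 < g x) -> 0 < g u) ->
  forall x, a <= x -> 0 < g x.
Proof.
  intros Hc Ha Hs x Hx.
  destruct (Rlt_or_le 0 (g x)) as [|Hneg]; [assumption|exfalso].
  set (E := fun y => a <= y <= x /\ forall z, a <= z <= y -> 0 < g z).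
  assert (Ea : E a).
  { split; [lra|]. intros z Hz. replace z with a by lra. exact Ha. }
  destruct (completeness E) as [s [Hub Hl]].
  { exists x. intros y [Hy _]. lra. }
  { now exists a. }
  assert (Has : a <= s) by (apply Hub, Ea).
  assert (Hsx : s <= x) by (apply Hl; intros y [Hy _]; lra).
  assert (Hbelow : forall z, a <= z < s -> 0 < g z).
  { intros z Hz. destruct (Rlt_or_le 0 (g z)) as [|N]; [assumption|exfalso].
    assert (s <= z); [|lra]. apply Hl. intros y [Hy Hy'].
    destruct (Rle_or_lt y z) as [|L]; [assumption|].
    specialize (Hy' z). lra. }
  assert (Hgs : 0 < g s).
  { destruct (Rle_lt_or_eq_dec _ _ Has) as [L|<-]; [apply Hs; assumption|assumption]. }
  destruct (continuous_gt0_nbhd g s (Hc s Has) Hgs) as (d & Hd & Hnb).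
  set (y := Rmin (s + d / 2) x).
  assert (Ey : E y).
  { unfold y. split.
    - split; [apply Rmin_glb; lra|apply Rmin_r].
    - intros z [Hz1 Hz2]. destruct (Rlt_or_le z s) as [L|L]; [apply Hbelow; lra|].
      assert (z <= s + d / 2) by (eapply Rle_trans; [exact Hz2|apply Rmin_l]).
      apply Hnb. rewrite Rabs_pos_eq; lra. }
  assert (Hys := Hub y Ey). unfold y in Hys.
  destruct (Rle_or_lt (s + d / 2) x) as [L|L]; [rewrite Rmin_left in Hys by lra; lra|].
  rewrite Rmin_right in Hys by lra.
  assert (x = s) by lra. subst x. lra.
Qed.

Lemma continuous_exp_comp (f : R -> R) (x : R) :
  continuous f x -> continuous (fun t => exp (f t)) x.
Proof. intros C. apply continuous_comp; [exact C|apply continuous_exp]. Qed.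

Lemma continuous_Rmult (f g : R -> R) (x : R) :
  continuous f x -> continuous g x -> continuous (fun t => f t * g t) x.
Proof. intros C D. apply (continuous_mult f g x C D). Qed.

Lemma continuous_Rplus (f g : R -> R) (x : R) :
  continuous f x -> continuous g x -> continuous (fun t => f t + g t) x.
Proof. intros C D. apply (continuous_plus f g x C D). Qed.

Lemma is_derive_continuous (f : R -> R) (x d : R) : is_derive f x d -> continuous f x.
Proof. intros D. apply (ex_derive_continuous f). now exists d. Qed.

Lemma ex_RInt_cont (f : R -> R) (a b : R) : (forall x, continuous f x) -> ex_RInt f a b.
Proof. intros C. apply (ex_RInt_continuous f). intros z _. apply C. Qed.

Lemma is_derive_RInt_cont (f : R -> R) (a x : R) :
  (forall t, continuous f t) -> is_derive (fun b => RInt f a b) x (f x).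
Proof.
  intros C. apply (is_derive_RInt f (fun b => RInt f a b) a x); [|apply C].
  apply filter_forall. intros b. apply (RInt_correct f), ex_RInt_cont, C.
Qed.

(** Moments, truncated Laplace transforms and the auxiliary Gaussian integral are all instances, so
    differentiation under the integral sign is done once. *)
Definition Lap (f g : R -> R) (a b z : R) : R := RInt (fun x => f x * exp (z * g x)) a b.

Lemma continuous_Lap_integrand (f g : R -> R) (z : R) :
  (forall x, continuous f x) -> (forall x, continuous g x) ->
  forall x, continuous (fun x => f x * exp (z * g x)) x.
Proof.
  intros F G x. apply continuous_Rmult; [apply F|]. apply continuous_exp_comp.
  apply continuous_Rmult; [apply continuous_const|apply G].
Qed.

Lemma is_derive_Lap (f g : R -> R) (a b z : R) :
  (forall x, continuous f x) -> (forall x, continuous g x) ->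
  is_derive (Lap f g a b) z (Lap (fun x => g x * f x) g a b z).
Proof.
  intros F G. unfold Lap.
  assert (D : forall t u, Derive (fun w => f t * exp (w * g t)) u = g t * f t * exp (u * g t)).
  { intros t u. apply is_derive_unique. auto_derive; [trivial|ring]. }
  rewrite <- (RInt_ext (fun t => Derive (fun w => f t * exp (w * g t)) z)).
  2:{ intros t _. apply D. }
  apply (is_derive_RInt_param (fun z x => f x * exp (z * g x))).
  - apply filter_forall. intros y t _. auto_derive. trivial.
  - intros t _.
    apply continuity_2d_pt_ext with (fun u v => (g v * f v) * exp (u * g v)).
    { intros u v. symmetry. apply D. }
    assert (C2 : forall h : R -> R, (forall x, continuous h x) -> forall x y,
      continuity_2d_pt (fun _ v => h v) x y).
    { intros h H x y. apply (continuity_1d_2d_pt_comp h (fun _ v => v)).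
      - apply continuity_pt_filterlim, H.
      - apply continuity_2d_pt_id2. }
    apply continuity_2d_pt_mult.
    + apply continuity_2d_pt_mult; apply C2; assumption.
    + apply (continuity_1d_2d_pt_comp exp).
      * apply derivable_continuous_pt, derivable_pt_exp.
      * apply continuity_2d_pt_mult; [apply continuity_2d_pt_id1|apply C2, G].
  - apply filter_forall. intros y. apply ex_RInt_cont.
    now apply continuous_Lap_integrand.
Qed.

Lemma is_derive_Lap_bound (f g : R -> R) (a b z : R) :
  (forall x, continuous f x) -> (forall x, continuous g x) ->
  is_derive (fun b => Lap f g a b z) b (f b * exp (z * g b)).
Proof.
  intros F G. apply (is_derive_RInt_cont (fun x => f x * exp (z * g x))).
  now apply continuous_Lap_integrand.
Qed.

Lemma is_derive_eq (f : R -> R) (x l l' : R) : is_derive f x l -> l = l' -> is_derive f x l'.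
Proof. intros D <-. exact D. Qed.

Lemma is_derive_Rmult (f g : R -> R) (x df dg : R) :
  is_derive f x df -> is_derive g x dg ->
  is_derive (fun t => f t * g t) x (df * g x + f x * dg).
Proof.
  intros D E. auto_derive; [split; [eexists; exact D|split; [eexists; exact E|trivial]]|].
  rewD D. rewD E. ring.
Qed.

(** * The function I *)

Lemma RInt_lin (f g : R -> R) (c d a b : R) :
  (forall x, continuous f x) -> (forall x, continuous g x) ->
  RInt (fun x => c * f x + d * g x) a b = c * RInt f a b + d * RInt g a b.
Proof.
  intros F G. apply (is_RInt_unique (V := R_CompleteNormedModule)).
  apply (is_RInt_plus (V := R_NormedModule)); apply (is_RInt_scal (V := R_NormedModule));
    apply (RInt_correct (V := R_CompleteNormedModule)); apply ex_RInt_cont; assumption.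
Qed.

Lemma exp_ge_1px (x : R) : 1 + x <= exp x.
Proof.
  destruct (Req_dec x 0) as [->|N]; [rewrite exp_0; lra|].
  left. now apply exp_ineq1.
Qed.

(* [I' = expmom 0], [I'' = expmom 1] and [I''' = expmom 2]. *)
Definition expmom (n : nat) (z : R) : R := Lap (fun x => x ^ n) (fun x => x) 0 1 z.

Lemma continuous_Rpow (n : nat) (x : R) : continuous (fun x => x ^ n) x.
Proof. apply (ex_derive_continuous (fun x => x ^ n)). auto_derive. trivial. Qed.

Lemma is_derive_expmom (n : nat) (z : R) : is_derive (expmom n) z (expmom (S n) z).
Proof.
  apply (is_derive_Lap (fun x => x ^ n) (fun x => x)).
  - apply continuous_Rpow.
  - intros x. apply continuous_id.
Qed.

Lemma continuous_expmom (n : nat) (z : R) : continuous (expmom n) z.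
Proof. apply (is_derive_continuous _ _ _ (is_derive_expmom n z)). Qed.

Lemma expmom_gt0 (n : nat) (z : R) : 0 < expmom n z.
Proof.
  unfold expmom, Lap. apply RInt_gt_0; [lra| |].
  - intros x Hx. apply Rmult_lt_0_compat; [apply pow_lt; lra|apply exp_pos].
  - intros x _. apply (continuous_Lap_integrand (fun x => x ^ n) (fun x => x)).
    + apply continuous_Rpow.
    + intros y. apply continuous_id.
Qed.

(** The integrand times [z] is the derivative of [exp (z * x)] in [x]. Without a division the
    identity also covers [z = 0]. *)
Lemma expmom0_mul (z : R) : z * expmom 0 z = exp z - 1.
Proof.
  unfold expmom, Lap.
  assert (H : is_RInt (fun x => z * (x ^ 0 * exp (z * x))) 0 1 (exp (z * 1) - exp (z * 0))).
  { apply (is_RInt_derive (fun x => exp (z * x)) (fun x => z * (x ^ 0 * exp (z * x)))).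
    - intros x _. auto_derive; [trivial|simpl; ring].
    - intros x _. apply (ex_derive_continuous (fun x => z * (x ^ 0 * exp (z * x)))).
      auto_derive. trivial. }
  apply (is_RInt_unique (V := R_CompleteNormedModule)) in H.
  replace (exp z - 1) with (exp (z * 1) - exp (z * 0))
    by (rewrite Rmult_1_r, Rmult_0_r, exp_0; reflexivity).
  rewrite <- H. symmetry.
  apply (RInt_scal (V := R_CompleteNormedModule) (fun x => x ^ 0 * exp (z * x))).
  apply ex_RInt_cont. apply (continuous_Lap_integrand (fun x => x ^ 0) (fun x => x)).
  - apply continuous_Rpow.
  - intros y. apply continuous_id.
Qed.

Lemma I_integrand_expmom (z : R) : I_integrand z = expmom 0 z.
Proof.
  unfold I_integrand. destruct (Req_EM_T z 0) as [->|N].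
  - unfold expmom, Lap. rewrite (RInt_ext _ (fun _ => 1)).
    + rewrite RInt_const. unfold scal; simpl; unfold mult; simpl. ring.
    + intros x _. rewrite Rmult_0_l, exp_0. simpl. ring.
  - apply (Rmult_eq_reg_l z); [|exact N]. rewrite expmom0_mul. field. exact N.
Qed.

Lemma is_derive_I (z : R) : is_derive I z (expmom 0 z).
Proof.
  rewrite <- I_integrand_expmom. apply (is_derive_RInt_cont I_integrand 0 z).
  intros t. apply (continuous_ext (expmom 0)).
  - intros x. symmetry. apply I_integrand_expmom.
  - apply continuous_expmom.
Qed.

Lemma I_0 : I 0 = 0.
Proof. unfold I. apply (RInt_point (V := R_CompleteNormedModule)). Qed.

Lemma Derive_n_I_2 (z : R) : Derive_n I 2 z = expmom 1 z.
Proof.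
  simpl. rewrite (Derive_ext _ (expmom 0)).
  - apply is_derive_unique, is_derive_expmom.
  - intros t. apply is_derive_unique, is_derive_I.
Qed.

Lemma expmom_lt (n : nat) (x y : R) : x < y -> expmom n x < expmom n y.
Proof.
  intros H. apply derive_gt0_lt; [exact H| |].
  - intros t _. apply continuous_expmom.
  - intros t _. exists (expmom (S n) t). split; [apply is_derive_expmom|apply expmom_gt0].
Qed.

Lemma expmom0_0 : expmom 0 0 = 1.
Proof.
  rewrite <- I_integrand_expmom. unfold I_integrand.
  destruct (Req_EM_T 0 0); [reflexivity|congruence].
Qed.

(* Jensen's inequality for [exp (y * x)] under the probability density
   proportional to [x * exp (z * x)], whose mean is [I'''(z) / I''(z)]. *)
Lemma expmom1_ge (z y : R) :
  expmom 1 z * exp (expmom 2 z / expmom 1 z * y) <= expmom 1 (z + y).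
Proof.
  assert (P1 := expmom_gt0 1 z). set (m := expmom 2 z / expmom 1 z).
  assert (M : expmom 2 z = m * expmom 1 z) by (unfold m; field; lra).
  set (f1 := fun x => x ^ 1 * exp (z * x)). set (f2 := fun x => x ^ 2 * exp (z * x)).
  assert (C : forall n x, continuous (fun x => x ^ n * exp (z * x)) x).
  { intros n. apply (continuous_Lap_integrand (fun x => x ^ n) (fun x => x)).
    - apply continuous_Rpow.
    - intros x. apply continuous_id. }
  (* The integrand is the weight [x * exp (z * x)] times [exp (m * y) * (1 + y * (x - m))], the
     tangent at [x = m] to [exp (y * x)]. As [m] is the mean, the linear term integrates to 0. *)
  assert (E : RInt (fun x => (exp (m * y) * (1 - y * m)) * f1 x + (exp (m * y) * y) * f2 x) 0 1
    = expmom 1 z * exp (m * y)).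
  { rewrite (RInt_lin f1 f2); [|apply C|apply C].
    change (RInt f1 0 1) with (expmom 1 z). change (RInt f2 0 1) with (expmom 2 z).
    rewrite M. eqR; ring. }
  rewrite <- E. unfold expmom, Lap. apply RInt_le; [lra| | |].
  - apply ex_RInt_cont. intros x. apply continuous_Rplus; apply continuous_Rmult;
      try apply continuous_const; apply C.
  - apply ex_RInt_cont. apply (continuous_Lap_integrand (fun x => x ^ 1) (fun x => x)).
    + apply continuous_Rpow.
    + intros x. apply continuous_id.
  - intros x Hx. unfold f1, f2.
    replace ((z + y) * x) with (z * x + (m * y + y * (x - m))) by ring.
    rewrite !exp_plus. assert (H := exp_ge_1px (y * (x - m))).
    assert (P := Rmult_lt_0_compat _ _ (exp_pos (z * x)) (exp_pos (m * y))).
    apply Rminus_le.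
    replace (exp (m * y) * (1 - y * m) * (x ^ 1 * exp (z * x)) +
      exp (m * y) * y * (x ^ 2 * exp (z * x)) -
      x ^ 1 * (exp (z * x) * (exp (m * y) * exp (y * (x - m)))))
      with ((x * (exp (z * x) * exp (m * y))) * (1 + y * (x - m) - exp (y * (x - m)))) by ring.
    assert (0 < x * (exp (z * x) * exp (m * y))) by (apply Rmult_lt_0_compat; lra).
    nra.
Qed.

(** For [x > 0] this is [exp (- gamma - E1 x)] with the exponential integral [E1], because
    [- I (- x) = E1 x + ln x + gamma]; hence it increases to [exp (- gamma)]. *)
Definition expV (x : R) : R := x * exp (I (- x)).

Lemma is_derive_expV (x : R) : is_derive expV x (exp (- x) * exp (I (- x))).
Proof.
  unfold expV. assert (D := is_derive_I (- x)).
  auto_derive; [now exists (expmom 0 (- x))|].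
  rewD D. assert (E := expmom0_mul (- x)).
  replace (exp (- x)) with (1 + - x * expmom 0 (- x)) by lra. ring.
Qed.

Lemma continuous_expV (x : R) : continuous expV x.
Proof. apply (is_derive_continuous _ _ _ (is_derive_expV x)). Qed.

Lemma I_lower (x : R) : 0 <= x -> - x <= I (- x).
Proof.
  intros H. assert (E : 0 + I (- 0) <= x + I (- x)); [|rewrite Ropp_0, I_0 in E; lra].
  apply (derive_ge0_le (fun x => x + I (- x))); [exact H| |].
  - intros t _. apply (ex_derive_continuous (fun x => x + I (- x))).
    auto_derive. exists (expmom 0 (- t)). apply is_derive_I.
  - intros t Ht. exists (1 - expmom 0 (- t)). split.
    + auto_derive; [exists (expmom 0 (- t)); apply is_derive_I|].
      rewD (is_derive_I (- t)). ring.
    + assert (L := expmom_lt 0 (- t) 0 ltac:(lra)). rewrite expmom0_0 in L. lra.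
Qed.

Lemma I_nonpos (x : R) : 0 <= x -> I (- x) <= 0.
Proof.
  intros H. assert (E : I (- x) <= I (- 0)); [|rewrite Ropp_0, I_0 in E; lra].
  apply (derive_le0_ge (fun x => I (- x))); [exact H| |].
  - intros t _. apply (ex_derive_continuous (fun x => I (- x))).
    auto_derive. exists (expmom 0 (- t)). apply is_derive_I.
  - intros t Ht. exists (- expmom 0 (- t)). split.
    + auto_derive; [exists (expmom 0 (- t)); apply is_derive_I|].
      rewD (is_derive_I (- t)). ring.
    + assert (L := expmom_gt0 0 (- t)). lra.
Qed.

Lemma expV_0 : expV 0 = 0.
Proof. unfold expV. ring. Qed.

Lemma expV_lt (x y : R) : x < y -> expV x < expV y.
Proof.
  intros H. apply derive_gt0_lt; [exact H| |].
  - intros t _. apply continuous_expV.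
  - intros t _. eexists. split; [apply is_derive_expV|].
    apply Rmult_lt_0_compat; apply exp_pos.
Qed.

(** The derivative of [expV] is at most [exp (- x)], because [I (- x) <= 0]; hence
    [expV x + exp (- x)] decreases from 1. *)
Lemma expV_le1 (x : R) : 0 <= x -> expV x <= 1.
Proof.
  intros H. assert (E : expV x + exp (- x) <= expV 0 + exp (- 0)).
  { apply (derive_le0_ge (fun x => expV x + exp (- x))); [exact H| |].
    - intros t _. apply continuous_Rplus; [apply continuous_expV|].
      apply (ex_derive_continuous (fun x => exp (- x))). auto_derive. trivial.
    - intros t Ht. exists (exp (- t) * exp (I (- t)) - exp (- t)). split.
      + assert (D := is_derive_expV t). auto_derive; [eexists; exact D|].
        rewD D. ring.
      + assert (L := I_nonpos t ltac:(lra)). assert (P := exp_pos (- t)).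
        assert (exp (I (- t)) <= 1); [|nra].
        rewrite <- exp_0. destruct L as [L|L]; [left; now apply exp_increasing|rewrite L; lra]. }
  rewrite expV_0, Ropp_0, exp_0 in E. assert (P := exp_pos (- x)). lra.
Qed.

(** * Euler's constant *)

(* Increases from [0] at [t = 0] to the harmonic number at [t = N], with derivative
   [(1 - (1 - t / N) ^ n) / t], which for [N = n] is close to [(1 - exp (- t)) / t]. *)
Definition harmonic_interp (N : R) (n : nat) (t : R) : R :=
  sum_n_m (fun k => (1 - (1 - t / N) ^ k) / INR k) 1 n.

Lemma harmonic_interp_S (N : R) (n : nat) (t : R) :
  harmonic_interp N (S n) t
  = harmonic_interp N n t + (1 - (1 - t / N) ^ S n) / INR (S n).
Proof. unfold harmonic_interp. rewrite sum_n_Sm; [reflexivity|lia]. Qed.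

Lemma is_derive_harmonic_interp (N : R) (n : nat) (t : R) :
  0 < N -> t <> 0 ->
  is_derive (harmonic_interp N n) t ((1 - (1 - t / N) ^ n) / t).
Proof.
  intros HN Ht. induction n as [|n IH].
  - apply (is_derive_ext (fun _ => 0)).
    { intros s. unfold harmonic_interp. rewrite sum_n_m_zero; [reflexivity|lia]. }
    replace ((1 - (1 - t / N) ^ 0) / t) with 0 by (simpl; field; exact Ht).
    apply (is_derive_const (K := R_AbsRing) (V := R_NormedModule)).
  - apply (is_derive_ext (fun s => harmonic_interp N n s + (1 - (1 - s / N) ^ S n) / INR (S n))).
    { intros s. now rewrite harmonic_interp_S. }
    assert (HS : INR (S n) <> 0) by (apply not_0_INR; lia).
    replace ((1 - (1 - t / N) ^ S n) / t)
      with ((1 - (1 - t / N) ^ n) / t + (1 - t / N) ^ n / N) by (simpl; field; lra).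
    apply (is_derive_plus (K := R_AbsRing) (V := R_NormedModule)); [exact IH|].
    auto_derive; [lra|]. change (pred (S n)) with n.
    change (match n with 0%nat => 1 | S _ => INR n + 1 end) with (INR (S n)).
    replace (1 + - (t * / N)) with (1 - t / N) by (unfold Rdiv; ring).
    set (p := (1 - t / N) ^ n). set (q := INR (S n)) in *. eqR. field. split; [lra|exact HS].
Qed.

Lemma harmonic_interp_at0 (N : R) (n : nat) : harmonic_interp N n 0 = 0.
Proof.
  induction n as [|n IH].
  - unfold harmonic_interp. rewrite sum_n_m_zero; [reflexivity|lia].
  - rewrite harmonic_interp_S, IH. unfold Rdiv at 2. rewrite Rmult_0_l, Rminus_0_r, pow1.
    unfold Rdiv. ring.
Qed.

Lemma harmonic_interp_atN (N : R) (n : nat) :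
  N <> 0 -> harmonic_interp N n N = sum_n_m (fun k => / INR k) 1 n.
Proof.
  intros HN. unfold harmonic_interp. apply sum_n_m_ext_loc. intros k Hk.
  replace (1 - N / N) with 0 by (field; exact HN).
  rewrite pow_i by lia. eqR. unfold Rdiv. ring.
Qed.

Lemma continuous_harmonic_interp (N : R) (n : nat) (t : R) :
  continuous (harmonic_interp N n) t.
Proof.
  induction n as [|n IH].
  - apply (continuous_ext (fun _ => 0)).
    { intros s. unfold harmonic_interp. rewrite sum_n_m_zero; [reflexivity|lia]. }
    apply continuous_const.
  - apply (continuous_ext (fun s => harmonic_interp N n s + (1 - (1 - s / N) ^ S n) / INR (S n))).
    { intros s. now rewrite harmonic_interp_S. }
    apply continuous_Rplus; [exact IH|].
    apply (ex_derive_continuous (fun s => (1 - (1 - s / N) ^ S n) / INR (S n))).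
    auto_derive. trivial.
Qed.

(** With [x = t / n], both bounds are n-th powers of elementary ones: [1 - x <= exp (- x)] above,
    and [(1 + x) * exp (- x) <= 1] times [1 - x] below, followed by Bernoulli for [(1 - x^2)^n]. *)
Lemma pow_le_exp_neg (n : nat) (t : R) :
  (0 < n)%nat -> 0 <= t <= INR n ->
  exp (- t) * (1 - t * t / INR n) <= (1 - t / INR n) ^ n <= exp (- t).
Proof.
  intros Hn Ht. assert (HN : 0 < INR n) by (apply lt_0_INR; exact Hn).
  assert (E : exp (- t) = exp (- (t / INR n)) ^ n).
  { assert (Ep : forall k x, exp x ^ k = exp (INR k * x)).
    { intros k x. induction k as [|k IH]; [simpl; rewrite Rmult_0_l, exp_0; reflexivity|].
      rewrite S_INR. simpl pow. rewrite IH, <- exp_plus. f_equal. ring. }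
    rewrite Ep. f_equal. field. lra. }
  assert (Hx : 0 <= t / INR n <= 1).
  { split; [apply Rdiv_le_0_compat; lra|apply Rle_div_l; lra]. }
  set (x := t / INR n) in *.
  assert (B : 1 - t * t / INR n <= (1 - x * x) ^ n).
  { replace (1 - t * t / INR n) with (1 + INR n * (- (x * x))) by (unfold x; field; lra).
    replace (1 - x * x) with (1 + - (x * x)) by ring.
    assert (Bern : forall k y, -1 <= y -> 1 + INR k * y <= (1 + y) ^ k).
    { intros k y Hy. induction k as [|k IH]; [simpl; lra|].
      rewrite S_INR. simpl pow. assert (0 <= INR k) by apply pos_INR.
      assert (H2 := Rmult_le_compat_l (1 + y) _ _ ltac:(lra) IH).
      assert (0 <= INR k * (y * y)) by (apply Rmult_le_pos; [lra|nra]). nra. }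
    apply Bern. nra. }
  split.
  - apply Rle_trans with (exp (- t) * (1 - x * x) ^ n).
    + apply Rmult_le_compat_l; [left; apply exp_pos|exact B].
    + rewrite E, <- Rpow_mult_distr. apply pow_incr. split.
      * apply Rmult_le_pos; [left; apply exp_pos|nra].
      * assert (H := exp_ge_1px x). assert (P := exp_pos (- x)).
        assert (Einv : exp x * exp (- x) = 1) by (rewrite <- exp_plus, Rplus_opp_r; apply exp_0).
        replace (exp (- x) * (1 - x * x)) with ((1 - x) * ((1 + x) * exp (- x))) by ring.
        assert ((1 + x) * exp (- x) <= 1) by nra. nra.
  - rewrite E. apply pow_incr. split; [lra|]. assert (H := exp_ge_1px (- x)). lra.
Qed.

(** Replace the end [N] by a variable [t]: the difference vanishes at 0 and its derivative
    [((1 - t/N)^n - exp (- t)) / t] lies between [- t * exp (- t) / N] and 0. The primitive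
    [1 - (1 + t) * exp (- t)] of [t * exp (- t)] stays below 1. *)
Lemma harmonic_Ein_close (n : nat) :
  (0 < n)%nat ->
  - / INR n <= - I (- INR n) - sum_n_m (fun k => / INR k) 1 n <= 0.
Proof.
  intros Hn. assert (HN : 0 < INR n) by (apply lt_0_INR; exact Hn). set (N := INR n) in *.
  rewrite <- (harmonic_interp_atN N n) by lra.
  assert (C : forall t, continuous (fun t => - I (- t) - harmonic_interp N n t) t).
  { intros t. apply (continuous_minus (fun t => - I (- t)) (harmonic_interp N n)).
    - apply (ex_derive_continuous (fun t => - I (- t))). auto_derive.
      exists (expmom 0 (- t)). apply is_derive_I.
    - apply continuous_harmonic_interp. }
  assert (D : forall t, 0 < t < N -> is_derive (fun t => - I (- t) - harmonic_interp N n t) t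
     (((1 - t / N) ^ n - exp (- t)) / t)).
  { intros t Ht.
    replace (((1 - t / N) ^ n - exp (- t)) / t)
      with (expmom 0 (- t) - (1 - (1 - t / N) ^ n) / t).
    - apply (is_derive_minus (K := R_AbsRing) (V := R_NormedModule)).
      + auto_derive; [exists (expmom 0 (- t)); apply is_derive_I|].
        rewD (is_derive_I (- t)). ring.
      + apply is_derive_harmonic_interp; lra.
    - assert (M := expmom0_mul (- t)). replace (exp (- t)) with (1 - t * expmom 0 (- t)) by lra.
      field. lra. }
  split.
  - assert (H : - I (- 0) - harmonic_interp N n 0 - (1 - (1 + 0) * exp (- 0)) * - / N
      <= - I (- N) - harmonic_interp N n N - (1 - (1 + N) * exp (- N)) * - / N).
    { apply (derive_ge0_le (fun t => - I (- t) - harmonic_interp N n t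
         - (1 - (1 + t) * exp (- t)) * - / N)); [lra| |].
      - intros t _. apply (continuous_minus (fun t => - I (- t) - harmonic_interp N n t)
         (fun t => (1 - (1 + t) * exp (- t)) * - / N)); [apply C|].
        apply (ex_derive_continuous (fun t => (1 - (1 + t) * exp (- t)) * - / N)).
        auto_derive. trivial.
      - intros t Ht. exists (((1 - t / N) ^ n - exp (- t)) / t - t * exp (- t) * - / N). split.
        + apply (is_derive_minus (K := R_AbsRing) (V := R_NormedModule)); [apply D; exact Ht|].
          auto_derive; [trivial|]. ring.
        + destruct (pow_le_exp_neg n t Hn ltac:(fold N; lra)) as [L _]. fold N in L.
          replace (((1 - t / N) ^ n - exp (- t)) / t - t * exp (- t) * - / N)
            with (((1 - t / N) ^ n - exp (- t) * (1 - t * t / N)) / t) by (field; lra).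
          apply Rdiv_le_0_compat; lra. }
    rewrite harmonic_interp_at0, Ropp_0, I_0, exp_0 in H.
    assert (P := exp_pos (- N)). assert (PN := Rinv_0_lt_compat _ HN).
    assert (0 < (1 + N) * exp (- N) * / N) by (repeat apply Rmult_lt_0_compat; lra).
    lra.
  - assert (H : - I (- N) - harmonic_interp N n N <= - I (- 0) - harmonic_interp N n 0).
    { apply (derive_le0_ge (fun t => - I (- t) - harmonic_interp N n t)); [lra| |].
      - intros t _. apply C.
      - intros t Ht. eexists. split; [apply D; exact Ht|].
        destruct (pow_le_exp_neg n t Hn ltac:(fold N; lra)) as [_ U]. fold N in U.
        apply Rle_div_l; lra. }
    rewrite harmonic_interp_at0, Ropp_0, I_0 in H. lra.
Qed.

(** Monotone and bounded, the sequence has a limit [a > 0]. Taking logarithms and exchanging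
    [- I (- n)] for the harmonic sum shows that the sequence defining [euler_gamma] really
    converges, to [- ln a]. *)
Lemma expV_lim_euler : is_lim_seq (fun n => expV (INR n)) (exp (- euler_gamma)).
Proof.
  destruct (ex_finite_lim_seq_incr (fun n => expV (INR n)) 1) as [a La].
  { intros n. left. apply expV_lt. rewrite S_INR. lra. }
  { intros n. apply expV_le1, pos_INR. }
  assert (Pa : 0 < a).
  { apply Rlt_le_trans with (expV (INR 1)).
    - rewrite <- expV_0. apply expV_lt. simpl. lra.
    - apply (is_lim_seq_incr_compare (fun n => expV (INR n)) a La).
      intros n. left. apply expV_lt. rewrite S_INR. lra. }
  assert (Ll : is_lim_seq (fun n => ln (expV (INR n))) (ln a)).
  { apply is_lim_seq_continuous; [|exact La].
    apply derivable_continuous_pt. now exists (/ a); apply derivable_pt_lim_ln. }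
  assert (Lz : is_lim_seq (fun n => - I (- INR n) - sum_n_m (fun k => / INR k) 1 n) 0).
  { apply (is_lim_seq_le_le_loc (fun n => - / INR n) _ (fun _ => 0)).
    - exists 1%nat. intros n Hn. apply harmonic_Ein_close. lia.
    - replace 0 with (- 0) by ring. apply (is_lim_seq_opp (fun n => / INR n) 0).
      apply (is_lim_seq_inv INR p_infty); [apply is_lim_seq_INR|discriminate].
    - apply is_lim_seq_const. }
  assert (Lg : is_lim_seq (fun n => sum_n_m (fun k => / INR k) 1 n - ln (INR n)) (- ln a)).
  { apply (is_lim_seq_ext_loc (fun n => - ln (expV (INR n))
      - (- I (- INR n) - sum_n_m (fun k => / INR k) 1 n))).
    - exists 1%nat. intros n Hn. assert (0 < INR n) by (apply lt_0_INR; lia).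
      unfold expV. rewrite ln_mult, ln_exp; [ring|lra|apply exp_pos].
    - replace (- ln a) with (- ln a - 0) by ring.
      apply is_lim_seq_minus'; [|exact Lz]. now apply (is_lim_seq_opp _ (ln a)). }
  unfold euler_gamma. rewrite (is_lim_seq_unique _ _ Lg). simpl.
  rewrite Ropp_involutive, exp_ln; [exact La|exact Pa].
Qed.

Lemma expV_le_euler (x : R) : expV x <= exp (- euler_gamma).
Proof.
  assert (Hn : exists n, x < INR n).
  { assert (0 < / (Rabs x + 1)) by (apply Rinv_0_lt_compat; assert (H := Rabs_pos x); lra).
    destruct (archimed_cor1 _ H) as [n [H1 H2]]. exists n. apply lt_0_INR in H2.
    apply Rinv_lt_cancel in H1; [|lra]. assert (H3 := Rle_abs x). lra. }
  destruct Hn as [n Hn].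
  apply Rle_trans with (expV (INR n)); [left; apply expV_lt; lra|].
  apply (is_lim_seq_incr_compare (fun n => expV (INR n)) _ expV_lim_euler).
  intros k. left. apply expV_lt. rewrite S_INR. lra.
Qed.

Lemma euler_le_of_expV (c : R) :
  (forall x, 0 < x -> expV x <= c) -> exp (- euler_gamma) <= c.
Proof.
  intros H.
  apply (is_lim_seq_le_loc (fun n => expV (INR n)) (fun _ => c) (exp (- euler_gamma)) c).
  - exists 1%nat. intros n Hn. apply H, lt_0_INR. lia.
  - apply expV_lim_euler.
  - apply is_lim_seq_const.
Qed.

(** * Log-concavity of Dickman's function *)

(* Extending [rho] by [1] to the left makes it continuous on all of [R]. *)
Definition dickman_ext (r : R -> R) : Prop :=
  (forall x, continuous r x)
  /\ (forall x, x <= 1 -> r x = 1)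
  /\ (forall x, 1 < x -> is_derive r x (- (r (x - 1) / x))).

Lemma RInt_const1 (r : R -> R) (a b : R) :
  a <= b -> b <= 1 -> (forall x, x <= 1 -> r x = 1) -> RInt r a b = b - a.
Proof.
  intros Hab Hb H1. rewrite (RInt_ext r (fun _ => 1)).
  - rewrite RInt_const. unfold scal; simpl; unfold mult; simpl. ring.
  - intros x Hx. rewrite Rmin_left, Rmax_right in Hx by lra. apply H1. lra.
Qed.

Lemma is_derive_shift (f : R -> R) (c x l : R) :
  is_derive f (x - c) l -> is_derive (fun t => f (t - c)) x l.
Proof.
  intros D. auto_derive; [eexists; exact D|]. change (x + - c) with (x - c). rewD D. ring.
Qed.

Lemma continuous_shift (f : R -> R) (c x : R) :
  continuous f (x - c) -> continuous (fun t => f (t - c)) x.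
Proof.
  intros C. apply (continuous_comp (fun t => t - c) f); [|exact C].
  apply (ex_derive_continuous (fun t => t - c)). auto_derive. trivial.
Qed.

(** Both sides equal 1 at [u = 1] and have derivative [r u - r (u - 1)]. Writing the window as a
    difference of primitives from 0 lets each moving end be differentiated separately. *)
Lemma dickman_integral (r : R -> R) (u : R) :
  dickman_ext r -> 1 <= u -> u * r u = RInt r 0 u - RInt r 0 (u - 1).
Proof.
  intros (C & H1 & D) Hu.
  assert (E : u * r u - (RInt r 0 u - RInt r 0 (u - 1))
    = 1 * r 1 - (RInt r 0 1 - RInt r 0 (1 - 1))).
  { apply (derive_eq0_eq (fun u => u * r u - (RInt r 0 u - RInt r 0 (u - 1)))); [exact Hu| |].
    - intros x _. apply (continuous_minus (fun u => u * r u) (fun u => RInt r 0 u - RInt r 0 (u - 1))).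
      + apply continuous_Rmult; [apply continuous_id|apply C].
      + apply (continuous_minus (fun u => RInt r 0 u) (fun u => RInt r 0 (u - 1))).
        * apply (is_derive_continuous _ _ _ (is_derive_RInt_cont r 0 x C)).
        * apply (continuous_shift (fun u => RInt r 0 u)).
          apply (is_derive_continuous _ _ _ (is_derive_RInt_cont r 0 (x - 1) C)).
    - intros x Hx.
      apply (is_derive_eq _ _ ((1 * r x + x * - (r (x - 1) / x)) - (r x - r (x - 1)))); [|field; lra].
      apply (is_derive_minus (K := R_AbsRing) (V := R_NormedModule)).
      + assert (Dx := D x ltac:(lra)). auto_derive; [eexists; exact Dx|]. rewD Dx. ring.
      + apply (is_derive_minus (K := R_AbsRing) (V := R_NormedModule)).
        * apply (is_derive_RInt_cont r 0 x C).
        * apply (is_derive_shift (fun u => RInt r 0 u)), (is_derive_RInt_cont r 0 (x - 1) C). }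
  rewrite (H1 1) in E by lra. rewrite (RInt_const1 r 0 1), (RInt_const1 r 0 (1 - 1)) in E by (auto; lra). lra.
Qed.

Lemma dickman_gt0_aux (r : R -> R) (u : R) :
  dickman_ext r -> 1 <= u -> (forall x, u - 1 < x < u -> 0 < r x) -> 0 < r u.
Proof.
  intros Hr Hu Hp. assert (E := dickman_integral r u Hr Hu). destruct Hr as (C & _ & _).
  assert (RInt r 0 (u - 1) < RInt r 0 u).
  { apply (derive_gt0_lt (fun u => RInt r 0 u)); [lra| |].
    - intros x _. apply (is_derive_continuous _ _ _ (is_derive_RInt_cont r 0 x C)).
    - intros x Hx. exists (r x). split; [apply (is_derive_RInt_cont r 0 x C)|auto]. }
  assert (0 < u * r u) by lra. nra.
Qed.

Lemma dickman_gt0 (r : R -> R) (u : R) : dickman_ext r -> 0 < r u.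
Proof.
  intros Hr. destruct (Rle_or_lt u 1) as [L|L].
  - destruct Hr as (_ & H1 & _). rewrite H1 by exact L. lra.
  - apply (real_induction_gt0 r 1); [| | |lra].
    + intros x _. apply Hr.
    + destruct Hr as (_ & H1 & _). rewrite H1; lra.
    + intros v Hv Hp. apply (dickman_gt0_aux r v Hr); [lra|].
      intros x Hx. destruct (Rle_or_lt 1 x) as [L'|L']; [apply Hp; lra|].
      destruct Hr as (_ & H1 & _). rewrite H1; lra.
Qed.

Lemma dickman_lt (r : R -> R) (x y : R) : dickman_ext r -> 1 <= x -> x < y -> r y < r x.
Proof.
  intros Hr Hx Hxy. apply derive_lt0_gt; [exact Hxy|intros t _; apply Hr|].
  intros t Ht. eexists. split; [apply Hr; lra|].
  assert (0 < r (t - 1) / t) by (apply Rdiv_lt_0_compat; [now apply dickman_gt0|lra]). lra.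
Qed.

Lemma dickman_le (r : R -> R) (x y : R) : dickman_ext r -> x <= y -> r y <= r x.
Proof.
  intros Hr Hxy. assert (H1 := proj1 (proj2 Hr)).
  destruct (Rle_or_lt y 1) as [L|L]; [rewrite !H1; lra|].
  destruct (Rle_or_lt x 1) as [L'|L'].
  - rewrite (H1 x L'), <- (H1 1 (Rle_refl 1)). left. apply dickman_lt; auto; lra.
  - destruct Hxy as [Hxy|<-]; [left; apply dickman_lt; auto; lra|lra].
Qed.

Lemma dickman_le1 (r : R -> R) (x : R) : dickman_ext r -> r x <= 1.
Proof.
  intros Hr. destruct (Rle_or_lt x 1) as [L|L].
  - destruct Hr as (_ & H1 & _). rewrite H1; lra.
  - assert (H := dickman_le r 1 x Hr ltac:(lra)).
    destruct Hr as (_ & H1 & _). rewrite (H1 1) in H; lra.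
Qed.

Lemma is_derive_primitive (r : R -> R) (x : R) :
  dickman_ext r -> is_derive (fun t => RInt r 0 t) x (r x).
Proof. intros Hr. apply is_derive_RInt_cont, Hr. Qed.

Lemma continuous_primitive (r : R -> R) (x : R) :
  dickman_ext r -> continuous (fun t => RInt r 0 t) x.
Proof. intros Hr. apply (is_derive_continuous _ _ _ (is_derive_primitive r x Hr)). Qed.

(* [lam = - r' / r] beyond [1]. *)
Definition lam (r : R -> R) (u : R) : R := r (u - 1) / (u * r u).

Lemma lam_gt0 (r : R -> R) (u : R) : dickman_ext r -> 0 < u -> 0 < lam r u.
Proof.
  intros Hr Hu. apply Rdiv_lt_0_compat; [now apply dickman_gt0|].
  apply Rmult_lt_0_compat; [exact Hu|now apply dickman_gt0].
Qed.

Lemma lam_mul (r : R -> R) (u : R) :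
  dickman_ext r -> 0 < u -> lam r u * r u = r (u - 1) / u.
Proof.
  intros Hr Hu. assert (P := dickman_gt0 r u Hr). unfold lam. field. lra.
Qed.

Lemma is_derive_dickman (r : R -> R) (u : R) :
  dickman_ext r -> 1 < u -> is_derive r u (- (lam r u * r u)).
Proof. intros Hr Hu. rewrite lam_mul by (auto; lra). now apply Hr. Qed.

Lemma continuous_lam (r : R -> R) (u : R) : dickman_ext r -> 0 < u -> continuous (lam r) u.
Proof.
  intros Hr Hu. assert (P := dickman_gt0 r u Hr). unfold lam, Rdiv.
  apply (continuous_Rmult (fun u => r (u - 1)) (fun u => / (u * r u))).
  - apply continuous_shift, Hr.
  - apply (continuous_comp (fun u => u * r u) Rinv).
    + apply continuous_Rmult; [apply continuous_id|apply Hr].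
    + apply continuity_pt_filterlim. apply (continuity_pt_inv id).
      * apply derivable_continuous_pt, derivable_pt_id.
      * unfold id. apply Rgt_not_eq. nra.
Qed.

(** Here [lam t = 1 / (t * r t)], and [(t * r t)' = r t - 1] is negative. *)
Lemma lam_lt_12 (r : R -> R) (x y : R) :
  dickman_ext r -> 1 <= x -> x < y -> y <= 2 -> lam r x < lam r y.
Proof.
  intros Hr Hx Hxy Hy. apply derive_gt0_lt; [exact Hxy| |].
  - intros t Ht. apply continuous_lam; [exact Hr|lra].
  - intros t Ht. exists ((1 - r t) / (t * r t) ^ 2). assert (P := dickman_gt0 r t Hr). split.
    + apply (is_derive_ext_loc (fun t => / (t * r t))).
      { assert (L : locally t (fun s => s < 2)) by (apply open_lt; lra).
        apply (filter_imp (fun s => s < 2)); [|exact L]. intros s Hs.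
        unfold lam. rewrite (proj1 (proj2 Hr) (s - 1)) by lra. unfold Rdiv. symmetry. apply Rmult_1_l. }
      assert (D := proj2 (proj2 Hr) t ltac:(lra)).
      rewrite (proj1 (proj2 Hr) (t - 1)) in D by lra.
      auto_derive.
      * split; [eexists; exact D|]. split; [|trivial]. apply Rgt_not_eq. nra.
      * rewD D. field. lra.
    + apply Rdiv_lt_0_compat.
      * assert (H := dickman_lt r 1 t Hr ltac:(lra) ltac:(lra)).
        rewrite (proj1 (proj2 Hr) 1) in H by lra. lra.
      * apply pow_lt. nra.
Qed.

(** Integrating [- r' = lam * r > lam (u - 1) * r] over the window gives
    [r (u - 1) - r u > lam (u - 1) * u * r u]. Division by [u * r u] turns the left side into
    [lam u - 1 / u]. *)
Lemma lam_gap (r : R -> R) (u : R) :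
  dickman_ext r -> 2 <= u ->
  (forall t, u - 1 < t < u -> lam r (u - 1) < lam r t) ->
  0 < lam r u - lam r (u - 1) - 1 / u.
Proof.
  intros Hr Hu Hm. set (c := lam r (u - 1)) in *.
  assert (H : r u + c * RInt r 0 u < r (u - 1) + c * RInt r 0 (u - 1)).
  { apply (derive_lt0_gt (fun t => r t + c * RInt r 0 t)); [lra| |].
    - intros t _. apply continuous_Rplus; [apply Hr|].
      apply continuous_Rmult; [apply continuous_const|now apply continuous_primitive].
    - intros t Ht. exists (- (lam r t * r t) + c * r t). split.
      + apply (is_derive_plus (K := R_AbsRing) (V := R_NormedModule)).
        * apply is_derive_dickman; [exact Hr|lra].
        * apply (is_derive_scal (fun t => RInt r 0 t)), is_derive_primitive, Hr.
      + assert (P := dickman_gt0 r t Hr). assert (H := Hm t Ht). nra. }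
  assert (E := dickman_integral r u Hr ltac:(lra)).
  assert (P := dickman_gt0 r u Hr).
  assert (E2 := lam_mul r u Hr ltac:(lra)).
  assert (E3 : r (u - 1) = lam r u * r u * u) by (rewrite E2; field; lra).
  rewrite E3 in H.
  assert (H' : 0 < (u * r u) * (lam r u - c - 1 / u)).
  { replace ((u * r u) * (lam r u - c - 1 / u))
      with (lam r u * r u * u - c * (u * r u) - r u) by (field; lra).
    rewrite E. lra. }
  assert (0 < u * r u) by nra.
  destruct (Rlt_or_le 0 (lam r u - c - 1 / u)) as [|N]; [assumption|]. nra.
Qed.

(** Beyond 2 the gap is exactly the logarithmic derivative of [lam]. Below 2 the factor [r (t - 1)]
    is constant, which is the separate case [lam_lt_12]. *)
Lemma lam_lt_of_gap (r : R -> R) (x y : R) :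
  dickman_ext r -> 1 <= x -> x < y ->
  (forall t, 2 <= t < y -> 0 < lam r t - lam r (t - 1) - 1 / t) ->
  lam r x < lam r y.
Proof.
  intros Hr.
  assert (A : forall x y, 2 <= x -> x < y ->
    (forall t, 2 <= t < y -> 0 < lam r t - lam r (t - 1) - 1 / t) -> lam r x < lam r y).
  { clear x y. intros x y Hx Hxy Hg. apply derive_gt0_lt; [exact Hxy| |].
    - intros t Ht. apply continuous_lam; [exact Hr|lra].
    - intros t Ht. exists (lam r t * (lam r t - lam r (t - 1) - 1 / t)). split.
      + assert (D := is_derive_dickman r t Hr ltac:(lra)).
        assert (D1 := is_derive_dickman r (t - 1) Hr ltac:(lra)).
        assert (P := dickman_gt0 r t Hr). assert (P1 := dickman_gt0 r (t - 1) Hr).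
        unfold lam at 1. auto_derive.
        * change (t + - (1)) with (t - 1). repeat split; try (eexists; eassumption).
          apply Rgt_not_eq. nra.
        * change (t + - (1)) with (t - 1). rewD D. rewD D1.
          replace (r (t - 1)) with (lam r t * r t * t)
            by (rewrite (lam_mul r t Hr) by lra; field; lra).
          field. lra.
      + apply Rmult_lt_0_compat; [apply lam_gt0; [exact Hr|lra]|apply Hg; lra]. }
  intros Hx Hxy Hg.
  destruct (Rle_or_lt 2 x) as [L|L]; [now apply A|].
  destruct (Rle_or_lt y 2) as [L'|L']; [now apply lam_lt_12|].
  apply Rlt_trans with (lam r 2); [apply lam_lt_12; auto; lra|apply A; auto; lra].
Qed.

(** A bootstrap: a positive gap before [v] makes [lam] increase up to [v], which is what [lam_gap]
    needs to give a positive gap at [v]. *)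
Lemma lam_gap_gt0 (r : R -> R) (u : R) :
  dickman_ext r -> 2 <= u -> 0 < lam r u - lam r (u - 1) - 1 / u.
Proof.
  intros Hr. apply (real_induction_gt0 (fun u => lam r u - lam r (u - 1) - 1 / u) 2).
  - intros x Hx. apply (continuous_minus (fun u => lam r u - lam r (u - 1)) (fun u => 1 / u)).
    + apply (continuous_minus (lam r) (fun u => lam r (u - 1))).
      * apply continuous_lam; [exact Hr|lra].
      * apply continuous_shift, continuous_lam; [exact Hr|lra].
    + apply (ex_derive_continuous (fun u => 1 / u)). auto_derive. lra.
  - apply lam_gap; [exact Hr|lra|]. intros t Ht. apply lam_lt_12; auto; lra.
  - intros v Hv Hg. apply lam_gap; [exact Hr|lra|]. intros t Ht.
    apply lam_lt_of_gap; auto; try lra. intros s Hs. apply Hg. lra.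
Qed.

Lemma lam_le (r : R -> R) (x y : R) : dickman_ext r -> 1 <= x -> x <= y -> lam r x <= lam r y.
Proof.
  intros Hr Hx [Hxy|<-]; [left|lra]. apply lam_lt_of_gap; auto.
  intros t Ht. apply lam_gap_gt0; [exact Hr|lra].
Qed.

(** [- r' / r] on both sides of 1: on [(0, 1]] the function [lam] is [1 / u], whereas the constant
    [r] has slope 0. *)
Definition slope (r : R -> R) (u : R) : R := if Rle_dec u 1 then 0 else lam r u.

(** The concave function [ln r] lies below its tangent at [y], here to the left of the point of
    contact; [dickman_log_ge] is the same to the right. *)
Lemma dickman_log_le (r : R -> R) (x y : R) :
  dickman_ext r -> x <= y -> r x <= r y * exp (slope r y * (y - x)).
Proof.
  intros Hr Hxy. unfold slope. destruct (Rle_dec y 1) as [L|L].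
  - assert (H1 := proj1 (proj2 Hr)). rewrite !H1 by lra. rewrite Rmult_0_l, exp_0. lra.
  - set (c := lam r y). assert (Pc : 0 < c) by (apply lam_gt0; [exact Hr|lra]).
    assert (M : forall x, 1 <= x -> x <= y -> r x <= r y * exp (c * (y - x))).
    { intros z Hz Hzy.
      assert (H : r z * exp (c * z) <= r y * exp (c * y)).
      { apply (derive_ge0_le (fun z => r z * exp (c * z))); [exact Hzy| |].
        - intros t _. apply continuous_Rmult; [apply Hr|].
          apply (ex_derive_continuous (fun t => exp (c * t))). auto_derive. trivial.
        - intros t Ht. exists ((c - lam r t) * (r t * exp (c * t))). split.
          + assert (D := is_derive_dickman r t Hr ltac:(lra)).
            auto_derive; [eexists; exact D|]. rewD D. ring.
          + apply Rmult_le_pos.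
            * assert (lam r t <= c) by (apply lam_le; auto; lra). lra.
            * apply Rmult_le_pos; [left; now apply dickman_gt0|left; apply exp_pos]. }
      replace (c * (y - z)) with (c * y + - (c * z)) by ring.
      rewrite exp_plus, exp_Ropp. apply (Rmult_le_reg_r (exp (c * z))); [apply exp_pos|].
      replace (r y * (exp (c * y) * / exp (c * z)) * exp (c * z)) with (r y * exp (c * y))
        by (field; apply Rgt_not_eq, exp_pos). exact H. }
    destruct (Rle_or_lt 1 x) as [Lx|Lx]; [apply M; lra|].
    rewrite (proj1 (proj2 Hr) x) by lra. rewrite <- (proj1 (proj2 Hr) 1) by lra.
    apply Rle_trans with (r y * exp (c * (y - 1))); [apply M; lra|].
    apply Rmult_le_compat_l; [left; now apply dickman_gt0|].
    left. apply exp_increasing. nra.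
Qed.

Lemma dickman_log_ge (r : R -> R) (x y : R) :
  dickman_ext r -> x <= y -> r y <= r x * exp (- (slope r x * (y - x))).
Proof.
  intros Hr Hxy. unfold slope. destruct (Rle_dec x 1) as [L|L].
  - rewrite (proj1 (proj2 Hr) x) by lra. rewrite Rmult_0_l, Ropp_0, exp_0.
    assert (H := dickman_le1 r y Hr). lra.
  - set (c := lam r x).
    assert (H : r y * exp (c * y) <= r x * exp (c * x)).
    { apply (derive_le0_ge (fun z => r z * exp (c * z))); [exact Hxy| |].
      - intros t _. apply continuous_Rmult; [apply Hr|].
        apply (ex_derive_continuous (fun t => exp (c * t))). auto_derive. trivial.
      - intros t Ht. exists (- ((lam r t - c) * (r t * exp (c * t)))). split.
        + assert (D := is_derive_dickman r t Hr ltac:(lra)).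
          auto_derive; [eexists; exact D|]. rewD D. ring.
        + assert (0 <= (lam r t - c) * (r t * exp (c * t))); [|lra]. apply Rmult_le_pos.
          * assert (c <= lam r t) by (apply lam_le; auto; lra). lra.
          * apply Rmult_le_pos; [left; now apply dickman_gt0|left; apply exp_pos]. }
    replace (- (c * (y - x))) with (c * x + - (c * y)) by ring.
    rewrite exp_plus, exp_Ropp. apply (Rmult_le_reg_r (exp (c * y))); [apply exp_pos|].
    replace (r x * (exp (c * x) * / exp (c * y)) * exp (c * y)) with (r x * exp (c * x))
      by (field; apply Rgt_not_eq, exp_pos). exact H.
Qed.

(** * The truncated Laplace transform *)

(** [expmom 0 z] with a variable upper end, convertible to it at [v = 1]. *)
Definition expint (z v : R) : R := Lap (fun x => x ^ 0) (fun x => x) 0 v z.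

Lemma is_derive_expint (z v : R) : is_derive (expint z) v (exp (z * v)).
Proof.
  apply (is_derive_eq _ _ (v ^ 0 * exp (z * v))); [|simpl; ring].
  apply (is_derive_Lap_bound (fun x => x ^ 0) (fun x => x)).
  - apply continuous_Rpow.
  - intros x. apply continuous_id.
Qed.

Lemma expint_0 (z : R) : expint z 0 = 0.
Proof. apply (RInt_point (V := R_CompleteNormedModule)). Qed.

(** The integral over [0 <= t <= v] of [r (u - t) - r u * exp (xi * t)]. The choice of [xi] makes it
    vanish at [v = 1]. *)
Definition excess (r : R -> R) (u xi v : R) : R :=
  RInt r 0 u - RInt r 0 (u - v) - r u * expint xi v.

Lemma is_derive_flip (f : R -> R) (c x l : R) :
  is_derive f (c - x) l -> is_derive (fun t => f (c - t)) x (- l).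
Proof.
  intros D. auto_derive; [eexists; exact D|]. change (c + - x) with (c - x). rewD D. ring.
Qed.

Lemma is_derive_excess (r : R -> R) (u xi v : R) :
  dickman_ext r -> is_derive (excess r u xi) v (r (u - v) - r u * exp (xi * v)).
Proof.
  intros Hr. apply (is_derive_eq _ _ ((0 - - r (u - v)) - r u * exp (xi * v))); [|ring].
  apply (is_derive_minus (K := R_AbsRing) (V := R_NormedModule)).
  - apply (is_derive_minus (K := R_AbsRing) (V := R_NormedModule)).
    + apply (is_derive_const (K := R_AbsRing) (V := R_NormedModule)).
    + apply (is_derive_flip (fun t => RInt r 0 t)), is_derive_primitive, Hr.
  - apply (is_derive_scal (expint xi)), is_derive_expint.
Qed.

Lemma continuous_excess (r : R -> R) (u xi v : R) :
  dickman_ext r -> continuous (excess r u xi) v.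
Proof. intros Hr. apply (is_derive_continuous _ _ _ (is_derive_excess r u xi v Hr)). Qed.

Lemma excess_0 (r : R -> R) (u xi : R) : excess r u xi 0 = 0.
Proof. unfold excess. rewrite expint_0, Rminus_0_r. ring. Qed.

Lemma excess_1 (r : R -> R) (u xi : R) :
  dickman_ext r -> 1 <= u -> expmom 0 xi = u -> excess r u xi 1 = 0.
Proof.
  intros Hr Hu Hxi. unfold excess. rewrite <- (dickman_integral r u Hr Hu).
  change (expint xi 1) with (expmom 0 xi). rewrite Hxi. ring.
Qed.

(* Log-concavity makes [v |-> r (u - v) / (r u * exp (xi * v))] unimodal, so
   [r (u - v) - r u * exp (xi * v)] changes sign at most once, from + to -. *)
Lemma excess_ge0 (r : R -> R) (u xi v : R) :
  dickman_ext r -> 1 <= u -> expmom 0 xi = u -> 0 <= v <= 1 -> 0 <= excess r u xi v.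
Proof.
  intros Hr Hu Hxi Hv. destruct (Rle_or_lt 0 (excess r u xi v)) as [|N]; [assumption|exfalso].
  assert (E0 := excess_0 r u xi). assert (E1 := excess_1 r u xi Hr Hu Hxi).
  assert (v <> 0) by (intros ->; lra). assert (v <> 1) by (intros ->; lra).
  assert (D := fun v => is_derive_excess r u xi v Hr).
  (* A negative value between two zeros forces the derivative to be negative at some [p < v] and
     positive at some [q > v], the wrong order of signs. *)
  destruct (MVT_open (excess r u xi) 0 v ltac:(lra)) as (p & Hp & Ep).
  { intros x _. now apply continuous_excess. }
  { intros x _. eexists. apply D. }
  destruct (MVT_open (excess r u xi) v 1 ltac:(lra)) as (q & Hq & Eq).
  { intros x _. now apply continuous_excess. }
  { intros x _. eexists. apply D. }
  rewrite (is_derive_unique _ _ _ (D p)) in Ep. rewrite (is_derive_unique _ _ _ (D q)) in Eq.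
  assert (A : r (u - p) < r u * exp (xi * p)) by nra.
  assert (B : r u * exp (xi * q) < r (u - q)) by nra.
  assert (L1 := dickman_log_ge r (u - p) u Hr ltac:(lra)).
  assert (L2 := dickman_log_le r (u - q) (u - p) Hr ltac:(lra)).
  set (c := slope r (u - p)) in *.
  replace (u - (u - p)) with p in L1 by ring.
  replace (u - p - (u - q)) with (q - p) in L2 by ring.
  assert (P := dickman_gt0 r (u - p) Hr).
  (* The tangent at [u - p], followed forward to [u], gives [c < xi] from the sign at [p]. Followed
     backward to [u - q], it grows more slowly than [exp (xi * v)], so the sign at [q] cannot be
     positive. *)
  assert (Lc : c < xi).
  { destruct (Rlt_or_le c xi) as [|N']; [assumption|exfalso].
    assert (HH : r (u - p) * (exp (- (c * p)) * exp (xi * p)) <= r (u - p) * 1).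
    { apply Rmult_le_compat_l; [lra|]. rewrite <- exp_plus, <- exp_0.
      assert (K : - (c * p) + xi * p <= 0) by nra.
      destruct K as [K|K]; [left; now apply exp_increasing|rewrite K; lra]. }
    assert (Px := exp_pos (xi * p)). nra. }
  assert (Hexp : exp (c * (q - p)) <= exp (xi * (q - p))) by (left; apply exp_increasing; nra).
  assert (H2 : exp (xi * q) = exp (xi * p) * exp (xi * (q - p))).
  { rewrite <- exp_plus. f_equal. ring. }
  assert (Px := exp_pos (xi * (q - p))).
  assert (r (u - p) * exp (c * (q - p)) <= r (u - p) * exp (xi * (q - p)))
    by (apply Rmult_le_compat_l; lra).
  assert (r (u - p) * exp (xi * (q - p)) < r u * exp (xi * p) * exp (xi * (q - p)))
    by (apply Rmult_lt_compat_r; lra).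
  rewrite H2 in B. lra.
Qed.

Definition lapl (r : R -> R) (u z : R) : R := Lap r (fun x => x) 0 u z.
Definition lapl1 (r : R -> R) (u z : R) : R := Lap (fun x => x * r x) (fun x => x) 0 u z.

Lemma is_derive_lapl (r : R -> R) (u z : R) :
  dickman_ext r -> is_derive (lapl r u) z (lapl1 r u z).
Proof. intros Hr. apply (is_derive_Lap r (fun x => x)); [apply Hr|intros x; apply continuous_id]. Qed.

Lemma continuous_idmul (r : R -> R) : dickman_ext r -> forall x, continuous (fun x => x * r x) x.
Proof. intros Hr x. apply continuous_Rmult; [apply continuous_id|apply Hr]. Qed.

Lemma is_derive_lapl1 (r : R -> R) (u z : R) :
  dickman_ext r -> exists l, is_derive (lapl1 r u) z l.
Proof.
  intros Hr. eexists. apply (is_derive_Lap (fun x => x * r x) (fun x => x)).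
  - now apply continuous_idmul.
  - intros x. apply continuous_id.
Qed.

Lemma is_derive_lapl_bound (r : R -> R) (u z : R) :
  dickman_ext r -> is_derive (fun u => lapl r u z) u (r u * exp (z * u)).
Proof.
  intros Hr. apply (is_derive_Lap_bound r (fun x => x)); [apply Hr|intros x; apply continuous_id].
Qed.

Lemma is_derive_lapl1_bound (r : R -> R) (u z : R) :
  dickman_ext r -> is_derive (fun u => lapl1 r u z) u (u * r u * exp (z * u)).
Proof.
  intros Hr. apply (is_derive_Lap_bound (fun x => x * r x) (fun x => x)).
  - now apply continuous_idmul.
  - intros x. apply continuous_id.
Qed.

Lemma lapl_0 (r : R -> R) (z : R) : lapl r 0 z = 0.
Proof. apply (RInt_point (V := R_CompleteNormedModule)). Qed.

Lemma lapl1_0 (r : R -> R) (z : R) : lapl1 r 0 z = 0.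
Proof. apply (RInt_point (V := R_CompleteNormedModule)). Qed.

Lemma continuous_lapl_bound (r : R -> R) (u z : R) :
  dickman_ext r -> continuous (fun u => lapl r u z) u.
Proof. intros Hr. apply (is_derive_continuous _ _ _ (is_derive_lapl_bound r u z Hr)). Qed.

Lemma continuous_lapl1_bound (r : R -> R) (u z : R) :
  dickman_ext r -> continuous (fun u => lapl1 r u z) u.
Proof. intros Hr. apply (is_derive_continuous _ _ _ (is_derive_lapl1_bound r u z Hr)). Qed.

(** Integration by parts of [(x r)' = r x - r (x - 1)] against [exp (z * x)], done by comparing
    derivatives in [u]. On [[0, 1]], where [r = 1] and that equation fails, the identity is computed
    directly. *)
Lemma lapl_ode (r : R -> R) (u z : R) :
  dickman_ext r -> 1 <= u ->
  z * lapl1 r u z + lapl r u z = u * r u * exp (z * u) + exp z * lapl r (u - 1) z.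
Proof.
  intros Hr Hu.
  assert (E1 : z * lapl1 r 1 z + lapl r 1 z - 1 * exp (z * 1)
     = z * lapl1 r 0 z + lapl r 0 z - 0 * exp (z * 0)).
  { apply (derive_eq0_eq (fun u => z * lapl1 r u z + lapl r u z - u * exp (z * u))); [lra| |].
    - intros x _. apply (continuous_minus (fun u => z * lapl1 r u z + lapl r u z)
        (fun u => u * exp (z * u))).
      + apply continuous_Rplus; [|now apply continuous_lapl_bound].
        apply continuous_Rmult; [apply continuous_const|now apply continuous_lapl1_bound].
      + apply (ex_derive_continuous (fun u => u * exp (z * u))). auto_derive. trivial.
    - intros x Hx. assert (D := is_derive_lapl_bound r x z Hr).
      assert (D1 := is_derive_lapl1_bound r x z Hr).
      apply (is_derive_eq _ _ ((z * (x * r x * exp (z * x)) + r x * exp (z * x))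
        - (exp (z * x) + x * (z * exp (z * x))))).
      + apply (is_derive_minus (K := R_AbsRing) (V := R_NormedModule)).
        * apply (is_derive_plus (K := R_AbsRing) (V := R_NormedModule)); [|exact D].
          apply (is_derive_scal (fun u => lapl1 r u z)), D1.
        * auto_derive; [trivial|ring].
      + rewrite (proj1 (proj2 Hr) x) by lra. ring. }
  rewrite lapl_0, lapl1_0 in E1.
  assert (E2 : z * lapl1 r u z + lapl r u z - (u * r u * exp (z * u) + exp z * lapl r (u - 1) z)
    = z * lapl1 r 1 z + lapl r 1 z - (1 * r 1 * exp (z * 1) + exp z * lapl r (1 - 1) z)).
  { apply (derive_eq0_eq (fun u => z * lapl1 r u z + lapl r u z
      - (u * r u * exp (z * u) + exp z * lapl r (u - 1) z))); [lra| |].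
    - intros x _. apply (continuous_minus (fun u => z * lapl1 r u z + lapl r u z)
        (fun u => u * r u * exp (z * u) + exp z * lapl r (u - 1) z)).
      + apply continuous_Rplus; [|now apply continuous_lapl_bound].
        apply continuous_Rmult; [apply continuous_const|now apply continuous_lapl1_bound].
      + apply continuous_Rplus.
        * apply continuous_Rmult; [now apply continuous_idmul|].
          apply (ex_derive_continuous (fun u => exp (z * u))). auto_derive. trivial.
        * apply continuous_Rmult; [apply continuous_const|].
          apply (continuous_shift (fun u => lapl r u z)). now apply continuous_lapl_bound.
    - intros x Hx. assert (D := is_derive_lapl_bound r x z Hr).
      assert (D1 := is_derive_lapl1_bound r x z Hr).
      assert (Dr := proj2 (proj2 Hr) x ltac:(lra)).
      assert (Ds := is_derive_shift (fun u => lapl r u z) 1 x _ (is_derive_lapl_bound r (x - 1) z Hr)).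
      apply (is_derive_eq _ _ ((z * (x * r x * exp (z * x)) + r x * exp (z * x))
        - ((r x * exp (z * x) + x * - (r (x - 1) / x) * exp (z * x) + x * r x * (z * exp (z * x)))
           + exp z * (r (x - 1) * exp (z * (x - 1)))))).
      + apply (is_derive_minus (K := R_AbsRing) (V := R_NormedModule)).
        * apply (is_derive_plus (K := R_AbsRing) (V := R_NormedModule)); [|exact D].
          apply (is_derive_scal (fun u => lapl1 r u z)), D1.
        * apply (is_derive_plus (K := R_AbsRing) (V := R_NormedModule)).
          -- auto_derive; [eexists; exact Dr|]. rewD Dr. ring.
          -- apply (is_derive_scal (fun u => lapl r (u - 1) z)), Ds.
      + replace (z * x) with (z * (x - 1) + z) by ring. rewrite exp_plus. field. lra. }
  replace (1 - 1) with 0 in E2 by ring.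
  rewrite lapl_0, (proj1 (proj2 Hr) 1) in E2 by lra. lra.
Qed.

(** The bracket is the integral of [excess' * exp (- z v)] over [[0, 1]]. As [excess] vanishes at
    both ends, parts turn it into [z] times an integral of a nonnegative function; the second factor
    [z] makes a square. *)
Lemma lapl_window (r : R -> R) (u xi z : R) :
  dickman_ext r -> 1 <= u -> expmom 0 xi = u ->
  0 <= z * ((lapl r u z - lapl r (u - 1) z) * exp (- (z * u)) - r u * expmom 0 (xi - z)).
Proof.
  intros Hr Hu Hxi.
  assert (D : forall v, is_derive (fun v => (lapl r u z - lapl r (u - v) z) * exp (- (z * u))
     - r u * expint (xi - z) v - excess r u xi v * exp (- (z * v))) v
     (z * (excess r u xi v * exp (- (z * v))))).
  { intros v. assert (D1 := is_derive_lapl_bound r (u - v) z Hr).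
    assert (D2 := is_derive_expint (xi - z) v). assert (D3 := is_derive_excess r u xi v Hr).
    apply (is_derive_eq _ _ ((- - (r (u - v) * exp (z * (u - v)))) * exp (- (z * u))
      - r u * exp ((xi - z) * v)
      - ((r (u - v) - r u * exp (xi * v)) * exp (- (z * v))
          + excess r u xi v * (- z * exp (- (z * v)))))).
    - apply (is_derive_minus (K := R_AbsRing) (V := R_NormedModule));
        [apply (is_derive_minus (K := R_AbsRing) (V := R_NormedModule))|].
      + auto_derive; [eexists; exact D1|]. change (u + - v) with (u - v). rewD D1. ring.
      + now apply (is_derive_scal (expint (xi - z))).
      + auto_derive; [eexists; exact D3|]. rewD D3. ring.
    - replace (z * (u - v)) with (z * u + - (z * v)) by ring.
      replace ((xi - z) * v) with (xi * v + - (z * v)) by ring.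
      rewrite !exp_plus, (exp_Ropp (z * u)). field. apply Rgt_not_eq, exp_pos. }
  set (F := fun v => (lapl r u z - lapl r (u - v) z) * exp (- (z * u))
     - r u * expint (xi - z) v - excess r u xi v * exp (- (z * v))) in D.
  assert (C : forall v, continuous F v) by (intros v; apply (is_derive_continuous _ _ _ (D v))).
  assert (F0 : F 0 = 0).
  { unfold F. rewrite excess_0, expint_0, Rminus_0_r. ring. }
  assert (F1 : F 1 = (lapl r u z - lapl r (u - 1) z) * exp (- (z * u)) - r u * expmom 0 (xi - z)).
  { unfold F. rewrite (excess_1 r u xi Hr Hu Hxi).
    change (expint (xi - z) 1) with (expmom 0 (xi - z)). ring. }
  rewrite <- F1.
  assert (K : forall v, 0 < v < 1 -> 0 <= excess r u xi v * exp (- (z * v))).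
  { intros v Hv. apply Rmult_le_pos; [apply excess_ge0; auto; lra|left; apply exp_pos]. }
  destruct (Rle_or_lt 0 z) as [L|L].
  - assert (F 0 <= F 1); [|nra]. apply derive_ge0_le; [lra|intros; apply C|].
    intros v Hv. eexists. split; [apply D|]. specialize (K v Hv). nra.
  - assert (F 1 <= F 0); [|nra]. apply derive_le0_ge; [lra|intros; apply C|].
    intros v Hv. eexists. split; [apply D|]. specialize (K v Hv). nra.
Qed.

Lemma lapl_ineq_ne0 (r : R -> R) (u xi z : R) :
  dickman_ext r -> 1 <= u -> expmom 0 xi = u -> z <> 0 -> z <> xi ->
  r u * exp (z * u) * ((expmom 0 z - u) / (z - xi)) <= expmom 0 z * lapl r u z - lapl1 r u z.
Proof.
  intros Hr Hu Hxi Hz Hzx.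
  assert (W := lapl_window r u xi z Hr Hu Hxi).
  assert (O := lapl_ode r u z Hr Hu).
  assert (Mz := expmom0_mul z). assert (Mx := expmom0_mul xi). assert (Md := expmom0_mul (xi - z)).
  rewrite Hxi in Mx.
  assert (Ed : exp (xi - z) * exp z = exp xi) by (rewrite <- exp_plus; f_equal; ring).
  assert (Em : exp (- (z * u)) * exp (z * u) = 1)
    by (rewrite <- exp_plus, Rplus_opp_l; apply exp_0).
  set (A := lapl r u z) in *. set (B := lapl r (u - 1) z) in *. set (A1 := lapl1 r u z) in *.
  assert (Pe := exp_pos z). assert (Pu := exp_pos (z * u)).
  (* Multiplied by [z - xi], this only uses [exp xi = 1 + u * xi]. It converts the window bound into
     the quotient [(I'(z) - u) / (z - xi)]. *)
  assert (Eq : exp z * expmom 0 (xi - z) - u = z * ((expmom 0 z - u) / (z - xi))).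
  { apply (Rmult_eq_reg_l (z - xi)); [|lra].
    replace ((z - xi) * (z * ((expmom 0 z - u) / (z - xi)))) with (z * expmom 0 z - z * u) by (field; lra).
    rewrite Mz.
    replace ((z - xi) * (exp z * expmom 0 (xi - z) - u))
      with (- exp z * ((xi - z) * expmom 0 (xi - z)) - z * u + xi * u) by ring.
    rewrite Md, Mx, <- Ed. ring. }
  assert (W2 : 0 <= z * ((exp z * (A - B)) - r u * exp (z * u) * (exp z * expmom 0 (xi - z)))).
  { replace (z * (exp z * (A - B) - r u * exp (z * u) * (exp z * expmom 0 (xi - z))))
      with ((exp z * exp (z * u)) * (z * ((A - B) * exp (- (z * u)) - r u * expmom 0 (xi - z)))).
    - apply Rmult_le_pos; [|exact W]. left. now apply Rmult_lt_0_compat.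
    - transitivity (exp z * z * ((A - B) * (exp (- (z * u)) * exp (z * u)))
        - exp z * z * exp (z * u) * r u * expmom 0 (xi - z)); [ring|].
      rewrite Em. ring. }
  replace (exp z * expmom 0 (xi - z)) with (u + z * ((expmom 0 z - u) / (z - xi))) in W2 by lra.
  set (G := (expmom 0 z - u) / (z - xi)) in *.
  assert (W3 : 0 <= z * z * (expmom 0 z * A - A1 - r u * exp (z * u) * G)).
  { replace (z * z * (expmom 0 z * A - A1 - r u * exp (z * u) * G))
      with (z * ((z * expmom 0 z) * A - z * A1 - r u * exp (z * u) * (z * G))) by ring.
    rewrite Mz.
    replace ((exp z - 1) * A - z * A1 - r u * exp (z * u) * (z * G))
      with (exp z * (A - B) - r u * exp (z * u) * (u + z * G)); [exact W2|].
    lra. }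
  assert (0 < z * z) by nra.
  destruct (Rle_or_lt (r u * exp (z * u) * G) (expmom 0 z * A - A1)) as [|N]; [assumption|]. nra.
Qed.

Lemma continuous_le_punctured (f g : R -> R) (x : R) :
  continuous f x -> continuous g x ->
  (exists d, 0 < d /\ forall y, x < y < x + d -> f y <= g y) -> f x <= g x.
Proof.
  intros Cf Cg (d & Hd & H).
  destruct (Rle_or_lt (f x) (g x)) as [|N]; [assumption|exfalso].
  destruct (continuous_gt0_nbhd (fun y => f y - g y) x) as (e & He & K).
  - apply (continuous_minus f g x Cf Cg).
  - lra.
  - assert (P : 0 < Rmin d e) by now apply Rmin_glb_lt.
    assert (Rmin d e <= d) by apply Rmin_l. assert (Rmin d e <= e) by apply Rmin_r.
    assert (K1 := H (x + Rmin d e / 2) ltac:(lra)).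
    assert (K2 := K (x + Rmin d e / 2)). cbv beta in K2.
    rewrite Rabs_pos_eq in K2 by lra. lra.
Qed.

(** The previous argument cancels [z * z]; the value [z = 0] is recovered by continuity from the
    right. *)
Lemma lapl_ineq (r : R -> R) (u xi z : R) :
  dickman_ext r -> 1 <= u -> expmom 0 xi = u -> z <> xi ->
  r u * exp (z * u) * ((expmom 0 z - u) / (z - xi)) <= expmom 0 z * lapl r u z - lapl1 r u z.
Proof.
  intros Hr Hu Hxi Hzx.
  destruct (Req_dec z 0) as [E|N]; [|now apply lapl_ineq_ne0].
  apply (continuous_le_punctured (fun z => r u * exp (z * u) * ((expmom 0 z - u) / (z - xi)))
    (fun z => expmom 0 z * lapl r u z - lapl1 r u z)).
  - apply (ex_derive_continuous (fun z => r u * exp (z * u) * ((expmom 0 z - u) / (z - xi)))).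
    auto_derive. repeat split; [eexists; apply is_derive_expmom|lra].
  - apply (ex_derive_continuous (fun z => expmom 0 z * lapl r u z - lapl1 r u z)).
    destruct (is_derive_lapl1 r u z Hr) as [l Dl].
    auto_derive. repeat split; [eexists; apply is_derive_expmom|eexists; now apply is_derive_lapl|].
    exists l. exact Dl.
  - exists (Rabs (z - xi)). split; [apply Rabs_pos_lt; lra|].
    intros y Hy. apply lapl_ineq_ne0; auto; [lra|].
    intros ->. rewrite Rabs_minus_sym, Rabs_pos_eq in Hy; lra.
Qed.

Definition theta (r : R -> R) (u z : R) : R := lapl r u z * exp (- I z).

Lemma is_derive_theta (r : R -> R) (u z : R) :
  dickman_ext r ->
  is_derive (theta r u) z (- ((expmom 0 z * lapl r u z - lapl1 r u z) * exp (- I z))).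
Proof.
  intros Hr. assert (D := is_derive_lapl r u z Hr). assert (DI := is_derive_I z).
  unfold theta. auto_derive; [split; [eexists; exact D|split; [eexists; exact DI|trivial]]|].
  rewD D. rewD DI. ring.
Qed.

Lemma continuous_theta (r : R -> R) (u z : R) : dickman_ext r -> continuous (theta r u) z.
Proof. intros Hr. apply (is_derive_continuous _ _ _ (is_derive_theta r u z Hr)). Qed.

Lemma theta_ge0 (r : R -> R) (u z : R) : dickman_ext r -> 0 <= u -> 0 <= theta r u z.
Proof.
  intros Hr Hu. apply Rmult_le_pos; [|left; apply exp_pos].
  rewrite <- (lapl_0 r z). apply (derive_ge0_le (fun u => lapl r u z)); [exact Hu| |].
  - intros x _. now apply continuous_lapl_bound.
  - intros x _. eexists. split; [now apply is_derive_lapl_bound|].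
    apply Rmult_le_pos; [left; now apply dickman_gt0|left; apply exp_pos].
Qed.

Lemma theta_decr (r : R -> R) (u xi y z : R) :
  dickman_ext r -> 1 <= u -> expmom 0 xi = u -> y <= z -> z <= xi ->
  theta r u z <= theta r u y.
Proof.
  intros Hr Hu Hxi Hyz Hz. apply derive_le0_ge; [exact Hyz| |].
  - intros x _. now apply continuous_theta.
  - intros x Hx. eexists. split; [now apply is_derive_theta|].
    assert (L := lapl_ineq r u xi x Hr Hu Hxi ltac:(lra)).
    assert (0 <= r u * exp (x * u) * ((expmom 0 x - u) / (x - xi))).
    { apply Rmult_le_pos.
      - apply Rmult_le_pos; [left; now apply dickman_gt0|left; apply exp_pos].
      - replace ((expmom 0 x - u) / (x - xi)) with ((u - expmom 0 x) / (xi - x)) by (field; lra).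
        apply Rdiv_le_0_compat; [|lra]. rewrite <- Hxi. assert (Lx := expmom_lt 0 x xi ltac:(lra)). lra. }
    assert (P := exp_pos (- I x)). nra.
Qed.

(** The factors [exp (I (- x))] cancel, leaving [x] times the integral of [r t * exp (- x t)], and
    [r <= 1]. With [expV] tending to [exp (- gamma)], this bounds [theta] near minus infinity. *)
Lemma theta_neg_le (r : R -> R) (u x : R) :
  dickman_ext r -> 0 <= u -> 0 < x -> expV x * theta r u (- x) <= 1.
Proof.
  intros Hr Hu Hx.
  assert (H : lapl r u (- x) + exp (- x * u) / x <= lapl r 0 (- x) + exp (- x * 0) / x).
  { apply (derive_le0_ge (fun u => lapl r u (- x) + exp (- x * u) / x)); [exact Hu| |].
    - intros t _. apply continuous_Rplus; [now apply continuous_lapl_bound|].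
      apply (ex_derive_continuous (fun u => exp (- x * u) / x)). auto_derive. trivial.
    - intros t _. exists (r t * exp (- x * t) + - exp (- x * t)). split.
      + apply (is_derive_plus (K := R_AbsRing) (V := R_NormedModule));
          [now apply is_derive_lapl_bound|]. auto_derive; [trivial|]. eqR. field. lra.
      + assert (L := dickman_le1 r t Hr). assert (P := exp_pos (- x * t)). nra. }
  rewrite lapl_0, Rmult_0_r, exp_0 in H.
  assert (P : 0 < exp (- x * u) / x) by (apply Rdiv_lt_0_compat; [apply exp_pos|lra]).
  unfold expV, theta.
  assert (E : exp (I (- x)) * exp (- I (- x)) = 1) by (rewrite <- exp_plus, Rplus_opp_r; apply exp_0).
  replace (x * exp (I (- x)) * (lapl r u (- x) * exp (- I (- x))))
    with (x * lapl r u (- x) * (exp (I (- x)) * exp (- I (- x)))) by ring.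
  rewrite E, Rmult_1_r. apply Rle_trans with (x * (1 / x)); [|right; field; lra].
  apply Rmult_le_compat_l; lra.
Qed.

Lemma theta_le_euler (r : R -> R) (u xi z : R) :
  dickman_ext r -> 1 <= u -> expmom 0 xi = u -> z <= xi ->
  theta r u z * exp (- euler_gamma) <= 1.
Proof.
  intros Hr Hu Hxi Hz.
  assert (T0 := theta_ge0 r u z Hr ltac:(lra)).
  destruct T0 as [T0|T0]; [|rewrite <- T0, Rmult_0_l; lra].
  apply (Rmult_le_reg_r (/ theta r u z)); [now apply Rinv_0_lt_compat|].
  replace (theta r u z * exp (- euler_gamma) * / theta r u z) with (exp (- euler_gamma)) by (field; lra).
  rewrite Rmult_1_l.
  apply (is_lim_seq_le_loc (fun n => expV (INR n)) (fun _ => / theta r u z)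
    (exp (- euler_gamma)) (/ theta r u z)).
  - assert (Hn : exists n, 0 < INR n /\ - z < INR n).
    { assert (P : 0 < / (Rabs z + 1)) by (apply Rinv_0_lt_compat; assert (H := Rabs_pos z); lra).
      destruct (archimed_cor1 _ P) as [n [H1 H2]]. exists n. apply lt_0_INR in H2. split; [exact H2|].
      apply Rinv_lt_cancel in H1; [|lra]. assert (H3 := Rle_abs (- z)). rewrite Rabs_Ropp in H3. lra. }
    destruct Hn as (n & Hn1 & Hn2). exists n. intros k Hk. apply le_INR in Hk.
    assert (A := theta_neg_le r u (INR k) Hr ltac:(lra) ltac:(lra)).
    assert (B := theta_decr r u xi (- INR k) z Hr Hu Hxi ltac:(lra) Hz).
    assert (V : 0 < expV (INR k)) by (rewrite <- expV_0; apply expV_lt; lra).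
    apply (Rmult_le_reg_r (theta r u z)); [exact T0|]. rewrite Rinv_l by lra.
    apply Rle_trans with (expV (INR k) * theta r u (- INR k)); [|exact A].
    apply Rmult_le_compat_l; lra.
  - apply expV_lim_euler.
  - apply is_lim_seq_const.
Qed.

(** * The saddle-point integral *)

(* An explicit substitute for the solution [y] of [exp y - 1 - y = t ^ 2 / 2] having
   the sign of [t]: [1 / yq t = 1 / t + 1 / wid t] with [wid] even, so that
   [1 / yq t - 1 / yq (- t) = 2 / t] exactly.  The constants in [wid] match
   [1 / y = 1 / t + 1 / 6 - t ^ 2 / 1080 + ...].  For [t <= - sqrt 60] the sum
   [wid t + t] is not positive and [yq t] is meaningless. *)
Definition wid (t : R) : R := sqrt (36 + 2 / 5 * t ^ 2).
Definition yq (t : R) : R := t * wid t / (wid t + t).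

Lemma wid_sq (t : R) : wid t * wid t = 36 + 2 / 5 * t ^ 2.
Proof. apply sqrt_sqrt. nra. Qed.

Lemma wid_ge6 (t : R) : 6 <= wid t.
Proof.
  assert (H := wid_sq t). assert (P : 0 <= wid t) by apply sqrt_pos.
  destruct (Rle_or_lt 6 (wid t)) as [|N]; [assumption|]. nra.
Qed.

Lemma wid_opp (t : R) : wid (- t) = wid t.
Proof. unfold wid. f_equal. ring. Qed.

Lemma is_derive_wid (t : R) : is_derive wid t (2 / 5 * t / wid t).
Proof.
  assert (H := wid_ge6 t). unfold wid in *. auto_derive.
  - nra.
  - change (t * (t * 1)) with (t ^ 2). set (w := sqrt (36 + 2 / 5 * t ^ 2)) in *.
    eqR. field. lra.
Qed.

Lemma is_derive_yq (t : R) :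
  0 < wid t + t ->
  is_derive yq t ((wid t ^ 3 + 2 / 5 * t ^ 3) / (wid t * (wid t + t) ^ 2)).
Proof.
  intros Ht. assert (D := is_derive_wid t). assert (H := wid_ge6 t).
  unfold yq. auto_derive.
  - repeat split; try (eexists; exact D). lra.
  - rewD D. field. lra.
Qed.

Lemma wid_add_mono (s t : R) : 0 < wid t + t -> t <= s -> 0 < wid s + s.
Proof.
  intros Ht Hts. assert (Hs := wid_ge6 s). assert (H6 := wid_ge6 t).
  destruct (Rlt_or_le 0 (wid s + s)) as [|N]; [assumption|exfalso].
  assert (Es := wid_sq s). assert (Et := wid_sq t).
  assert (t * t <= wid t * wid t) by nra.
  assert (wid s * wid s <= s * s) by nra.
  assert (s * s <= t * t) by nra. nra.
Qed.

(** The sign of the derivative in [yq_exp_ge]; the extra factor [s] treats both branches at once. *)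
Lemma yq_sign_aux (s : R) :
  0 < wid s + s ->
  0 <= s * ((yq s + s ^ 2 / 2) * ((wid s ^ 3 + 2 / 5 * s ^ 3) / (wid s * (wid s + s) ^ 2)) - s).
Proof.
  intros Hs. assert (H6 := wid_ge6 s). assert (E := wid_sq s).
  unfold yq. set (b := wid s) in *.
  set (K := (b - 6) * (7 / 2 * b ^ 2 + 33 * b + 90) + 2 * s * b * (b + 3)).
  (* An identity modulo [b^2 = 36 + 2/5 s^2]. The factor [b + 6] is there because
     [(b - 6) * (b + 6) = 2/5 s^2]. It remains to see that [K] has the sign of [s]: clear for
     [s >= 0], and for [s < 0] a factor [s] of [(b + 6) * K] splits off, with a cofactor nonnegative
     thanks to [b + s > 0]. *)
  assert (Id : ((2 * b + s * (b + s)) * (b ^ 3 + 2 / 5 * s ^ 3) - 2 * b * (b + s) ^ 3) * (b + 6)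
     = 2 / 5 * s ^ 3 * K).
  { transitivity (2 / 5 * s ^ 3 * K + (b * b - (36 + 2 / 5 * s ^ 2)) * (s * (b ^ 2 * (b + s) - s ^ 2 * (b + 6)))).
    - unfold K. field.
    - rewrite E. ring. }
  replace (s * ((s * b / (b + s) + s ^ 2 / 2) * ((b ^ 3 + 2 / 5 * s ^ 3) / (b * (b + s) ^ 2)) - s))
    with (s * s * (((2 * b + s * (b + s)) * (b ^ 3 + 2 / 5 * s ^ 3) - 2 * b * (b + s) ^ 3) * (b + 6))
          / (2 * b * (b + 6) * (b + s) ^ 3)) by (field; lra).
  rewrite Id. apply Rdiv_le_0_compat.
  - replace (s * s * (2 / 5 * s ^ 3 * K)) with (2 / 5 * (s ^ 2) ^ 2 * (s * K)) by ring.
    assert (0 <= s * K).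
    { unfold K.
      destruct (Rle_or_lt 0 s) as [L|L].
      - apply Rmult_le_pos; [lra|]. apply Rplus_le_le_0_compat; apply Rmult_le_pos; try nra.
      - assert (Sb : (b - 6) * (b + 6) = 2 / 5 * s ^ 2) by (rewrite <- (Rplus_0_r (2 / 5 * s ^ 2)); nra).
        assert (A : (b + 6) * ((b - 6) * (7 / 2 * b ^ 2 + 33 * b + 90) + 2 * s * b * (b + 3)) <= 0).
        { replace ((b + 6) * ((b - 6) * (7 / 2 * b ^ 2 + 33 * b + 90) + 2 * s * b * (b + 3)))
            with (((b - 6) * (b + 6)) * (7 / 2 * b ^ 2 + 33 * b + 90) + 2 * s * b * (b + 3) * (b + 6)) by ring.
          rewrite Sb.
          replace (2 / 5 * s ^ 2 * (7 / 2 * b ^ 2 + 33 * b + 90) + 2 * s * b * (b + 3) * (b + 6))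
            with (s * (2 / 5 * (b + s) * (7 / 2 * b ^ 2 + 33 * b + 90)
               + b * (3 / 5 * b ^ 2 + 24 / 5 * b))) by field.
          assert (0 <= 2 / 5 * (b + s) * (7 / 2 * b ^ 2 + 33 * b + 90)) by (apply Rmult_le_pos; nra).
          assert (0 <= b * (3 / 5 * b ^ 2 + 24 / 5 * b)) by (apply Rmult_le_pos; nra).
          nra. }
        set (K2 := (b - 6) * (7 / 2 * b ^ 2 + 33 * b + 90) + 2 * s * b * (b + 3)) in *.
        assert (K2 <= 0) by nra. nra. }
    apply Rmult_le_pos; [|assumption]. apply Rmult_le_pos; [lra|apply pow2_ge_0].
  - apply Rmult_lt_0_compat; [nra|apply pow_lt; lra].
Qed.

(* With [Delta := exp y - 1 - y - t ^ 2 / 2] and [y := yq t] one has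
   [(Delta * exp (- y))' = exp (- y) * ((y + t ^ 2 / 2) * y' - t)], whose sign is that of [t]. *)
Lemma yq_exp_ge (t : R) : 0 < wid t + t -> t ^ 2 / 2 <= exp (yq t) - 1 - yq t.
Proof.
  intros Ht.
  set (F := fun s => 1 - (1 + yq s + s ^ 2 / 2) * exp (- yq s)).
  assert (D : forall s, 0 < wid s + s -> is_derive F s (exp (- yq s) *
     ((yq s + s ^ 2 / 2) * ((wid s ^ 3 + 2 / 5 * s ^ 3) / (wid s * (wid s + s) ^ 2)) - s))).
  { intros s Hs. assert (Dy := is_derive_yq s Hs). unfold F.
    auto_derive; [repeat split; eexists; exact Dy|]. rewD Dy.
    set (d := (wid s ^ 3 + 2 / 5 * s ^ 3) / (wid s * (wid s + s) ^ 2)). eqR. field. }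
  assert (F0 : F 0 = 0).
  { unfold F, yq. replace (0 * wid 0 / (wid 0 + 0)) with 0.
    - rewrite Ropp_0, exp_0. field.
    - assert (H := wid_ge6 0). field. lra. }
  assert (P := fun s => exp_pos (- yq s)).
  assert (FP : 0 <= F t).
  { destruct (Rle_or_lt 0 t) as [L|L]; rewrite <- F0.
    - apply (derive_ge0_le F); [exact L| |].
      + intros s Hs. apply (is_derive_continuous _ _ _ (D s ltac:(assert (H := wid_ge6 s); lra))).
      + intros s Hs. assert (Hb : 0 < wid s + s) by (assert (H := wid_ge6 s); lra).
        eexists. split; [now apply D|]. assert (A := yq_sign_aux s Hb).
        apply Rmult_le_pos; [left; apply P|]. nra.
    - apply (derive_le0_ge F); [lra| |].
      + intros s Hs. apply (is_derive_continuous _ _ _ (D s (wid_add_mono s t Ht ltac:(lra)))).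
      + intros s Hs. assert (Hb := wid_add_mono s t Ht ltac:(lra)).
        eexists. split; [now apply D|]. assert (A := yq_sign_aux s Hb).
        specialize (P s).
        match goal with |- _ * ?X <= 0 => assert (X <= 0) by nra end. nra. }
  unfold F in FP. assert (Pe := exp_pos (yq t)).
  assert (E : exp (- yq t) * exp (yq t) = 1) by (rewrite <- exp_plus, Rplus_opp_l; apply exp_0).
  assert (0 <= exp (yq t) - (1 + yq t + t ^ 2 / 2)); [|lra].
  replace (exp (yq t) - (1 + yq t + t ^ 2 / 2))
    with (exp (yq t) * (1 - (1 + yq t + t ^ 2 / 2) * exp (- yq t))).
  - apply Rmult_le_pos; lra.
  - transitivity (exp (yq t) - (1 + yq t + t ^ 2 / 2) * (exp (- yq t) * exp (yq t))); [ring|].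
    rewrite E. ring.
Qed.

(** [t^2 = 60] solves [36 + 2/5 t^2 = t^2]: at [t = - sqrt 60] the denominator of [yq] vanishes and
    the negative branch has run off to minus infinity. *)
Lemma sqrt60_bounds : 7.7 < sqrt 60 < 7.8.
Proof.
  assert (P := sqrt_pos 60). assert (E := sqrt_sqrt 60 ltac:(lra)). split; nra.
Qed.

Lemma half_exp_gt (t : R) : sqrt 60 <= t -> t ^ 2 / 2 < exp (t / 2) - 1 - t / 2.
Proof.
  intros Ht. assert (B := sqrt60_bounds). set (y := t / 2).
  assert (Hy : 3.85 < y) by (unfold y; lra). replace t with (2 * y) by (unfold y; field).
  assert (H := exp_ge_taylor y 5 ltac:(lra)). simpl in H.
  assert (L : 1 + y + y ^ 2 / 2 + y ^ 3 / 6 + y ^ 4 / 24 + y ^ 5 / 120 <= exp y) by lra.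
  (* With [t = 2 y] the claim is [2 y^2 < exp y - 1 - y]. At [y = 3.85] the terms up to [y^4] do not
     yet suffice, hence degree 5. *)
  assert (A : 2 < 1 / 2 + y / 6 + y ^ 2 / 24 + y ^ 3 / 120) by nra.
  assert (0 < y ^ 2) by nra.
  assert (y ^ 2 * 2 < y ^ 2 * (1 / 2 + y / 6 + y ^ 2 / 24 + y ^ 3 / 120))
    by (apply Rmult_lt_compat_l; assumption).
  lra.
Qed.

(** * The Gaussian integral on finite intervals *)

Definition gaussint (c t : R) : R := RInt (fun s => exp (- (c * s ^ 2))) 0 t.

Lemma continuous_gauss (c s : R) : continuous (fun s => exp (- (c * s ^ 2))) s.
Proof. apply (ex_derive_continuous (fun s => exp (- (c * s ^ 2)))). auto_derive. trivial. Qed.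

Lemma is_derive_gaussint (c t : R) : is_derive (gaussint c) t (exp (- (c * t ^ 2))).
Proof.
  apply (is_derive_RInt_cont (fun s => exp (- (c * s ^ 2)))). intros s. apply continuous_gauss.
Qed.

Lemma gaussint_0 (c : R) : gaussint c 0 = 0.
Proof. apply (RInt_point (V := R_CompleteNormedModule)). Qed.

Lemma gaussint_ge0 (c t : R) : 0 <= t -> 0 <= gaussint c t.
Proof.
  intros Ht. rewrite <- (gaussint_0 c). apply derive_ge0_le; [exact Ht| |].
  - intros s _. apply (is_derive_continuous _ _ _ (is_derive_gaussint c s)).
  - intros s _. eexists. split; [apply is_derive_gaussint|left; apply exp_pos].
Qed.

Lemma gaussint_le (c t : R) : 0 <= c -> 0 <= t -> gaussint c t <= t.
Proof.
  intros Hc Ht. assert (H : gaussint c t - t <= gaussint c 0 - 0); [|rewrite gaussint_0 in H; lra].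
  apply (derive_le0_ge (fun t => gaussint c t - t)); [exact Ht| |].
  - intros s _. apply (continuous_minus (gaussint c) (fun t => t)); [|apply continuous_id].
    apply (is_derive_continuous _ _ _ (is_derive_gaussint c s)).
  - intros s _. exists (exp (- (c * s ^ 2)) - 1). split.
    + assert (D := is_derive_gaussint c s). auto_derive; [eexists; exact D|]. rewD D. ring.
    + assert (exp (- (c * s ^ 2)) <= 1); [|lra]. rewrite <- exp_0.
      assert (K : - (c * s ^ 2) <= 0) by nra.
      destruct K as [K|K]; [left; now apply exp_increasing|rewrite K; lra].
Qed.

Lemma gauss_scaled (c x : R) :
  x * RInt (fun t => exp (- (c * (x * t) ^ 2))) 0 1 = gaussint c x.
Proof.
  assert (E := RInt_comp_lin (fun s => exp (- (c * s ^ 2))) x 0 0 1).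
  rewrite Rmult_0_r, Rmult_1_r, !Rplus_0_r in E. unfold gaussint. rewrite <- E.
  2:{ apply ex_RInt_cont. intros s. apply continuous_gauss. }
  symmetry. rewrite <- (RInt_scal (V := R_CompleteNormedModule)).
  2:{ apply ex_RInt_cont. intros s.
      apply (ex_derive_continuous (fun t => exp (- (c * (x * t) ^ 2)))). auto_derive. trivial. }
  apply RInt_ext. intros t _. rewrite Rplus_0_r. reflexivity.
Qed.

Definition invsq (t : R) : R := / (1 + t ^ 2).

Lemma continuous_invsq (t : R) : continuous invsq t.
Proof.
  apply (ex_derive_continuous invsq). unfold invsq. auto_derive.
  apply Rgt_not_eq. nra.
Qed.

Lemma continuous_1psq (t : R) : continuous (fun t => 1 + t ^ 2) t.
Proof. apply (ex_derive_continuous (fun t => 1 + t ^ 2)). auto_derive. trivial. Qed.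

Lemma invsq_int : RInt invsq 0 1 = PI / 4.
Proof.
  rewrite <- atan_1. replace (atan 1) with (atan 1 - atan 0) by (rewrite atan_0; ring).
  apply (is_RInt_unique (V := R_CompleteNormedModule)).
  apply (is_RInt_derive atan invsq).
  - intros x _. apply is_derive_Reals. apply derivable_pt_lim_atan.
  - intros x _. apply continuous_invsq.
Qed.

(* The derivative of [gaussint c x ^ 2] cancels that of
   the integral of [exp (- c x^2 (1 + t^2)) / (c (1 + t^2))] over [0 <= t <= 1]. *)
Lemma gaussint_sq (c x : R) :
  0 < c -> 0 <= x ->
  gaussint c x ^ 2 + Lap invsq (fun t => 1 + t ^ 2) 0 1 (- (c * x ^ 2)) / c = PI / (4 * c).
Proof.
  intros Hc Hx.
  assert (DL : forall z, is_derive (Lap invsq (fun t => 1 + t ^ 2) 0 1) z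
     (Lap (fun t => (1 + t ^ 2) * invsq t) (fun t => 1 + t ^ 2) 0 1 z)).
  { intros z. apply (is_derive_Lap invsq (fun t => 1 + t ^ 2)).
    - apply continuous_invsq.
    - apply continuous_1psq. }
  assert (EL : forall y, y * Lap (fun t => (1 + t ^ 2) * invsq t) (fun t => 1 + t ^ 2) 0 1 (- (c * y ^ 2))
     = exp (- (c * y ^ 2)) * gaussint c y).
  { intros y. rewrite <- (gauss_scaled c y).
    replace (exp (- (c * y ^ 2)) * (y * RInt (fun t => exp (- (c * (y * t) ^ 2))) 0 1))
      with (y * (exp (- (c * y ^ 2)) * RInt (fun t => exp (- (c * (y * t) ^ 2))) 0 1)) by ring.
    f_equal. unfold Lap. symmetry. rewrite <- (RInt_scal (V := R_CompleteNormedModule)).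
    - apply RInt_ext. intros t _.
      change (exp (- (c * y ^ 2)) * exp (- (c * (y * t) ^ 2))
        = (1 + t ^ 2) * / (1 + t ^ 2) * exp (- (c * y ^ 2) * (1 + t ^ 2))).
      rewrite <- exp_plus.
      replace ((1 + t ^ 2) * / (1 + t ^ 2)) with 1 by (field; nra).
      rewrite Rmult_1_l. f_equal. ring.
    - apply ex_RInt_cont. intros s.
      apply (ex_derive_continuous (fun t => exp (- (c * (y * t) ^ 2)))). auto_derive. trivial. }
  set (LL := Lap invsq (fun t => 1 + t ^ 2) 0 1) in *.
  set (LL1 := Lap (fun t => (1 + t ^ 2) * invsq t) (fun t => 1 + t ^ 2) 0 1) in *.
  set (F := fun x => gaussint c x ^ 2 + LL (- (c * x ^ 2)) / c).
  assert (D : forall y, is_derive F y 0).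
  { intros y. assert (D1 := is_derive_gaussint c y). assert (D2 := DL (- (c * y ^ 2))).
    unfold F. auto_derive.
    - split; [eexists; exact D1|]. split; [eexists; exact D2|trivial].
    - change (- (c * (y * (y * 1)))) with (- (c * y ^ 2)). rewD D1. rewD D2.
      replace (- (c * (1 * ((1 + 1) * (y * 1)))) * LL1 (- (c * y ^ 2)) * / c)
        with (- 2 * (y * LL1 (- (c * y ^ 2)))) by (field; lra).
      rewrite EL. ring. }
  change (F x = PI / (4 * c)). rewrite (derive_eq0_eq F 0 x Hx).
  - unfold F. rewrite gaussint_0.
    replace (LL (- (c * 0 ^ 2))) with (PI / 4); [field; lra|].
    rewrite <- invsq_int. unfold LL, Lap. apply RInt_ext. intros t _.
    replace (- (c * 0 ^ 2) * (1 + t ^ 2)) with 0 by ring. rewrite exp_0. eqR. ring.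
  - intros y _. apply (is_derive_continuous _ _ _ (D y)).
  - intros y _. apply D.
Qed.

(** A form of the Gaussian integral without a limit: in [gaussint_sq] the remainder is at most
    [exp (- c t^2) / c], which is below [1 / (c^2 t)] for [t >= 1]. *)
Lemma gaussint_lim (c w T : R) :
  0 < c -> (forall t, T <= t -> gaussint c t <= w) -> sqrt (PI / (4 * c)) <= w.
Proof.
  intros Hc H.
  assert (Pw : 0 <= w).
  { apply Rle_trans with (gaussint c (Rmax T 0)); [apply gaussint_ge0, Rmax_r|apply H, Rmax_l]. }
  assert (Psq : PI / (4 * c) <= w ^ 2).
  { destruct (Rle_or_lt (PI / (4 * c)) (w ^ 2)) as [|N]; [assumption|exfalso].
    set (e := PI / (4 * c) - w ^ 2). assert (Pe : 0 < e) by (unfold e; lra).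
    set (t := Rmax (Rmax T 1) (/ (c * c * e))).
    assert (T1 : T <= t) by (apply Rle_trans with (Rmax T 1); apply Rmax_l).
    assert (T2 : 1 <= t) by (apply Rle_trans with (Rmax T 1); [apply Rmax_r|apply Rmax_l]).
    assert (T3 : / (c * c * e) <= t) by apply Rmax_r.
    assert (S := gaussint_sq c t Hc ltac:(lra)). specialize (H t T1).
    assert (G0 := gaussint_ge0 c t ltac:(lra)).
    assert (gaussint c t ^ 2 <= w ^ 2) by nra.
    set (L := Lap invsq (fun t => 1 + t ^ 2) 0 1 (- (c * t ^ 2))) in *.
    assert (UL : L <= exp (- (c * t ^ 2))).
    { replace (exp (- (c * t ^ 2))) with (RInt (fun _ => exp (- (c * t ^ 2))) 0 1).
      2:{ rewrite RInt_const. unfold scal; simpl; unfold mult; simpl. ring. }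
      unfold L, Lap. apply RInt_le; [lra| | |].
      - apply ex_RInt_cont. apply continuous_Lap_integrand; [apply continuous_invsq|apply continuous_1psq].
      - apply ex_RInt_cont. intros x. apply continuous_const.
      - intros x Hx. unfold invsq.
        apply Rle_trans with (1 * exp (- (c * t ^ 2) * (1 + x ^ 2))).
        + apply Rmult_le_compat_r; [left; apply exp_pos|].
          apply Rle_trans with (/ 1); [apply Rinv_le_contravar; nra|rewrite Rinv_1; lra].
        + rewrite Rmult_1_l.
          assert (K : - (c * t ^ 2) * (1 + x ^ 2) <= - (c * t ^ 2)).
          { assert (0 <= c * t ^ 2 * x ^ 2); [|lra].
            apply Rmult_le_pos; [apply Rmult_le_pos; [lra|apply pow2_ge_0]|apply pow2_ge_0]. }
          destruct K as [K|K]; [left; now apply exp_increasing|rewrite K; lra]. }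
    assert (UE : exp (- (c * t ^ 2)) < / (c * t)).
    { assert (Pc : 0 < c * t) by nra.
      rewrite exp_Ropp. apply Rinv_lt_contravar.
      - apply Rmult_lt_0_compat; [exact Pc|apply exp_pos].
      - assert (K := exp_ge_1px (c * t ^ 2)). assert (c * t <= c * t ^ 2); [|lra].
        apply Rmult_le_compat_l; [lra|nra]. }
    assert (UF : L / c < e).
    { apply Rlt_le_trans with (/ (c * t) / c).
      - apply Rmult_lt_compat_r; [now apply Rinv_0_lt_compat|lra].
      - assert (0 < c * c * e) by (apply Rmult_lt_0_compat; nra).
        assert (K : 1 <= t * (c * c * e)).
        { apply (Rmult_le_compat_r (c * c * e)) in T3; [|lra]. rewrite Rinv_l in T3; lra. }
        replace (/ (c * t) / c) with (1 / (c * c * t)) by (field; lra).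
        apply Rle_div_l; [nra|]. lra. }
    unfold e in UF. lra. }
  rewrite <- (sqrt_pow2 w Pw). apply sqrt_le_1_alt. exact Psq.
Qed.

(* [gtail' = - 2 (1 - exp (- A t^2 / 2)) / t^2]: the Gaussian counterpart of the
   derivative of [hcorr] below, taken over both branches. *)
Definition gtail (A t : R) : R := 2 * (1 - exp (- (A / 2 * t ^ 2))) / t - 2 * A * gaussint (A / 2) t.

Lemma is_derive_gtail (A t : R) :
  t <> 0 -> is_derive (gtail A) t (- (2 * (1 - exp (- (A / 2 * t ^ 2))) / t ^ 2)).
Proof.
  intros Ht. assert (D := is_derive_gaussint (A / 2) t). unfold gtail. auto_derive.
  - split; [exact Ht|]. split; [eexists; exact D|trivial].
  - rewD D. change (t * (t * 1)) with (t ^ 2). change (A * / 2) with (A / 2).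
    set (e := exp (- (A / 2 * t ^ 2))). eqR. field. exact Ht.
Qed.

(** * Comparison with the Gaussian along the two branches *)

Lemma exp_neg_le1 (x : R) : 0 <= x -> exp (- x) <= 1.
Proof.
  intros [H| <-]; [|rewrite Ropp_0, exp_0; lra].
  rewrite <- exp_0. left. apply exp_increasing. lra.
Qed.

Lemma exp_le (x y : R) : x <= y -> exp x <= exp y.
Proof. intros [H|<-]; [left; now apply exp_increasing|lra]. Qed.

(* Intended instance: [H y = Theta (xi + y) / (rho u * M xi)]. *)
Record saddle (H D dD : R -> R) (m A : R) : Prop := {
  saddle_m : 0 < m;
  saddle_A : 0 < A;
  saddle_D : forall y, is_derive D y (dD y);
  saddle_D0 : D 0 = 0;
  saddle_dD0 : dD 0 = 0;
  saddle_dD : forall y, 0 <= dD y * y;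
  saddle_D_ge : forall y, A * (exp (m * y) - 1 - m * y) <= D y;
  saddle_H_cont : forall y, continuous H y;
  saddle_H : forall y, y <> 0 ->
    exists d, is_derive H y d /\ d <= - (dD y * exp (- D y) / y) }.

(* The added term is an integration by parts: it turns the bound
   [H' <= - D' e^{-D} / y] into [hcorr' <= - (1 - e^{-D}) / y^2]. *)
Definition hcorr (H D : R -> R) (y : R) : R := H y + (1 - exp (- D y)) / y.

Lemma saddle_D_ge0 (H D dD : R -> R) (m A y : R) : saddle H D dD m A -> 0 <= D y.
Proof.
  intros S. apply Rle_trans with (2 := saddle_D_ge _ _ _ _ _ S y).
  assert (E := exp_ge_1px (m * y)). assert (P := saddle_A _ _ _ _ _ S). nra.
Qed.

Lemma saddle_hcorr (H D dD : R -> R) (m A y : R) :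
  saddle H D dD m A -> y <> 0 ->
  exists d, is_derive (hcorr H D) y d /\ d <= - ((1 - exp (- D y)) / y ^ 2).
Proof.
  intros S Hy. destruct (saddle_H _ _ _ _ _ S y Hy) as (d & Dd & Hd).
  assert (DD := saddle_D _ _ _ _ _ S y).
  exists (d + (dD y * exp (- D y) / y - (1 - exp (- D y)) / y ^ 2)). split; [|lra].
  unfold hcorr. auto_derive.
  - repeat split; [eexists; exact Dd|eexists; exact DD|exact Hy].
  - rewD Dd. rewD DD. field. exact Hy.
Qed.

(** The derivative bound excludes 0, so the two half-lines are treated separately and glued by
    continuity. *)
Lemma saddle_H_decr (H D dD : R -> R) (m A x y : R) :
  saddle H D dD m A -> x <= y -> H y <= H x.
Proof.
  intros S.
  assert (K : forall x y, x <= y -> (0 <= x \/ y <= 0) -> H y <= H x).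
  { clear x y. intros x y Hxy Hs. apply derive_le0_ge; [exact Hxy| |].
    - intros t _. apply (saddle_H_cont _ _ _ _ _ S).
    - intros t Ht. assert (Nt : t <> 0) by lra.
      destruct (saddle_H _ _ _ _ _ S t Nt) as (d & Dd & Hd). exists d. split; [exact Dd|].
      assert (P := saddle_dD _ _ _ _ _ S t).
      assert (0 <= dD t * exp (- D t) / t); [|lra].
      replace (dD t * exp (- D t) / t) with ((dD t * t) * (exp (- D t) / t ^ 2)) by (field; exact Nt).
      apply Rmult_le_pos; [exact P|]. apply Rdiv_le_0_compat; [left; apply exp_pos|].
      assert (0 < t ^ 2) by (apply pow2_gt_0; exact Nt). lra. }
  intros Hxy. destruct (Rle_or_lt 0 x) as [L|L]; [apply K; auto|].
  destruct (Rle_or_lt y 0) as [L'|L']; [apply K; auto|].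
  apply Rle_trans with (H 0); apply K; lra.
Qed.

Lemma saddle_level (H D dD : R -> R) (m A y t : R) :
  saddle H D dD m A -> t ^ 2 / 2 <= exp (m * y) - 1 - m * y ->
  1 - exp (- (A / 2 * t ^ 2)) <= 1 - exp (- D y).
Proof.
  intros S Hq. assert (G := saddle_D_ge _ _ _ _ _ S y). assert (P := saddle_A _ _ _ _ _ S).
  assert (A * (t ^ 2 / 2) <= D y).
  { apply Rle_trans with (2 := G). apply Rmult_le_compat_l; lra. }
  assert (exp (- D y) <= exp (- (A / 2 * t ^ 2))) by (apply exp_le; lra). lra.
Qed.

Lemma wid_lt_sqrt60 (t : R) : - sqrt 60 < t < sqrt 60 -> 0 < wid t + t.
Proof.
  intros Ht. assert (W := wid_ge6 t). assert (E := wid_sq t).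
  assert (E60 := sqrt_sqrt 60 ltac:(lra)).
  assert (t * t < 60) by nra.
  destruct (Rlt_or_le 0 (wid t + t)) as [|N]; [assumption|]. nra.
Qed.

Lemma yq_sign (t : R) : 0 < wid t + t -> 0 <= yq t * t /\ (t <> 0 -> yq t <> 0).
Proof.
  intros Ht. assert (W := wid_ge6 t). unfold yq. split.
  - replace (t * wid t / (wid t + t) * t) with (wid t * t ^ 2 / (wid t + t)) by (field; lra).
    apply Rdiv_le_0_compat; [|exact Ht]. apply Rmult_le_pos; [lra|apply pow2_ge_0].
  - intros N. apply Rmult_integral_contrapositive_currified; [|apply Rinv_neq_0_compat; lra].
    apply Rmult_integral_contrapositive_currified; lra.
Qed.

(** This is [- (1 / yq)'] with [1 / yq = 1 / t + 1 / wid]: an even part [1 / t^2], and an odd part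
    that cancels when the branches [t] and [- t] are added. *)
Lemma yq_weight (t : R) :
  0 < wid t + t -> t <> 0 ->
  (wid t ^ 3 + 2 / 5 * t ^ 3) / (wid t * (wid t + t) ^ 2) / yq t ^ 2
  = 1 / t ^ 2 + 2 / 5 * t / wid t ^ 3.
Proof. intros Ht N. assert (W := wid_ge6 t). unfold yq. field. lra. Qed.

Lemma saddle_curve_deriv (H D dD : R -> R) (m A t : R) :
  saddle H D dD m A -> 0 < wid t + t -> t <> 0 -> 0 <= 1 / t ^ 2 + 2 / 5 * t / wid t ^ 3 ->
  exists d, is_derive (fun t => hcorr H D (yq t / m)) t d /\
    d <= - (m * (1 - exp (- (A / 2 * t ^ 2))) * (1 / t ^ 2 + 2 / 5 * t / wid t ^ 3)).
Proof.
  intros S Ht N Hw. assert (Pm := saddle_m _ _ _ _ _ S).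
  destruct (yq_sign t Ht) as [_ Ny]. specialize (Ny N).
  assert (Nym : yq t / m <> 0).
  { apply Rmult_integral_contrapositive_currified; [exact Ny|apply Rinv_neq_0_compat; lra]. }
  destruct (saddle_hcorr _ _ _ _ _ _ S Nym) as (d & Dd & Hd).
  assert (Dy := is_derive_yq t Ht). assert (Wt := yq_weight t Ht N).
  set (w := (wid t ^ 3 + 2 / 5 * t ^ 3) / (wid t * (wid t + t) ^ 2)) in *.
  exists (w / m * d). split.
  - auto_derive.
    + repeat split; [eexists; exact Dd|eexists; exact Dy].
    + change (yq t * / m) with (yq t / m). rewD Dy. rewD Dd. eqR. field. lra.
  - assert (Py2 : 0 < yq t ^ 2) by (apply pow2_gt_0; exact Ny).
    assert (Ew : w = (1 / t ^ 2 + 2 / 5 * t / wid t ^ 3) * yq t ^ 2).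
    { rewrite <- Wt. field. exact Ny. }
    set (k := 1 / t ^ 2 + 2 / 5 * t / wid t ^ 3) in *.
    assert (Pw : 0 <= w / m).
    { apply Rdiv_le_0_compat; [|exact Pm]. rewrite Ew. apply Rmult_le_pos; lra. }
    assert (L := saddle_level _ _ _ _ _ (yq t / m) t S).
    replace (m * (yq t / m)) with (yq t) in L by (field; lra).
    specialize (L (yq_exp_ge t Ht)).
    apply Rle_trans with (w / m * - ((1 - exp (- D (yq t / m))) / (yq t / m) ^ 2)).
    { apply Rmult_le_compat_l; assumption. }
    rewrite Ew.
    replace (k * yq t ^ 2 / m * - ((1 - exp (- D (yq t / m))) / (yq t / m) ^ 2))
      with (- (m * (1 - exp (- D (yq t / m))) * k)) by (field; lra).
    apply Ropp_le_contravar. apply Rmult_le_compat_r; [exact Hw|].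
    apply Rmult_le_compat_l; lra.
Qed.

Lemma curve_weight_ge0 (t : R) :
  0 < wid t + t -> t <> 0 -> 0 <= 1 / t ^ 2 + 2 / 5 * t / wid t ^ 3.
Proof.
  intros Ht N. assert (W := wid_ge6 t). assert (E := wid_sq t).
  assert (P2 : 0 < t ^ 2) by (apply pow2_gt_0; exact N).
  assert (P3 : 0 < wid t ^ 3) by (apply pow_lt; lra).
  replace (1 / t ^ 2 + 2 / 5 * t / wid t ^ 3)
    with ((wid t ^ 3 + 2 / 5 * t ^ 2 * t) / (t ^ 2 * wid t ^ 3)) by (field; lra).
  apply Rdiv_le_0_compat; [|now apply Rmult_lt_0_compat].
  replace (2 / 5 * t ^ 2) with (wid t * wid t - 36) by lra.
  (* The numerator is [(wid^2 - 36) * (wid + t) + 36 * wid]. *)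
  assert (0 <= (wid t * wid t - 36) * (wid t + t)) by (apply Rmult_le_pos; nra). nra.
Qed.

Lemma yq_small (t : R) : 0 <= t <= 3 -> 0 <= yq t <= 2 * t /\ - (2 * t) <= yq (- t) <= 0.
Proof.
  intros Ht. assert (W := wid_ge6 t). unfold yq. rewrite wid_opp.
  set (b := wid t) in *. repeat split.
  - apply Rdiv_le_0_compat; nra.
  - apply Rle_div_l; nra.
  - apply Rle_div_r; nra.
  - apply Rle_div_l; nra.
Qed.

(** Both branches have the same level [A t^2 / 2], so the odd parts of the weights cancel and the
    difference of the two sides decreases in [t]; near 0 it is not positive. *)
Lemma saddle_inner (H D dD : R -> R) (m A t : R) :
  saddle H D dD m A -> 0 < t < sqrt 60 ->
  hcorr H D (yq t / m) - hcorr H D (yq (- t) / m) <= m * gtail A t.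
Proof.
  intros S Ht. assert (Pm := saddle_m _ _ _ _ _ S). assert (PA := saddle_A _ _ _ _ _ S).
  set (F := fun t => hcorr H D (yq t / m) - hcorr H D (yq (- t) / m) - m * gtail A t).
  assert (Hd : forall s, 0 < s < sqrt 60 -> exists d, is_derive F s d /\ d <= 0).
  { intros s Hs.
    assert (W1 : 0 < wid s + s) by (apply wid_lt_sqrt60; lra).
    assert (W2 : 0 < wid (- s) + - s) by (apply wid_lt_sqrt60; lra).
    destruct (saddle_curve_deriv _ _ _ _ _ s S W1 ltac:(lra) (curve_weight_ge0 s W1 ltac:(lra)))
      as (d1 & D1 & L1).
    destruct (saddle_curve_deriv _ _ _ _ _ (- s) S W2 ltac:(lra) (curve_weight_ge0 (- s) W2 ltac:(lra)))
      as (d2 & D2 & L2).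
    assert (D3 := is_derive_gtail A s ltac:(lra)).
    exists (d1 - - d2 - m * - (2 * (1 - exp (- (A / 2 * s ^ 2))) / s ^ 2)). split.
    - apply (is_derive_minus (K := R_AbsRing) (V := R_NormedModule));
        [apply (is_derive_minus (K := R_AbsRing) (V := R_NormedModule)); [exact D1|]|].
      + replace (- s) with (0 - s) in D2 by ring.
        apply (is_derive_ext (fun s => hcorr H D (yq (0 - s) / m))).
        { intros x. now rewrite Rminus_0_l. }
        apply (is_derive_flip (fun t => hcorr H D (yq t / m))). exact D2.
      + now apply (is_derive_scal (gtail A)).
    - rewrite wid_opp in L2.
      replace ((- s) ^ 2) with (s ^ 2) in L2 by ring.
      set (e := 1 - exp (- (A / 2 * s ^ 2))) in *. assert (W := wid_ge6 s).
      replace (m * e * (1 / s ^ 2 + 2 / 5 * - s / wid s ^ 3))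
        with (m * e * (1 / s ^ 2) - m * e * (2 / 5 * s / wid s ^ 3)) in L2 by (field; lra).
      replace (m * e * (1 / s ^ 2 + 2 / 5 * s / wid s ^ 3))
        with (m * e * (1 / s ^ 2) + m * e * (2 / 5 * s / wid s ^ 3)) in L1 by (field; lra).
      replace (m * - (2 * e / s ^ 2)) with (- (2 * (m * e * (1 / s ^ 2)))) by (field; lra). lra. }
  assert (Mono : forall e, 0 < e < t -> F t <= F e).
  { intros e He. apply derive_le0_ge; [lra| |].
    - intros x Hx. destruct (Hd x ltac:(lra)) as (d & Dx & _). apply (is_derive_continuous _ _ _ Dx).
    - intros x Hx. apply Hd. lra. }
  assert (Key : F t <= 0); [|unfold F in Key; lra].
  destruct (Rle_or_lt (F t) 0) as [|N]; [assumption|exfalso].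
  assert (DD := saddle_D _ _ _ _ _ S 0). rewrite (saddle_dD0 _ _ _ _ _ S) in DD.
  apply is_derive_Reals in DD. destruct (DD (F t / 4) ltac:(lra)) as [del Hdel].
  assert (Pdel := cond_pos del).
  rewrite (saddle_D0 _ _ _ _ _ S) in Hdel.
  assert (Small : forall y, 0 < y < del -> (1 - exp (- D y)) / y <= F t / 4
      /\ - ((1 - exp (- D (- y))) / (- y)) <= F t / 4).
  { intros y Hy.
    assert (K1 := Hdel y ltac:(lra) ltac:(rewrite Rabs_pos_eq; lra)).
    assert (K2 := Hdel (- y) ltac:(lra) ltac:(rewrite Rabs_Ropp, Rabs_pos_eq; lra)).
    rewrite Rplus_0_l in K1, K2. apply Rabs_def2 in K1. apply Rabs_def2 in K2.
    assert (E1 := exp_ge_1px (- D y)). assert (E2 := exp_ge_1px (- D (- y))).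
    assert (I0 := Rinv_0_lt_compat y ltac:(lra)). split.
    - apply Rle_trans with (D y / y); [apply Rmult_le_compat_r; lra|].
      replace ((D y - 0) / y - 0) with (D y / y) in K1 by (field; lra). lra.
    - replace ((D (- y) - 0) / - y - 0) with (- (D (- y) / y)) in K2 by (field; lra).
      replace (- ((1 - exp (- D (- y))) / - y)) with ((1 - exp (- D (- y))) / y) by (field; lra).
      apply Rle_trans with (D (- y) / y); [apply Rmult_le_compat_r; lra|]. lra. }
  (* [t / 2] keeps [e] below [t], 3 allows [yq_small], [m * del / 4] brings both points within [del]
     of 0, and the last entry makes [2 A m e] at most [F t / 8]. Then [F e] is at most three
     quarters of [F t], against [F t <= F e]. *)
  set (e := Rmin (Rmin (t / 2) 3) (Rmin (m * del / 4) (F t / (16 * A * m)))).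
  assert (Pe : 0 < e).
  { unfold e. repeat apply Rmin_glb_lt; try lra.
    - apply Rdiv_lt_0_compat; nra.
    - apply Rdiv_lt_0_compat; [lra|nra]. }
  assert (e1 : e <= t / 2) by (unfold e; eapply Rle_trans; [apply Rmin_l|apply Rmin_l]).
  assert (e2 : e <= 3) by (unfold e; eapply Rle_trans; [apply Rmin_l|apply Rmin_r]).
  assert (e3 : e <= m * del / 4) by (unfold e; eapply Rle_trans; [apply Rmin_r|apply Rmin_l]).
  assert (e4 : e <= F t / (16 * A * m)) by (unfold e; eapply Rle_trans; [apply Rmin_r|apply Rmin_r]).
  destruct (yq_small e ltac:(lra)) as [Y1 Y2].
  assert (W1 : 0 < wid e + e) by (apply wid_lt_sqrt60; lra).
  assert (W2 : 0 < wid (- e) + - e) by (apply wid_lt_sqrt60; lra).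
  assert (N1 := proj2 (yq_sign e W1) ltac:(lra)). assert (N2 := proj2 (yq_sign (- e) W2) ltac:(lra)).
  assert (Im := Rinv_0_lt_compat m Pm).
  assert (Q : 2 * e / m < del).
  { apply Rlt_div_l; nra. }
  assert (B1 : 0 < yq e / m < del).
  { split; [apply Rdiv_lt_0_compat; lra|].
    apply Rle_lt_trans with (2 * e / m); [apply Rmult_le_compat_r; lra|exact Q]. }
  assert (B2 : 0 < - (yq (- e) / m) < del).
  { replace (- (yq (- e) / m)) with (- yq (- e) / m) by (field; lra).
    split; [apply Rdiv_lt_0_compat; lra|].
    apply Rle_lt_trans with (2 * e / m); [apply Rmult_le_compat_r; lra|exact Q]. }
  assert (S1 := proj1 (Small _ B1)). assert (S2 := proj2 (Small _ B2)).
  rewrite Ropp_involutive in S2.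
  assert (HH : H (yq e / m) <= H (yq (- e) / m)) by (apply (saddle_H_decr _ _ _ _ _ _ _ S); lra).
  assert (GG : - (m * gtail A e) <= F t / 4).
  { assert (G1 := gaussint_le (A / 2) e ltac:(lra) ltac:(lra)). unfold gtail.
    assert (E1 := exp_neg_le1 (A / 2 * e ^ 2) ltac:(nra)).
    assert (0 <= 2 * (1 - exp (- (A / 2 * e ^ 2))) / e) by (apply Rdiv_le_0_compat; lra).
    assert (U : 2 * A * m * e <= F t / 8).
    { replace (F t / 8) with (2 * A * m * (F t / (16 * A * m))) by (field; lra).
      apply Rmult_le_compat_l; [|exact e4]. apply Rmult_le_pos; lra. }
    assert (2 * A * m * gaussint (A / 2) e <= 2 * A * m * e).
    { apply Rmult_le_compat_l; [apply Rmult_le_pos; lra|lra]. }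
    assert (0 <= m * (2 * (1 - exp (- (A / 2 * e ^ 2))) / e)) by (apply Rmult_le_pos; lra).
    lra. }
  assert (M := Mono e ltac:(lra)). unfold F at 2 in M. unfold hcorr in M. lra.
Qed.

Lemma yq_sqrt60 : yq (sqrt 60) = sqrt 60 / 2.
Proof.
  assert (B := sqrt60_bounds). unfold yq, wid.
  replace (sqrt (36 + 2 / 5 * sqrt 60 ^ 2)) with (sqrt 60).
  - field. lra.
  - f_equal. rewrite pow2_sqrt; lra.
Qed.

Lemma saddle_at_sqrt60 (H D dD : R -> R) (m A B : R) :
  saddle H D dD m A -> (forall y, y <= 0 -> H y <= B) ->
  hcorr H D (sqrt 60 / (2 * m)) - m * gtail A (sqrt 60) <= B.
Proof.
  intros S HB. assert (Pm := saddle_m _ _ _ _ _ S). assert (B60 := sqrt60_bounds).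
  replace (sqrt 60 / (2 * m)) with (yq (sqrt 60) / m) by (rewrite yq_sqrt60; field; lra).
  assert (W : 0 < wid (sqrt 60) + sqrt 60) by (assert (H6 := wid_ge6 (sqrt 60)); lra).
  destruct (Rle_or_lt (hcorr H D (yq (sqrt 60) / m) - m * gtail A (sqrt 60)) B) as [|N];
    [assumption|exfalso].
  destruct (continuous_gt0_nbhd (fun t => hcorr H D (yq t / m) - m * gtail A t - B) (sqrt 60))
    as (e & He & K).
  - destruct (saddle_curve_deriv _ _ _ _ _ (sqrt 60) S W ltac:(lra)
      (curve_weight_ge0 (sqrt 60) W ltac:(lra))) as (d & D1 & _).
    assert (D2 := is_derive_gtail A (sqrt 60) ltac:(lra)).
    apply (continuous_minus (fun t => hcorr H D (yq t / m) - m * gtail A t) (fun _ => B));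
      [|apply continuous_const].
    apply (continuous_minus (fun t => hcorr H D (yq t / m)) (fun t => m * gtail A t)).
    + apply (is_derive_continuous _ _ _ D1).
    + apply continuous_Rmult; [apply continuous_const|apply (is_derive_continuous _ _ _ D2)].
  - lra.
  (* At [sqrt 60] itself the negative branch divides by 0. Just below, it is a point [y < 0], where
     [H y <= B] and the correction in [hcorr] is not positive. *)
  - set (t := sqrt 60 - Rmin e 1 / 2).
    assert (P : 0 < Rmin e 1) by (apply Rmin_glb_lt; lra).
    assert (M1 : Rmin e 1 <= e) by apply Rmin_l. assert (M2 : Rmin e 1 <= 1) by apply Rmin_r.
    assert (Ht : 0 < t < sqrt 60) by (unfold t; lra).
    assert (K1 := K t). cbv beta in K1.
    assert (K2 : Rabs (t - sqrt 60) < e).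
    { rewrite Rabs_left; unfold t; lra. }
    specialize (K1 K2). assert (In := saddle_inner _ _ _ _ _ _ S Ht).
    assert (Wt : 0 < wid (- t) + - t) by (apply wid_lt_sqrt60; lra).
    destruct (yq_sign (- t) Wt) as [Sy Ny]. specialize (Ny ltac:(lra)).
    assert (Ly : yq (- t) < 0) by nra.
    assert (Im := Rinv_0_lt_compat m Pm).
    assert (Lym : yq (- t) / m < 0) by (unfold Rdiv; nra).
    assert (Hy := HB _ (Rlt_le _ _ Lym)). unfold hcorr at 2 in In.
    assert (PD := saddle_D_ge0 _ _ _ _ _ (yq (- t) / m) S).
    assert (Ex := exp_neg_le1 _ PD).
    assert (Cn : 0 <= (1 - exp (- D (yq (- t) / m))) / - (yq (- t) / m))
      by (apply Rdiv_le_0_compat; lra).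
    replace ((1 - exp (- D (yq (- t) / m))) / - (yq (- t) / m))
      with (- ((1 - exp (- D (yq (- t) / m))) / (yq (- t) / m))) in Cn by (field; lra).
    lra.
Qed.

(* Beyond [sqrt 60] the negative branch has been exhausted, and [y = t / 2] replaces [yq t]
   on the positive one; the strict inequality here makes the final bound strict. *)
Lemma saddle_outer (H D dD : R -> R) (m A s t : R) :
  saddle H D dD m A -> sqrt 60 <= s -> s < t ->
  hcorr H D (t / (2 * m)) - m * gtail A t < hcorr H D (s / (2 * m)) - m * gtail A s.
Proof.
  intros S Hs Hst. assert (Pm := saddle_m _ _ _ _ _ S). assert (B60 := sqrt60_bounds).
  assert (PA := saddle_A _ _ _ _ _ S).
  assert (Dv : forall x, s <= x -> exists d,
    is_derive (fun t => hcorr H D (t / (2 * m)) - m * gtail A t) x d /\ d < 0).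
  { intros x Hx.
    assert (Px : 0 < x / (2 * m)) by (apply Rdiv_lt_0_compat; lra).
    destruct (saddle_hcorr _ _ _ _ _ (x / (2 * m)) S ltac:(lra)) as (d & Dd & Hd).
    assert (D2 := is_derive_gtail A x ltac:(lra)).
    exists (d / (2 * m) - m * - (2 * (1 - exp (- (A / 2 * x ^ 2))) / x ^ 2)). split.
    - apply (is_derive_minus (K := R_AbsRing) (V := R_NormedModule));
        [|now apply (is_derive_scal (gtail A))].
      auto_derive; [eexists; exact Dd|]. change (x * / (2 * m)) with (x / (2 * m)). rewD Dd.
      eqR. field. lra.
    - assert (Hh := half_exp_gt x ltac:(lra)).
      assert (G := saddle_D_ge _ _ _ _ _ S (x / (2 * m))).
      replace (m * (x / (2 * m))) with (x / 2) in G by (field; lra).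
      assert (G2 : A * (x ^ 2 / 2) < D (x / (2 * m))).
      { apply Rlt_le_trans with (2 := G). apply Rmult_lt_compat_l; lra. }
      assert (Ex : exp (- D (x / (2 * m))) < exp (- (A / 2 * x ^ 2))) by (apply exp_increasing; lra).
      assert (P2 : 0 < x ^ 2) by (apply pow2_gt_0; lra).
      apply Rle_lt_trans with (- ((1 - exp (- D (x / (2 * m)))) / (x / (2 * m)) ^ 2) / (2 * m)
        - m * - (2 * (1 - exp (- (A / 2 * x ^ 2))) / x ^ 2)).
      + apply Rplus_le_compat_r. apply Rmult_le_compat_r; [|exact Hd].
        left. apply Rinv_0_lt_compat. lra.
      + replace (- ((1 - exp (- D (x / (2 * m)))) / (x / (2 * m)) ^ 2) / (2 * m)
          - m * - (2 * (1 - exp (- (A / 2 * x ^ 2))) / x ^ 2))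
          with ((2 * m / x ^ 2) * (exp (- D (x / (2 * m))) - exp (- (A / 2 * x ^ 2)))) by (field; lra).
        assert (0 < 2 * m / x ^ 2) by (apply Rdiv_lt_0_compat; lra). nra. }
  apply (derive_lt0_gt (fun t => hcorr H D (t / (2 * m)) - m * gtail A t)); [exact Hst| |].
  - intros x Hx. destruct (Dv x ltac:(lra)) as (d & Dx & _). apply (is_derive_continuous _ _ _ Dx).
  - intros x Hx. apply Dv. lra.
Qed.

Lemma saddle_bound (H D dD : R -> R) (m A B : R) :
  saddle H D dD m A -> (forall y, 0 <= H y) -> (forall y, y <= 0 -> H y <= B) ->
  m * sqrt (2 * PI * A) < B.
Proof.
  intros S HP HB. assert (Pm := saddle_m _ _ _ _ _ S). assert (B60 := sqrt60_bounds).
  assert (PA := saddle_A _ _ _ _ _ S).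
  assert (L0 := saddle_at_sqrt60 _ _ _ _ _ _ S HB).
  (* One unit beyond [sqrt 60] secures [v < B] strictly before [t] goes to infinity. There [H >= 0]
     and the correction in [hcorr] dominates the first term of [gtail], which leaves
     [2 A m * gaussint (A / 2) t <= v]. *)
  assert (L1 := saddle_outer _ _ _ _ _ (sqrt 60) (sqrt 60 + 1) S ltac:(lra) ltac:(lra)).
  set (v := hcorr H D ((sqrt 60 + 1) / (2 * m)) - m * gtail A (sqrt 60 + 1)) in *.
  assert (Hv : forall t, sqrt 60 + 2 <= t -> gaussint (A / 2) t <= v / (2 * A * m)).
  { intros t Ht.
    assert (L2 := saddle_outer _ _ _ _ _ (sqrt 60 + 1) t S ltac:(lra) ltac:(lra)). fold v in L2.
    assert (Px : 0 < t / (2 * m)) by (apply Rdiv_lt_0_compat; lra).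
    assert (Hh := half_exp_gt t ltac:(lra)).
    assert (Lv := saddle_level _ _ _ _ _ (t / (2 * m)) t S).
    replace (m * (t / (2 * m))) with (t / 2) in Lv by (field; lra). specialize (Lv (Rlt_le _ _ Hh)).
    assert (HPt := HP (t / (2 * m))). unfold hcorr, gtail in L2.
    set (e1 := 1 - exp (- D (t / (2 * m)))) in *. set (e2 := 1 - exp (- (A / 2 * t ^ 2))) in *.
    replace (e1 / (t / (2 * m))) with (2 * m / t * e1) in L2 by (field; lra).
    replace (m * (2 * e2 / t - 2 * A * gaussint (A / 2) t))
      with (2 * m / t * e2 - 2 * A * m * gaussint (A / 2) t) in L2 by (field; lra).
    assert (P : 0 < 2 * m / t) by (apply Rdiv_lt_0_compat; lra).
    assert (2 * m / t * e2 <= 2 * m / t * e1) by (apply Rmult_le_compat_l; lra).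
    apply Rle_div_r; [nra|]. lra. }
  apply gaussint_lim in Hv; [|lra].
  apply Rle_lt_trans with v; [|lra].
  assert (P0 : 0 < 2 * A * m) by nra.
  apply (Rle_div_r _ _ _ P0) in Hv. apply Rle_trans with (2 := Hv). right.
  assert (E : 2 * PI * A = (2 * A) ^ 2 * (PI / (4 * (A / 2)))) by (field; lra).
  rewrite E, sqrt_mult_alt by (apply pow2_ge_0). rewrite sqrt_pow2 by lra. ring.
Qed.

(** [expmom1_ge] integrated twice from 0: the difference of the two sides vanishes there together
    with its first derivative. *)
Lemma saddle_log_convex (z y : R) :
  let m := expmom 2 z / expmom 1 z in
  expmom 1 z / m ^ 2 * (exp (m * y) - 1 - m * y) <= I (z + y) - I z - expmom 0 z * y.
Proof.
  intros m. assert (P1 := expmom_gt0 1 z). assert (P2 := expmom_gt0 2 z).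
  assert (Pm : 0 < m) by (apply Rdiv_lt_0_compat; assumption).
  set (s := expmom 1 z) in *.
  set (F1 := fun y => expmom 0 (z + y) - expmom 0 z - s / m * (exp (m * y) - 1)).
  assert (D1 : forall y, is_derive F1 y (expmom 1 (z + y) - s * exp (m * y))).
  { intros x. assert (D := is_derive_expmom 0 (z + x)). unfold F1. auto_derive; [eexists; exact D|].
    rewD D. field. lra. }
  assert (F10 : F1 0 = 0) by (unfold F1; rewrite Rmult_0_r, exp_0, Rplus_0_r; ring).
  assert (M1 : forall a b, a <= b -> F1 a <= F1 b).
  { intros a b Hab. apply derive_ge0_le; [exact Hab| |].
    - intros x _. apply (is_derive_continuous _ _ _ (D1 x)).
    - intros x _. eexists. split; [apply D1|]. assert (H := expmom1_ge z x). fold s m in H. lra. }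
  set (F := fun y => I (z + y) - I z - expmom 0 z * y - s / m ^ 2 * (exp (m * y) - 1 - m * y)).
  assert (D0 : forall y, is_derive F y (F1 y)).
  { intros x. assert (D := is_derive_I (z + x)). unfold F, F1. auto_derive; [eexists; exact D|].
    rewD D. field. lra. }
  assert (F0 : F 0 = 0) by (unfold F; rewrite !Rmult_0_r, exp_0, Rplus_0_r; ring).
  assert (Fp : 0 <= F y); [|unfold F in Fp; lra].
  rewrite <- F0. destruct (Rle_or_lt 0 y) as [L|L].
  - apply derive_ge0_le; [exact L| |].
    + intros x _. apply (is_derive_continuous _ _ _ (D0 x)).
    + intros x Hx. eexists. split; [apply D0|]. rewrite <- F10. apply M1. lra.
  - apply derive_le0_ge; [lra| |].
    + intros x _. apply (is_derive_continuous _ _ _ (D0 x)).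
    + intros x Hx. eexists. split; [apply D0|]. rewrite <- F10. apply M1. lra.
Qed.

Lemma dickman_saddle (r : R -> R) (u xi : R) :
  dickman_ext r -> 1 <= u -> expmom 0 xi = u ->
  r u < exp (euler_gamma - u * xi + I xi) / sqrt (2 * PI * expmom 1 xi).
Proof.
  intros Hr Hu Hxi. assert (P1 := expmom_gt0 1 xi). assert (P2 := expmom_gt0 2 xi).
  set (m := expmom 2 xi / expmom 1 xi).
  assert (Pm : 0 < m) by (apply Rdiv_lt_0_compat; assumption).
  assert (Pr := dickman_gt0 r u Hr).
  set (M := exp (xi * u - I xi)). assert (PM : 0 < M) by apply exp_pos.
  set (c := r u * M). assert (Pc : 0 < c) by (apply Rmult_lt_0_compat; assumption).
  set (H := fun y => theta r u (xi + y) / c).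
  set (D := fun y => I (xi + y) - I xi - expmom 0 xi * y).
  set (dD := fun y => expmom 0 (xi + y) - u).
  assert (S : saddle H D dD m (expmom 1 xi / m ^ 2)).
  { constructor.
    - exact Pm.
    - apply Rdiv_lt_0_compat; [exact P1|apply pow_lt; exact Pm].
    - intros y. assert (DI := is_derive_I (xi + y)). unfold D, dD. auto_derive; [eexists; exact DI|].
      rewD DI. rewrite Hxi. ring.
    - unfold D. rewrite Rplus_0_r. ring.
    - unfold dD. rewrite Rplus_0_r, Hxi. ring.
    - intros y. unfold dD. rewrite <- Hxi. destruct (Rtotal_order y 0) as [L|[->|L]].
      + assert (K := expmom_lt 0 (xi + y) xi ltac:(lra)). nra.
      + lra.
      + assert (K := expmom_lt 0 xi (xi + y) ltac:(lra)). nra.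
    - intros y. apply saddle_log_convex.
    - intros y. unfold H. apply (continuous_Rmult (fun y => theta r u (xi + y)) (fun _ => / c)).
      + apply (continuous_comp (fun y => xi + y) (theta r u)).
        * apply (ex_derive_continuous (fun y => xi + y)). auto_derive. trivial.
        * now apply continuous_theta.
      + apply continuous_const.
    - intros y Hy. assert (DT := is_derive_theta r u (xi + y) Hr).
      exists (- ((expmom 0 (xi + y) * lapl r u (xi + y) - lapl1 r u (xi + y)) * exp (- I (xi + y))) / c).
      split.
      + unfold H. auto_derive; [eexists; exact DT|]. rewD DT. field. lra.
      + assert (L := lapl_ineq r u xi (xi + y) Hr Hu Hxi ltac:(lra)).
        replace (xi + y - xi) with y in L by ring. fold (dD y) in L.
        set (W := expmom 0 (xi + y) * lapl r u (xi + y) - lapl1 r u (xi + y)) in *.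
        (* [exp (u z - I z)] at [z = xi + y], referred to its value at the saddle. *)
        assert (E : exp ((xi + y) * u) * exp (- I (xi + y)) = M * exp (- D y)).
        { unfold M, D. rewrite <- !exp_plus. f_equal. rewrite Hxi. ring. }
        assert (PI' := exp_pos (- I (xi + y))).
        apply (Rmult_le_compat_r (exp (- I (xi + y)))) in L; [|lra].
        replace (r u * exp ((xi + y) * u) * (dD y / y) * exp (- I (xi + y)))
          with (c * (dD y * exp (- D y) / y)) in L.
        2:{ transitivity (r u * (dD y / y) * (exp ((xi + y) * u) * exp (- I (xi + y)))); [|ring].
            rewrite E. unfold c. field. exact Hy. }
        apply Rle_div_l; [exact Pc|]. lra. }
  assert (B := saddle_bound H D dD m (expmom 1 xi / m ^ 2) (exp euler_gamma / c) S).
  assert (HB : m * sqrt (2 * PI * (expmom 1 xi / m ^ 2)) < exp euler_gamma / c).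
  { apply B.
    - intros y. apply Rdiv_le_0_compat; [|exact Pc]. apply theta_ge0; [exact Hr|lra].
    - intros y Hy. unfold H. apply Rmult_le_compat_r; [left; now apply Rinv_0_lt_compat|].
      assert (T := theta_le_euler r u xi (xi + y) Hr Hu Hxi ltac:(lra)).
      apply (Rmult_le_compat_r (exp euler_gamma)) in T; [|left; apply exp_pos].
      rewrite Rmult_assoc, <- exp_plus, Rplus_opp_l, exp_0 in T. lra. }
  (* The scale [m] of the exponential comparison drops out, leaving [I''(xi)] alone. *)
  assert (E : m * sqrt (2 * PI * (expmom 1 xi / m ^ 2)) = sqrt (2 * PI * expmom 1 xi)).
  { rewrite <- (sqrt_pow2 m) at 1 by lra. rewrite <- sqrt_mult_alt by apply pow2_ge_0.
    f_equal. field. lra. }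
  rewrite E in HB.
  assert (Ps : 0 < sqrt (2 * PI * expmom 1 xi)).
  { apply sqrt_lt_R0. assert (Pp := PI_RGT_0). nra. }
  apply Rlt_div_r; [exact Ps|]. apply (Rlt_div_r _ _ _ Pc) in HB.
  replace (euler_gamma - u * xi + I xi) with (euler_gamma + - (xi * u - I xi)) by ring.
  rewrite exp_plus, exp_Ropp. fold M. apply (Rlt_div_r _ _ _ PM).
  unfold c in HB. lra.
Qed.

(** * Buchstab's function *)

Definition buchstab_ext (w : R -> R) : Prop :=
  (forall x, continuous w x)
  /\ (forall x, x <= 1 -> w x = 1)
  /\ (forall x, 1 <= x <= 2 -> w x = 1 / x)
  /\ (forall x, 2 < x -> is_derive (fun v => v * w v) x (w (x - 1))).

Lemma is_derive_buchstab_12 (w : R -> R) (u : R) :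
  buchstab_ext w -> 1 < u < 2 -> is_derive w u (- (1 / u ^ 2)).
Proof.
  intros Hw Hu. apply (is_derive_ext_loc (fun v => 1 / v)).
  - assert (L1 : locally u (fun s => s < 2)) by (apply open_lt; lra).
    assert (L2 : locally u (fun s => 1 < s)) by (apply open_gt; lra).
    generalize (filter_and _ _ L1 L2). apply filter_imp. intros s Hs.
    symmetry. apply (proj1 (proj2 (proj2 Hw))). lra.
  - auto_derive; [lra|]. field. lra.
Qed.

Lemma is_derive_buchstab (w : R -> R) (u : R) :
  buchstab_ext w -> 2 < u -> is_derive w u ((w (u - 1) - w u) / u).
Proof.
  intros Hw Hu. apply (is_derive_ext_loc (fun v => (v * w v) * / v)).
  - assert (L : locally u (fun s => 2 < s)) by (apply open_gt; lra).
    revert L. apply filter_imp. intros s Hs. eqR. field. lra.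
  - assert (D := proj2 (proj2 (proj2 Hw)) u Hu).
    apply (is_derive_eq _ _ (w (u - 1) * / u + (u * w u) * (- / u ^ 2))); [|field; lra].
    apply (is_derive_Rmult (fun v => v * w v)); [exact D|].
    auto_derive; [lra|]. field. lra.
Qed.

Lemma buchstab_gt0 (w : R -> R) (u : R) : buchstab_ext w -> 1 <= u -> 0 < w u.
Proof.
  intros Hw.
  assert (H2 : forall x, 1 <= x <= 2 -> 0 < w x).
  { intros x Hx. rewrite (proj1 (proj2 (proj2 Hw)) x Hx). apply Rdiv_lt_0_compat; lra. }
  apply (real_induction_gt0 w 1).
  - intros x _. apply Hw.
  - apply H2. lra.
  - intros v Hv Hp. destruct (Rle_or_lt v 2) as [L|L]; [apply H2; lra|].
    assert (E : 2 * w 2 <= v * w v).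
    { apply (derive_ge0_le (fun v => v * w v)); [lra| |].
      - intros x _. apply continuous_Rmult; [apply continuous_id|apply Hw].
      - intros x Hx. exists (w (x - 1)). split; [apply Hw; lra|]. left. apply Hp. lra. }
    assert (P := H2 2 ltac:(lra)). nra.
Qed.

Lemma buchstab_le1 (w : R -> R) (u : R) : buchstab_ext w -> 1 <= u -> w u <= 1.
Proof.
  intros Hw Hu.
  assert (H2 : forall x, 1 <= x <= 2 -> w x <= 1).
  { intros x Hx. rewrite (proj1 (proj2 (proj2 Hw)) x Hx). apply Rle_div_l; lra. }
  destruct (Rle_or_lt u 2) as [L|L]; [apply H2; lra|].
  assert (E2 : w 2 = 1 / 2) by (apply (proj1 (proj2 (proj2 Hw))); lra).
  assert (0 < 1 - w u); [|lra]. apply (real_induction_gt0 (fun x => 1 - w x) 2); [| | |lra].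
  - intros x _. apply (continuous_minus (fun _ => 1) w); [apply continuous_const|apply Hw].
  - lra.
  - intros v Hv Hp.
    assert (E : 2 - 2 * w 2 <= v - v * w v).
    { apply (derive_ge0_le (fun v => v - v * w v)); [lra| |].
      - intros x _. apply (continuous_minus (fun v => v) (fun v => v * w v)); [apply continuous_id|].
        apply continuous_Rmult; [apply continuous_id|apply Hw].
      - intros x Hx. exists (1 - w (x - 1)). split.
        + apply (is_derive_minus (K := R_AbsRing) (V := R_NormedModule)).
          * apply (is_derive_id (K := R_AbsRing)).
          * apply Hw. lra.
        + destruct (Rle_or_lt (x - 1) 2) as [L'|L'].
          * assert (w (x - 1) <= 1) by (apply H2; lra). lra.
          * assert (0 < 1 - w (x - 1)) by (apply Hp; lra). lra. }
    nra.
Qed.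

(** * The bound on the derivative of Buchstab's function *)

Lemma ln_le_half (u : R) : 1 <= u -> ln u <= (u - / u) / 2.
Proof.
  intros Hu. assert (H : (1 - / 1) / 2 - ln 1 <= (u - / u) / 2 - ln u).
  { apply (derive_ge0_le (fun u => (u - / u) / 2 - ln u)); [exact Hu| |].
    - intros x Hx. apply (ex_derive_continuous (fun u => (u - / u) / 2 - ln u)).
      auto_derive. lra.
    - intros x Hx. exists ((1 - / x) ^ 2 / 2). split.
      + auto_derive; [lra|]. field. lra.
      + assert (0 <= (1 - / x) ^ 2) by apply pow2_ge_0. lra. }
  rewrite ln_1, Rinv_1 in H. lra.
Qed.

Lemma dickman_12 (r : R -> R) (u : R) : dickman_ext r -> 1 <= u <= 2 -> r u = 1 - ln u.
Proof.
  intros Hr Hu. assert (H : r u + ln u = r 1 + ln 1).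
  { apply (derive_eq0_eq (fun u => r u + ln u)); [lra| |].
    - intros x Hx. apply continuous_Rplus; [apply Hr|].
      apply (ex_derive_continuous ln). exists (/ x). apply is_derive_ln. lra.
    - intros x Hx. assert (D := proj2 (proj2 Hr) x ltac:(lra)).
      rewrite (proj1 (proj2 Hr) (x - 1)) in D by lra.
      apply (is_derive_eq _ _ (- (1 / x) + / x)); [|field; lra].
      apply (is_derive_plus (K := R_AbsRing) (V := R_NormedModule)); [exact D|].
      apply is_derive_ln. lra. }
  rewrite ln_1, (proj1 (proj2 Hr) 1) in H by lra. lra.
Qed.

(** On [[1, 2]] the left side is [|omega'|] and [r u = 1 - ln u]. The bound used for [ln] leaves
    [(u^2 - 1) (2 - u) / (2 u^2)], zero at both ends. *)
Lemma dickman_ge_invsq (r : R -> R) (u : R) :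
  dickman_ext r -> 1 <= u <= 2 -> 1 / u ^ 2 <= r u.
Proof.
  intros Hr Hu. rewrite (dickman_12 r u Hr Hu). assert (L := ln_le_half u ltac:(lra)).
  assert (E : (u - / u) / 2 <= 1 - 1 / u ^ 2); [|lra].
  apply Rminus_le_0. replace (1 - 1 / u ^ 2 - (u - / u) / 2)
    with ((u ^ 2 - 1) * (2 - u) / (2 * u ^ 2)) by (field; lra).
  apply Rdiv_le_0_compat; [apply Rmult_le_pos; nra|nra].
Qed.

Lemma dickman_2_gt (r : R -> R) : dickman_ext r -> 1 / 4 < r 2.
Proof.
  intros Hr. rewrite (dickman_12 r 2 Hr) by lra.
  assert (H : ln 2 < 3 / 4); [|lra].
  (* At 2 itself [ln_le_half] gives exactly 3/4, without strictness; on the two factors it gives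
     7/24 + 5/12 = 17/24. *)
  assert (E : 2 = (4 / 3) * (3 / 2)) by field. rewrite E, ln_mult by lra.
  assert (A := ln_le_half (4 / 3) ltac:(lra)). assert (B := ln_le_half (3 / 2) ltac:(lra)). lra.
Qed.

(** The primitive of [r] plus or minus [w] is increasing, piecewise on both sides of the kink at 2.
    The slope bound is asked only before [b], so that the induction of [buchstab_slope_lt] can
    supply it. *)
Lemma buchstab_abs_incr (w r : R -> R) (a b : R) :
  buchstab_ext w -> dickman_ext r -> 1 <= a -> a <= b ->
  (forall x, 2 < x < b -> Rabs ((w (x - 1) - w x) / x) <= r x) ->
  Rabs (w b - w a) <= RInt r 0 b - RInt r 0 a.
Proof.
  intros Hw Hr Ha Hab Hx.
  assert (K : forall e, (e = 1 \/ e = -1) -> forall a b, 1 <= a -> a <= b -> b <= 2 \/ 2 <= a ->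
     (forall x, 2 < x < b -> Rabs ((w (x - 1) - w x) / x) <= r x) ->
     RInt r 0 a + e * w a <= RInt r 0 b + e * w b).
  { clear a b Ha Hab Hx. intros e He a b Ha Hab Hs Hx.
    apply (derive_ge0_le (fun x => RInt r 0 x + e * w x)); [exact Hab| |].
    - intros x _. apply continuous_Rplus; [now apply continuous_primitive|].
      apply continuous_Rmult; [apply continuous_const|apply Hw].
    - intros x Hxab.
      assert (G : exists d, is_derive w x d /\ Rabs d <= r x).
      { destruct Hs as [Hs|Hs].
        - exists (- (1 / x ^ 2)). split; [apply is_derive_buchstab_12; [exact Hw|lra]|].
          rewrite Rabs_Ropp, Rabs_pos_eq.
          + apply dickman_ge_invsq; [exact Hr|lra].
          + apply Rdiv_le_0_compat; nra.
        - exists ((w (x - 1) - w x) / x). split; [apply is_derive_buchstab; [exact Hw|lra]|].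
          apply Hx. lra. }
      destruct G as (d & D & B). exists (r x + e * d). split.
      + apply (is_derive_plus (K := R_AbsRing) (V := R_NormedModule)).
        * now apply is_derive_primitive.
        * now apply (is_derive_scal w).
      + apply Rabs_le_between in B. destruct He as [-> | ->]; lra. }
  assert (K2 : forall e, (e = 1 \/ e = -1) -> RInt r 0 a + e * w a <= RInt r 0 b + e * w b).
  { intros e He. destruct (Rle_or_lt b 2) as [L|L]; [apply K; auto|].
    destruct (Rle_or_lt 2 a) as [L'|L']; [apply K; auto|].
    apply Rle_trans with (RInt r 0 2 + e * w 2).
    - apply K; auto; try lra. intros x Hx'. lra.
    - apply K; auto; lra. }
  assert (K3 := K2 1 ltac:(auto)). assert (K4 := K2 (-1) ltac:(auto)).
  apply Rabs_le. lra.
Qed.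

(** Continuous induction: [|w (u - 1) - w u|] is less than the integral of [r] over the window,
    which equals [u * r u]. *)
Lemma buchstab_slope_lt (w r : R -> R) (u : R) :
  buchstab_ext w -> dickman_ext r -> 2 <= u -> Rabs ((w (u - 1) - w u) / u) < r u.
Proof.
  intros Hw Hr Hu.
  assert (P : 0 < r u - Rabs ((w (u - 1) - w u) / u)); [|lra].
  apply (real_induction_gt0 (fun u => r u - Rabs ((w (u - 1) - w u) / u)) 2); [| | |exact Hu].
  - intros x Hx. apply (continuous_minus r (fun u => Rabs ((w (u - 1) - w u) / u))); [apply Hr|].
    apply (continuous_comp (fun u => (w (u - 1) - w u) / u) Rabs).
    + apply (continuous_Rmult (fun u => w (u - 1) - w u) Rinv).
      * apply (continuous_minus (fun u => w (u - 1)) w); [|apply Hw]. apply continuous_shift, Hw.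
      * apply (ex_derive_continuous Rinv). auto_derive. lra.
    + apply continuous_Rabs.
  - assert (E1 : w (2 - 1) = 1) by (apply Hw; lra).
    assert (E2 : w 2 = 1 / 2) by (apply (proj1 (proj2 (proj2 Hw))); lra).
    rewrite E1, E2. assert (H := dickman_2_gt r Hr). rewrite Rabs_pos_eq; lra.
  - intros v Hv Hp.
    (* Strict slope bounds are known only beyond 2, and the window may start earlier; it is cut at a
       point past 2, with a weak estimate before and a strict one after. *)
    set (c := (Rmax (v - 1) 2 + v) / 2).
    assert (M1 : v - 1 <= Rmax (v - 1) 2) by apply Rmax_l.
    assert (M2 : 2 <= Rmax (v - 1) 2) by apply Rmax_r.
    assert (M3 : Rmax (v - 1) 2 < v) by (apply Rmax_lub_lt; lra).
    assert (A1 : Rabs (w c - w (v - 1)) <= RInt r 0 c - RInt r 0 (v - 1)).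
    { apply buchstab_abs_incr; auto; unfold c; try lra.
      intros x Hx. assert (H := Hp x ltac:(lra)). lra. }
    assert (A2 : forall e, (e = 1 \/ e = -1) -> RInt r 0 c + e * w c < RInt r 0 v + e * w v).
    { intros e He. apply (derive_gt0_lt (fun x => RInt r 0 x + e * w x)); [unfold c; lra| |].
      - intros x _. apply continuous_Rplus; [now apply continuous_primitive|].
        apply continuous_Rmult; [apply continuous_const|apply Hw].
      - intros x Hx. unfold c in Hx. exists (r x + e * ((w (x - 1) - w x) / x)). split.
        + apply (is_derive_plus (K := R_AbsRing) (V := R_NormedModule)).
          * now apply is_derive_primitive.
          * apply (is_derive_scal w), is_derive_buchstab; [exact Hw|lra].
        + assert (H : Rabs ((w (x - 1) - w x) / x) < r x) by (assert (H := Hp x ltac:(lra)); lra).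
          apply Rabs_def2 in H. destruct He as [-> | ->]; lra. }
    assert (A3 := A2 1 ltac:(auto)). assert (A4 := A2 (-1) ltac:(auto)).
    apply Rabs_le_between in A1. assert (E := dickman_integral r v Hr ltac:(lra)).
    assert (H : Rabs ((w (v - 1) - w v) / v) < r v); [|lra].
    unfold Rdiv. rewrite Rabs_mult, (Rabs_pos_eq (/ v)) by (left; apply Rinv_0_lt_compat; lra).
    apply (Rlt_div_l _ _ v); [lra|]. apply Rabs_def1; lra.
Qed.

Lemma buchstab_abs_le (w r : R -> R) (a b : R) :
  buchstab_ext w -> dickman_ext r -> 1 <= a -> a <= b ->
  Rabs (w b - w a) <= RInt r 0 b - RInt r 0 a.
Proof.
  intros Hw Hr Ha Hab. apply buchstab_abs_incr; auto.
  intros x Hx. left. apply buchstab_slope_lt; auto. lra.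
Qed.

Lemma primitive_le (r : R -> R) (a b : R) :
  dickman_ext r -> a <= b -> RInt r 0 b - RInt r 0 a <= r a * (b - a).
Proof.
  intros Hr Hab. assert (H : RInt r 0 b - r a * b <= RInt r 0 a - r a * a); [|lra].
  apply (derive_le0_ge (fun x => RInt r 0 x - r a * x)); [exact Hab| |].
  - intros x _. apply (continuous_minus (fun x => RInt r 0 x) (fun x => r a * x)).
    + now apply continuous_primitive.
    + apply continuous_Rmult; [apply continuous_const|apply continuous_id].
  - intros x Hx. exists (r x - r a). split.
    + assert (D := is_derive_primitive r x Hr).
      apply (is_derive_minus (K := R_AbsRing) (V := R_NormedModule)); [exact D|].
      auto_derive; [trivial|ring].
    + assert (H := dickman_le r a x Hr ltac:(lra)). lra.
Qed.

(** The derivative is [r t - r (t - 1) / t], negative because [t * r t] is the integral of the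
    decreasing [r] over a window of length 1. *)
Lemma dickman_tail_lt (r : R -> R) (x y : R) :
  dickman_ext r -> 1 <= x -> x < y -> r y + RInt r 0 y < r x + RInt r 0 x.
Proof.
  intros Hr Hx Hxy. apply (derive_lt0_gt (fun x => r x + RInt r 0 x)); [exact Hxy| |].
  - intros t _. apply continuous_Rplus; [apply Hr|now apply continuous_primitive].
  - intros t Ht. exists (- (r (t - 1) / t) + r t). split.
    + apply (is_derive_plus (K := R_AbsRing) (V := R_NormedModule)).
      * apply Hr. lra.
      * now apply is_derive_primitive.
    + assert (E := dickman_integral r t Hr ltac:(lra)).
      (* Since [r] is constant up to 1, strictness must come from the part of the window beyond 1,
         where [c] is taken. *)
      set (c := (Rmax (t - 1) 1 + t) / 2).
      assert (M1 : t - 1 <= Rmax (t - 1) 1) by apply Rmax_l.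
      assert (M2 : 1 <= Rmax (t - 1) 1) by apply Rmax_r.
      assert (M3 : Rmax (t - 1) 1 < t) by (apply Rmax_lub_lt; lra).
      assert (A1 := primitive_le r (t - 1) c Hr ltac:(unfold c; lra)).
      assert (A2 := primitive_le r c t Hr ltac:(unfold c; lra)).
      assert (A3 : r c < r (t - 1)).
      { apply Rlt_le_trans with (r (Rmax (t - 1) 1)).
        - apply dickman_lt; auto. unfold c. lra.
        - now apply dickman_le. }
      assert (Lc : c < t) by (unfold c; lra).
      assert (A4 : t * r t < r (t - 1)) by nra.
      assert (r t < r (t - 1) / t); [|lra]. apply Rlt_div_r; lra.
Qed.

(** * The limit of Buchstab's function via its truncated Laplace transform *)

Definition blapl (w : R -> R) (U z : R) : R := Lap w (fun x => x) 1 U z.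
Definition blapl1 (w : R -> R) (U z : R) : R := Lap (fun x => x * w x) (fun x => x) 1 U z.

Lemma is_derive_blapl (w : R -> R) (U z : R) :
  buchstab_ext w -> is_derive (blapl w U) z (blapl1 w U z).
Proof. intros Hw. apply (is_derive_Lap w (fun x => x)); [apply Hw|intros x; apply continuous_id]. Qed.

Lemma is_derive_blapl_bound (w : R -> R) (U z : R) :
  buchstab_ext w -> is_derive (fun U => blapl w U z) U (w U * exp (z * U)).
Proof.
  intros Hw. apply (is_derive_Lap_bound w (fun x => x)); [apply Hw|intros x; apply continuous_id].
Qed.

Lemma is_derive_blapl1_bound (w : R -> R) (U z : R) :
  buchstab_ext w -> is_derive (fun U => blapl1 w U z) U (U * w U * exp (z * U)).
Proof.
  intros Hw. apply (is_derive_Lap_bound (fun x => x * w x) (fun x => x)).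
  - intros x. apply continuous_Rmult; [apply continuous_id|apply Hw].
  - intros x. apply continuous_id.
Qed.

Lemma continuous_blapl_bound (w : R -> R) (U z : R) :
  buchstab_ext w -> continuous (fun U => blapl w U z) U.
Proof. intros Hw. apply (is_derive_continuous _ _ _ (is_derive_blapl_bound w U z Hw)). Qed.

Lemma continuous_blapl1_bound (w : R -> R) (U z : R) :
  buchstab_ext w -> continuous (fun U => blapl1 w U z) U.
Proof. intros Hw. apply (is_derive_continuous _ _ _ (is_derive_blapl1_bound w U z Hw)). Qed.

Lemma blapl_1 (w : R -> R) (z : R) : blapl w 1 z = 0.
Proof. apply (RInt_point (V := R_CompleteNormedModule)). Qed.

Lemma blapl1_1 (w : R -> R) (z : R) : blapl1 w 1 z = 0.
Proof. apply (RInt_point (V := R_CompleteNormedModule)). Qed.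

(** Parts for [(x w)'], which is 0 on [(1, 2)] and [w (x - 1)] beyond. The summand 1 comes from the
    boundary value of [x * w x] at 1. *)
Lemma blapl_ode (w : R -> R) (U z : R) :
  buchstab_ext w -> 2 <= U ->
  - z * blapl1 w U z = exp z * (1 + blapl w (U - 1) z) - U * w U * exp (z * U).
Proof.
  intros Hw HU.
  assert (E1 : - z * blapl1 w 2 z + exp (z * 2) = - z * blapl1 w 1 z + exp (z * 1)).
  { apply (derive_eq0_eq (fun U => - z * blapl1 w U z + exp (z * U))); [lra| |].
    - intros x _. apply continuous_Rplus.
      + apply continuous_Rmult; [apply continuous_const|now apply continuous_blapl1_bound].
      + apply (ex_derive_continuous (fun U => exp (z * U))). auto_derive. trivial.
    - intros x Hx. apply (is_derive_eq _ _ (- z * (x * w x * exp (z * x)) + z * exp (z * x))).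
      + apply (is_derive_plus (K := R_AbsRing) (V := R_NormedModule)).
        * apply (is_derive_scal (fun U => blapl1 w U z)), is_derive_blapl1_bound, Hw.
        * auto_derive; [trivial|ring].
      + rewrite (proj1 (proj2 (proj2 Hw)) x) by lra. field. lra. }
  rewrite blapl1_1, Rmult_1_r in E1.
  assert (E2 : - z * blapl1 w U z - (exp z * (1 + blapl w (U - 1) z) - U * w U * exp (z * U))
    = - z * blapl1 w 2 z - (exp z * (1 + blapl w (2 - 1) z) - 2 * w 2 * exp (z * 2))).
  { apply (derive_eq0_eq (fun U => - z * blapl1 w U z
      - (exp z * (1 + blapl w (U - 1) z) - U * w U * exp (z * U)))); [exact HU| |].
    - intros x _. apply (continuous_minus (fun U => - z * blapl1 w U z)
        (fun U => exp z * (1 + blapl w (U - 1) z) - U * w U * exp (z * U))).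
      + apply continuous_Rmult; [apply continuous_const|now apply continuous_blapl1_bound].
      + apply (continuous_minus (fun U => exp z * (1 + blapl w (U - 1) z)) (fun U => U * w U * exp (z * U))).
        * apply continuous_Rmult; [apply continuous_const|].
          apply continuous_Rplus; [apply continuous_const|].
          apply (continuous_shift (fun U => blapl w U z)). now apply continuous_blapl_bound.
        * apply continuous_Rmult.
          -- apply continuous_Rmult; [apply continuous_id|apply Hw].
          -- apply (ex_derive_continuous (fun U => exp (z * U))). auto_derive. trivial.
    - intros x Hx.
      assert (Ds := is_derive_shift (fun U => blapl w U z) 1 x _ (is_derive_blapl_bound w (x - 1) z Hw)).
      assert (Dw := proj2 (proj2 (proj2 Hw)) x ltac:(lra)).
      apply (is_derive_eq _ _ (- z * (x * w x * exp (z * x))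
        - (exp z * (0 + w (x - 1) * exp (z * (x - 1)))
            - (w (x - 1) * exp (z * x) + (x * w x) * (z * exp (z * x)))))).
      + apply (is_derive_minus (K := R_AbsRing) (V := R_NormedModule)).
        * apply (is_derive_scal (fun U => blapl1 w U z)), is_derive_blapl1_bound, Hw.
        * apply (is_derive_minus (K := R_AbsRing) (V := R_NormedModule)).
          -- apply (is_derive_scal (fun U => 1 + blapl w (U - 1) z)).
             apply (is_derive_plus (K := R_AbsRing) (V := R_NormedModule)); [|exact Ds].
             apply (is_derive_const (K := R_AbsRing) (V := R_NormedModule)).
          -- apply (is_derive_Rmult (fun U => U * w U) (fun U => exp (z * U))); [exact Dw|]. auto_derive; [trivial|ring].
      + replace (z * x) with (z * (x - 1) + z) by ring. rewrite exp_plus. ring. }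
  replace (2 - 1) with 1 in E2 by ring.
  rewrite blapl_1, (proj1 (proj2 (proj2 Hw)) 2) in E2 by lra. lra.
Qed.

Lemma blapl_window (w : R -> R) (U s : R) :
  buchstab_ext w -> 2 <= U -> 0 <= s ->
  0 <= exp (- s) * (blapl w U (- s) - blapl w (U - 1) (- s)) <= exp (- s * U).
Proof.
  intros Hw HU Hs. assert (P := exp_pos (- s)).
  assert (L : blapl w (U - 1) (- s) <= blapl w U (- s)).
  { apply (derive_ge0_le (fun U => blapl w U (- s))); [lra| |].
    - intros x _. now apply continuous_blapl_bound.
    - intros x Hx. eexists. split; [now apply is_derive_blapl_bound|].
      apply Rmult_le_pos; [left; apply buchstab_gt0; [exact Hw|lra]|left; apply exp_pos]. }
  set (c := exp (- s * (U - 1))).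
  assert (R : blapl w U (- s) - c * U <= blapl w (U - 1) (- s) - c * (U - 1)).
  { apply (derive_le0_ge (fun U => blapl w U (- s) - c * U)); [lra| |].
    - intros x _. apply (continuous_minus (fun U => blapl w U (- s)) (fun U => c * U)).
      + now apply continuous_blapl_bound.
      + apply continuous_Rmult; [apply continuous_const|apply continuous_id].
    - intros x Hx. exists (w x * exp (- s * x) - c). split.
      + apply (is_derive_minus (K := R_AbsRing) (V := R_NormedModule));
          [now apply is_derive_blapl_bound|]. auto_derive; [trivial|ring].
      + assert (exp (- s * x) <= c) by (apply exp_le; nra).
        assert (W1 := buchstab_le1 w x Hw ltac:(lra)). assert (W0 := buchstab_gt0 w x Hw ltac:(lra)).
        assert (Pe := exp_pos (- s * x)). nra. }
  split; [apply Rmult_le_pos; lra|].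
  replace (- s * U) with (- s + - s * (U - 1)) by ring. rewrite exp_plus. fold c.
  apply Rmult_le_compat_l; lra.
Qed.

(* Compare [(expV * (1 + Laplace transform of w))'] with multiples of [exp (- s * U)]:
   integrating over [s >= 0] brackets [w U]. *)
Definition bprod (w : R -> R) (U s : R) : R := expV s * (1 + blapl w U (- s)).

Lemma is_derive_bprod (w : R -> R) (U s : R) :
  buchstab_ext w -> 2 <= U ->
  is_derive (bprod w U) s (exp (I (- s)) *
    (exp (- s) * (blapl w U (- s) - blapl w (U - 1) (- s)) + U * w U * exp (- s * U))).
Proof.
  intros Hw HU. assert (DV := is_derive_expV s). assert (DB := is_derive_blapl w U (- s) Hw).
  assert (O := blapl_ode w U (- s) Hw HU). unfold bprod.
  auto_derive; [repeat split; [eexists; exact DV|eexists; exact DB]|].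
  rewD DV. rewD DB.
  transitivity (exp (I (- s)) * (exp (- s) * (1 + blapl w U (- s)) - - - s * blapl1 w U (- s))).
  - unfold expV. ring.
  - rewrite O. ring.
Qed.

Lemma bprod_0 (w : R -> R) (U : R) : bprod w U 0 = 0.
Proof. unfold bprod. rewrite expV_0. ring. Qed.

Lemma blapl_bounds (w : R -> R) (U s : R) :
  buchstab_ext w -> 1 <= U -> 0 < s -> 0 <= blapl w U (- s) <= 1 / s.
Proof.
  intros Hw HU Hs. split.
  - rewrite <- (blapl_1 w (- s)). apply (derive_ge0_le (fun U => blapl w U (- s))); [exact HU| |].
    + intros x _. now apply continuous_blapl_bound.
    + intros x Hx. eexists. split; [now apply is_derive_blapl_bound|].
      apply Rmult_le_pos; [left; apply buchstab_gt0; [exact Hw|lra]|left; apply exp_pos].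
  - assert (H : blapl w U (- s) + exp (- s * U) / s <= blapl w 1 (- s) + exp (- s * 1) / s).
    { apply (derive_le0_ge (fun U => blapl w U (- s) + exp (- s * U) / s)); [exact HU| |].
      - intros x _. apply continuous_Rplus; [now apply continuous_blapl_bound|].
        apply (ex_derive_continuous (fun U => exp (- s * U) / s)). auto_derive. trivial.
      - intros x Hx. exists (w x * exp (- s * x) + - exp (- s * x)). split.
        + apply (is_derive_plus (K := R_AbsRing) (V := R_NormedModule));
            [now apply is_derive_blapl_bound|]. auto_derive; [trivial|]. eqR. field. lra.
        + assert (W1 := buchstab_le1 w x Hw ltac:(lra)). assert (Pe := exp_pos (- s * x)). nra. }
    rewrite blapl_1 in H.
    assert (0 < exp (- s * U) / s) by (apply Rdiv_lt_0_compat; [apply exp_pos|exact Hs]).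
    assert (exp (- s * 1) / s <= 1 / s); [|lra].
    apply Rmult_le_compat_r; [left; now apply Rinv_0_lt_compat|].
    rewrite Rmult_1_r. apply exp_neg_le1. lra.
Qed.

(** With [exp (I (- s)) <= 1], the derivative of [bprod] is at most [(U * w U + 1) * exp (- s U)],
    whose integral over [s >= 0] is [w U + / U]; and [expV <= bprod]. *)
Lemma buchstab_lower (w : R -> R) (U : R) :
  buchstab_ext w -> 2 <= U -> exp (- euler_gamma) <= w U + / U.
Proof.
  intros Hw HU. apply euler_le_of_expV. intros x Hx.
  assert (PU : 0 < / U) by (apply Rinv_0_lt_compat; lra).
  assert (W0 := buchstab_gt0 w U Hw ltac:(lra)).
  assert (H : bprod w U x + (w U + / U) * exp (- x * U)
    <= bprod w U 0 + (w U + / U) * exp (- 0 * U)).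
  { apply (derive_le0_ge (fun x => bprod w U x + (w U + / U) * exp (- x * U))); [lra| |].
    - intros s _. apply continuous_Rplus.
      + apply (is_derive_continuous _ _ _ (is_derive_bprod w U s Hw HU)).
      + apply (ex_derive_continuous (fun x => (w U + / U) * exp (- x * U))). auto_derive. trivial.
    - intros s Hs. eexists. split.
      + apply (is_derive_plus (K := R_AbsRing) (V := R_NormedModule)).
        * now apply is_derive_bprod.
        * apply (is_derive_eq _ _ (- (U * w U * exp (- s * U) + exp (- s * U)))); [|reflexivity].
          auto_derive; [trivial|]. eqR. field. lra.
      + assert (B := blapl_window w U s Hw HU ltac:(lra)).
        assert (F : exp (I (- s)) <= 1) by (rewrite <- exp_0; apply exp_le, I_nonpos; lra).
        assert (P := exp_pos (I (- s))). assert (Pe := exp_pos (- s * U)).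
        set (k := exp (- s) * (blapl w U (- s) - blapl w (U - 1) (- s))) in *.
        assert (0 <= U * w U * exp (- s * U)) by (apply Rmult_le_pos; [nra|lra]).
        change (exp (I (- s)) * (k + U * w U * exp (- s * U)) +
          - (U * w U * exp (- s * U) + exp (- s * U)) <= 0). nra. }
  rewrite bprod_0, Ropp_0, Rmult_0_l, exp_0 in H.
  assert (B := proj1 (blapl_bounds w U x Hw ltac:(lra) Hx)).
  assert (V : 0 <= expV x) by (rewrite <- expV_0; left; now apply expV_lt).
  assert (Pe := exp_pos (- x * U)).
  assert (0 <= (w U + / U) * exp (- x * U)) by (apply Rmult_le_pos; lra).
  unfold bprod in H. nra.
Qed.

Lemma buchstab_upper (w : R -> R) (U : R) :
  buchstab_ext w -> 2 <= U -> w U <= exp (- euler_gamma) + / U.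
Proof.
  intros Hw HU. set (a := exp (- euler_gamma)). assert (Pa : 0 < a) by apply exp_pos.
  assert (A1 : a <= 1) by (apply euler_le_of_expV; intros x Hx; apply expV_le1; lra).
  assert (W0 := buchstab_gt0 w U Hw ltac:(lra)).
  (* The integral over [s >= 0] of [U * w U * exp (- s (U + 1))], a minorant of the derivative of
     [bprod] because [I (- s) >= - s]. *)
  set (c := w U * U / (U + 1)).
  assert (Pc : 0 < c) by (apply Rdiv_lt_0_compat; nra).
  assert (B : forall x, 0 < x -> c * (1 - 1 / x) <= a * (1 + 1 / x)).
  { intros x Hx.
    assert (H : bprod w U 0 + c * exp (- 0 * (U + 1)) <= bprod w U x + c * exp (- x * (U + 1))).
    { apply (derive_ge0_le (fun x => bprod w U x + c * exp (- x * (U + 1)))); [lra| |].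
      - intros s _. apply continuous_Rplus.
        + apply (is_derive_continuous _ _ _ (is_derive_bprod w U s Hw HU)).
        + apply (ex_derive_continuous (fun x => c * exp (- x * (U + 1)))). auto_derive. trivial.
      - intros s Hs. eexists. split.
        + apply (is_derive_plus (K := R_AbsRing) (V := R_NormedModule)).
          * now apply is_derive_bprod.
          * apply (is_derive_eq _ _ (- (U * w U * exp (- s * (U + 1))))); [|reflexivity].
            auto_derive; [trivial|]. unfold c. eqR. field. lra.
        + assert (Bw := blapl_window w U s Hw HU ltac:(lra)).
          assert (F : exp (- s) <= exp (I (- s))) by (apply exp_le, I_lower; lra).
          assert (P := exp_pos (- s)). assert (Pe := exp_pos (- s * U)).
          set (k := exp (- s) * (blapl w U (- s) - blapl w (U - 1) (- s))) in *.
          replace (- s * (U + 1)) with (- s + - s * U) by ring. rewrite exp_plus.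
          assert (0 <= U * w U * exp (- s * U)) by (apply Rmult_le_pos; [nra|lra]).
          change (0 <= exp (I (- s)) * (k + U * w U * exp (- s * U)) +
            - (U * w U * (exp (- s) * exp (- s * U)))). nra. }
    rewrite bprod_0, Ropp_0, Rmult_0_l, exp_0 in H.
    destruct (blapl_bounds w U x Hw ltac:(lra) Hx) as [B0 B1].
    assert (V : 0 <= expV x) by (rewrite <- expV_0; left; now apply expV_lt).
    assert (Va := expV_le_euler x). fold a in Va. unfold bprod in H.
    assert (E : exp (- x * (U + 1)) <= 1 / x).
    { replace (- x * (U + 1)) with (- (x * (U + 1))) by ring. rewrite exp_Ropp.
      unfold Rdiv. rewrite Rmult_1_l. apply Rinv_le_contravar; [exact Hx|].
      assert (G := exp_ge_1px (x * (U + 1))). nra. }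
    assert (Ix : 0 < 1 / x) by (apply Rdiv_lt_0_compat; lra).
    apply Rle_trans with (expV x * (1 + blapl w U (- x))); [nra|].
    apply Rmult_le_compat; lra. }
  assert (Ca : c <= a).
  { destruct (Rle_or_lt c a) as [|N]; [assumption|exfalso].
    (* [c * (1 - 1 / x) = a * (1 + 1 / x)] at [x = (c + a) / (c - a)]; one more unit contradicts
       [B]. *)
    set (x := (c + a) / (c - a) + 1).
    assert (Px : 0 < (c + a) / (c - a)) by (apply Rdiv_lt_0_compat; lra).
    assert (Bx := B x ltac:(unfold x; lra)).
    apply (Rmult_le_compat_r x) in Bx; [|unfold x; lra].
    replace (c * (1 - 1 / x) * x) with (c * x - c) in Bx by (field; unfold x; lra).
    replace (a * (1 + 1 / x) * x) with (a * x + a) in Bx by (field; unfold x; lra).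
    assert (Ex : (c - a) * x = (c + a) + (c - a)) by (unfold x; field; lra). lra. }
  unfold c in Ca. apply Rle_div_l in Ca; [|lra].
  apply (Rmult_le_reg_r U); [lra|]. rewrite Rmult_plus_distr_r, Rinv_l by lra. lra.
Qed.

Lemma buchstab_dist_lt (w r : R -> R) (u : R) :
  buchstab_ext w -> dickman_ext r -> 1 <= u -> Rabs (w u - exp (- euler_gamma)) < r u.
Proof.
  intros Hw Hr Hu. set (a := exp (- euler_gamma)).
  assert (T := dickman_tail_lt r u (u + 1) Hr Hu ltac:(lra)).
  (* The strict decrease over [[u, u + 1]] is slack that survives for every later [v]; [v] is then
     taken so large that the error [/ v] is below it. *)
  set (e := r u + RInt r 0 u - (r (u + 1) + RInt r 0 (u + 1))).
  assert (Pe : 0 < e) by (unfold e; lra).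
  set (v := u + 2 + 2 / e).
  assert (P2 : 0 < 2 / e) by (apply Rdiv_lt_0_compat; lra).
  assert (T2 : r v + RInt r 0 v <= r (u + 1) + RInt r 0 (u + 1)).
  { left. apply dickman_tail_lt; auto; unfold v; lra. }
  assert (L := buchstab_abs_le w r u v Hw Hr Hu ltac:(unfold v; lra)).
  assert (B1 := buchstab_lower w v Hw ltac:(unfold v; lra)).
  assert (B2 := buchstab_upper w v Hw ltac:(unfold v; lra)). fold a in B1, B2.
  assert (Pv := dickman_gt0 r v Hr).
  assert (Iv : / v < e).
  { assert (E : / (2 / e) = e / 2) by (field; lra).
    apply Rlt_trans with (/ (2 / e)); [|rewrite E; lra].
    apply Rinv_lt_contravar; [apply Rmult_lt_0_compat; unfold v; lra|unfold v; lra]. }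
  apply Rabs_le_between in L. apply Rabs_def1; unfold e in *; lra.
Qed.

(** * From the functions on half-lines to continuous extensions, and one-sided derivatives *)

Lemma continuous_clamp (f : R -> R) (a b x : R) :
  a <= b -> continuous_on (fun u => a <= u) f -> continuous (fun t => f (Rmax b t)) x.
Proof.
  intros Hab C P HP.
  assert (L : a <= Rmax b x) by (apply Rle_trans with b; [exact Hab|apply Rmax_l]).
  destruct (C (Rmax b x) L P HP) as [e He]. exists e. intros y Hy. apply He.
  - assert (B : Rabs (y - x) < e) by exact Hy.
    change (Rabs (Rmax b y - Rmax b x) < e). apply Rle_lt_trans with (2 := B).
    unfold Rmax. destruct (Rle_dec b y), (Rle_dec b x); unfold Rabs; repeat destruct Rcase_abs; lra.
  - apply Rle_trans with b; [exact Hab|apply Rmax_l].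
Qed.

Lemma dickman_ext_of (rho : R -> R) :
  is_dickman rho -> dickman_ext (fun t => rho (Rmax 1 t)).
Proof.
  intros (C & H1 & D). split; [|split].
  - intros x. apply (continuous_clamp rho 0); [lra|exact C].
  - intros x Hx. rewrite Rmax_left by lra. apply H1. lra.
  - intros x Hx. destruct (D x Hx) as (d & Dd & E).
    assert (Solve : forall t c, 0 < t -> t * c + rho (x - 1) = 0 -> c = - (rho (x - 1) / t)).
    { intros t c Ht Hc. replace (rho (x - 1)) with (- (t * c)) by lra. field. lra. }
    replace (rho (Rmax 1 (x - 1))) with (rho (x - 1)).
    + apply (is_derive_eq _ _ d); [|apply Solve; [lra|exact E]].
      apply (is_derive_ext_loc rho); [|exact Dd].
      assert (L : locally x (fun s => 1 < s)) by (apply open_gt; lra).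
      revert L. apply filter_imp. intros s Hs. now rewrite Rmax_right by lra.
    + destruct (Rle_or_lt 1 (x - 1)); [now rewrite Rmax_right|].
      rewrite Rmax_left by lra. rewrite !H1; lra.
Qed.

Lemma buchstab_ext_of (omega : R -> R) :
  is_buchstab omega -> buchstab_ext (fun t => omega (Rmax 1 t)).
Proof.
  intros (C & H12 & D). split; [|split; [|split]].
  - intros x. apply (continuous_clamp omega 1); [lra|exact C].
  - intros x Hx. rewrite Rmax_left by lra. rewrite H12 by lra. field.
  - intros x Hx. rewrite Rmax_right by lra. apply H12. exact Hx.
  - intros x Hx. rewrite Rmax_right by lra.
    apply (is_derive_ext_loc (fun v => v * omega v)); [|now apply D].
    assert (L : locally x (fun s => 1 < s)) by (apply open_gt; lra).
    revert L. apply filter_imp. intros s Hs. now rewrite Rmax_right by lra.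
Qed.

Lemma is_derive_right (f : R -> R) (x d : R) : is_derive f x d -> is_right_derive f x d.
Proof.
  intros D. apply is_derive_Reals in D. apply filterlim_locally. intros eps.
  destruct (D eps (cond_pos eps)) as [del Hdel]. exists del. intros y Hy Hxy.
  assert (B : Rabs (y - x) < del) by exact Hy.
  specialize (Hdel (y - x) ltac:(lra) B). rewrite Rplus_minus in Hdel. exact Hdel.
Qed.

Lemma right_derive_bound (f : R -> R) (x d K : R) :
  is_right_derive f x d -> (forall y, x < y -> Rabs (f y - f x) <= K * (y - x)) -> Rabs d <= K.
Proof.
  intros D H. destruct (Rle_or_lt (Rabs d) K) as [|N]; [assumption|exfalso].
  assert (P : 0 < Rabs d - K) by lra.
  assert (L := proj1 (filterlim_locally _ _) D (mkposreal _ P)).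
  assert (Lx : at_right x (fun y => x < y)) by (exists (mkposreal _ P); intros y _ Hy; exact Hy).
  destruct (filter_ex _ (filter_and _ _ L Lx)) as (y & By & Hy).
  assert (B : Rabs ((f y - f x) / (y - x) - d) < Rabs d - K) by exact By.
  assert (Q : Rabs ((f y - f x) / (y - x)) <= K).
  { unfold Rdiv. rewrite Rabs_mult, (Rabs_pos_eq (/ (y - x))) by (left; apply Rinv_0_lt_compat; lra).
    apply (Rle_div_l _ _ (y - x)); [lra|]. now apply H. }
  assert (T := Rabs_triang_inv d ((f y - f x) / (y - x))). rewrite Rabs_minus_sym in B. lra.
Qed.

Lemma buchstab_right_at1 (omega : R -> R) : is_buchstab omega -> is_right_derive omega 1 (-1).
Proof.
  intros (_ & H12 & _).
  apply (filterlim_ext_loc (fun y => - / y)).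
  - exists (mkposreal 1 Rlt_0_1). intros y Hy Hy1.
    assert (B : Rabs (y - 1) < 1) by exact Hy. apply Rabs_def2 in B.
    rewrite !H12 by lra. field. lra.
  - apply (filterlim_filter_le_1 (F := locally 1)); [apply filter_le_within|].
    replace (-1) with (- / 1) by field.
    apply (ex_derive_continuous (fun y => - / y)). auto_derive. lra.
Qed.

Lemma buchstab_left_at2 (omega : R -> R) : is_buchstab omega -> is_left_derive omega 2 (- / 4).
Proof.
  intros (_ & H12 & _).
  apply (filterlim_ext_loc (fun y => - / (2 * y))).
  - exists (mkposreal 1 Rlt_0_1). intros y Hy Hy2.
    assert (B : Rabs (y - 2) < 1) by exact Hy. apply Rabs_def2 in B.
    rewrite !H12 by lra. field. lra.
  - apply (filterlim_filter_le_1 (F := locally 2)); [apply filter_le_within|].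
    replace (- / 4) with (- / (2 * 2)) by field.
    apply (ex_derive_continuous (fun y => - / (2 * y))). auto_derive. lra.
Qed.

Lemma buchstab_derive_exists (omega : R -> R) (u : R) :
  is_buchstab omega -> 1 <= u -> exists d, is_buchstab_derive omega u d.
Proof.
  intros Ho Hu. assert (Hw := buchstab_ext_of omega Ho).
  destruct (Req_dec u 1) as [->|N1]; [exists (-1); left; split; [reflexivity|now apply buchstab_right_at1]|].
  destruct (Req_dec u 2) as [->|N2].
  { exists (- / 4). right; left. split; [reflexivity|left; now apply buchstab_left_at2]. }
  assert (G : exists d, is_derive (fun t => omega (Rmax 1 t)) u d).
  { destruct (Rlt_or_le u 2) as [L|L]; eexists.
    - apply is_derive_buchstab_12; [exact Hw|lra].
    - apply is_derive_buchstab; [exact Hw|lra]. }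
  destruct G as [d D]. exists d. right; right. split; [exact N1|split; [exact N2|]].
  apply (is_derive_ext_loc (fun t => omega (Rmax 1 t))); [|exact D].
  assert (L : locally u (fun s => 1 < s)) by (apply open_gt; lra).
  revert L. apply filter_imp. intros s Hs. now rewrite Rmax_right by lra.
Qed.

(** For [y > u], [|omega y - omega u|] is at most the integral of [rho] over [[u, y]], hence at most
    [rho u * (y - u)]: this settles every right derivative, including those at 1 and 2. Only the
    left derivative at 2 is apart; uniqueness of limits makes it [- 1/4]. *)
Lemma buchstab_derive_le (rho omega : R -> R) (u d : R) :
  is_dickman rho -> is_buchstab omega -> 1 <= u ->
  is_buchstab_derive omega u d -> Rabs d <= rho u.
Proof.
  intros Hd Ho Hu Hod. assert (Hr := dickman_ext_of rho Hd). assert (Hw := buchstab_ext_of omega Ho).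
  assert (K : is_right_derive omega u d -> Rabs d <= rho u).
  { intros D. apply (right_derive_bound omega u d (rho u) D). intros y Hy.
    assert (A := buchstab_abs_le _ _ u y Hw Hr Hu ltac:(lra)). cbv beta in A.
    assert (B := primitive_le _ u y Hr ltac:(lra)). cbv beta in B.
    rewrite !Rmax_right in A by lra. rewrite Rmax_right in B by lra. lra. }
  destruct Hod as [[_ D]|[[E [D|D]]|[_ [_ D]]]]; auto.
  - subst u. replace d with (- / 4).
    + assert (A := dickman_2_gt _ Hr). cbv beta in A. rewrite Rmax_right in A by lra.
      rewrite Rabs_Ropp, Rabs_pos_eq; lra.
    + apply (filterlim_locally_unique (F := at_left 2) _ _ _ (buchstab_left_at2 omega Ho) D).
  - apply K, is_derive_right, D.
Qed.

Theorem corollary1 :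
  forall rho omega xi : R -> R,
    is_dickman rho -> is_buchstab omega -> is_xi xi ->
    forall u : R, 1 <= u ->
      Rabs (omega u - exp (- euler_gamma)) < rho u < rho_tilde xi u
      /\ (exists d, is_buchstab_derive omega u d)
      /\ (forall d, is_buchstab_derive omega u d ->
            Rabs d <= rho u < rho_tilde xi u).
Proof.
  intros rho omega xi Hd Ho [Hx1 Hx] u Hu.
  assert (Hr := dickman_ext_of rho Hd). assert (Hw := buchstab_ext_of omega Ho).
  (* The equation for [xi] reads [xi * I'(xi) = u * xi]; dividing needs [xi > 0], and [u = 1] is the
     value [I'(0) = 1]. *)
  assert (Ex : expmom 0 (xi u) = u).
  { destruct (Rle_lt_or_eq_dec _ _ Hu) as [L|<-]; [|rewrite Hx1; apply expmom0_0].
    destruct (Hx u L) as [P E]. apply (Rmult_eq_reg_l (xi u)); [|lra].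
    rewrite expmom0_mul, E. ring. }
  assert (A : Rabs (omega u - exp (- euler_gamma)) < rho u).
  { assert (A := buchstab_dist_lt _ _ u Hw Hr Hu). cbv beta in A.
    now rewrite !Rmax_right in A by lra. }
  assert (B : rho u < rho_tilde xi u).
  { assert (B := dickman_saddle _ u (xi u) Hr Hu Ex). cbv beta in B.
    rewrite Rmax_right in B by lra. unfold rho_tilde. now rewrite Derive_n_I_2. }
  split; [now split|]. split; [now apply buchstab_derive_exists|].
  intros d Dd. split; [|exact B]. now apply (buchstab_derive_le rho omega u d).
Qed.
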